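(* Let $H:[0,T]\times\mathbb{R}^n\times\mathbb{R}^n\to\mathbb{R}$ satisfy (H1)–(H4) and (HLC), with $c(\cdot)$, each $k_R(\cdot)$ and $t\mapsto H(t,0,0)$ integrable on $[0,T]$, and let $g:\mathbb{R}^n\to\mathbb{R}$ be locally Lipschitz. Then for every $M>0$ there exists $\lambda_M\in L^1([0,T],\mathbb{R})$ such that for all $(t_0,x_0)\in[0,T]\times\bar B_M$ and every minimizer $\bar x(\cdot)$ of $$\Theta[x(\cdot)]=g(x(T))+\int_{t_0}^T H^*(t,x(t),\dot x(t))\,dt\quad\text{over } x(\cdot)\in\mathcal{A}([t_0,T],\mathbb{R}^n),\ x(t_0)=x_0,$$ one has $\big|\big(\dot{\bar x}(t),H^*(t,\bar x(t),\dot{\bar x}(t))\big)\big|\le\lambda_M(t)$ for a.e. $t\in[t_0,T]$. Additionally, if $H$, $k_R(\cdot)$ and $c(\cdot)$ are continuous, then there exists a continuous $\lambda_M$ satisfying this inequality.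
   Context: Hypotheses: (H1) $H(\cdot,x,p)$ Lebesgue measurable; (H2) $H(t,\cdot,\cdot)$ continuous; (H3) $H(t,x,\cdot)$ convex; (H4) there is measurable $c\ge0$ with $|H(t,x,p)-H(t,x,q)|\le c(t)(1+|x|)|p-q|$; (HLC) for each $R>0$ there is measurable $k_R\ge0$ with $|H(t,x,p)-H(t,y,p)|\le k_R(t)(1+|p|)|x-y|$ for $x,y\in\bar B_R$ (closed ball radius $R$ about $0$), all $p$. $H^*(t,x,v)=\sup_p\{\langle v,p\rangle-H(t,x,p)\}$. $\mathcal{A}$ denotes absolutely continuous functions. *)

(* Defs.v *)
From HB Require Import structures.
From mathcomp Require Import all_boot all_order all_algebra.
From mathcomp Require Import all_classical all_reals all_analysis.

Set Implicit Arguments.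
Unset Strict Implicit.
Unset Printing Implicit Defensive.

Import Order.TTheory GRing.Theory Num.Theory.
Import numFieldNormedType.Exports.

Local Open Scope classical_set_scope.
Local Open Scope ring_scope.

(* The real line equipped with the Lebesgue (= completed) sigma-algebra. *)
Notation LebR R := (caratheodory_type (R:=R)
     (T:=lebesgue_stieltjes_measure_ocitv_type__canonical__measurable_structure_SemiRingOfSets R)
     (wlength idfun)^*%mu).

Notation leb R := (@completed_lebesgue_measure R).

Section Defs.
Context {R : realType} {n : nat}.

Definition dotv (u v : 'rV[R]_n) : R := \sum_(i < n) u ord0 i * v ord0 i.
Definition enorm (u : 'rV[R]_n) : R := Num.sqrt (dotv u u).

Definition enorm_pair (v : 'rV[R]_n) (h : R) : R :=
  Num.sqrt (dotv v v + h ^+ 2).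

Definition Hstar (H : R -> 'rV[R]_n -> 'rV[R]_n -> R) (t : R)
    (x v : 'rV[R]_n) : \bar R :=
  ereal_sup [set ((dotv v p - H t x p)%:E) | p in [set: 'rV[R]_n]].

Definition abs_cont (a b : R) (x : R -> 'rV[R]_n) : Prop :=
  forall e : R, 0 < e -> exists2 d : R, 0 < d &
    forall (k : nat) (u v : 'I_k -> R),
      (forall i, a <= u i /\ u i <= v i /\ v i <= b) ->
      (forall i j, i != j -> v i <= u j \/ v j <= u i) ->
      \sum_(i < k) (v i - u i) < d ->
      \sum_(i < k) enorm (x (v i) - x (u i)) < e.

Definition locally_lipschitz (g : 'rV[R]_n -> R) : Prop :=
  forall x0 : 'rV[R]_n, exists2 r : R, 0 < r & exists L : R,
    forall y z : 'rV[R]_n, enorm (y - x0) <= r -> enorm (z - x0) <= r ->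
      `|g y - g z| <= L * enorm (y - z).

Definition admissible (T t0 : R) (x0 : 'rV[R]_n) (x : R -> 'rV[R]_n) : Prop :=
  abs_cont t0 T x /\ x t0 = x0.

Definition Theta (H : R -> 'rV[R]_n -> 'rV[R]_n -> R) (g : 'rV[R]_n -> R)
    (T t0 : R) (x : R -> 'rV[R]_n) : \bar R :=
  ((g (x T))%:E +
   \int[leb R]_(t in (`[t0, T] : set (LebR R))) Hstar H t (x t) (derive1 x t))%E.

Definition minimizer (H : R -> 'rV[R]_n -> 'rV[R]_n -> R) (g : 'rV[R]_n -> R)
    (T t0 : R) (x0 : 'rV[R]_n) (xb : R -> 'rV[R]_n) : Prop :=
  admissible T t0 x0 xb /\
  forall x, admissible T t0 x0 x -> (Theta H g T t0 xb <= Theta H g T t0 x)%E.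

Definition bounded_by (H : R -> 'rV[R]_n -> 'rV[R]_n -> R) (xb : R -> 'rV[R]_n)
    (lam : R -> R) (t : R) : Prop :=
  Hstar H t (xb t) (derive1 xb t) \is a fin_num /\
  enorm_pair (derive1 xb t) (fine (Hstar H t (xb t) (derive1 xb t))) <= lam t.

End Defs.

(* Main.v *)
(* Since [dom H^*(t,x,.)] lies in the ball of radius [c(t)(1+|x|)] by (H4), Gronwall
   bounds a minimizer by some [r] and its velocity [f] by [r c(t)]. To bound the
   cost [h = H^*(t,x,f)], let [E] be the set where [h > lam1], with
   [lam1 = |H(t,0,0)| + r k_r + Q c], and stop the arc on [E]. The new arc is off by
   at most [r \int_E c], and its velocity solves the epigraphical inclusion up to an
   error of integral [O(\int_E c)]. Filippov's iteration repairs this error (the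
   required selections are subgradients of infimal convolutions) and yields an
   admissible arc whose cost exceeds the original one by at most
   [\int_E (|H(t,0,0)| + r k_r + Q c) - \int_E h]. Minimality gives
   [\int_E (h - lam1) <= 0], so [E] is null. The same
   [lam = lam1 + r c] is continuous when [H], [k_r], [c] are. *)

Require Import Defs.
From HB Require Import structures.
From mathcomp Require Import all_boot all_order all_algebra.
From mathcomp Require Import all_classical all_reals all_analysis.
From mathcomp Require Import measurable_realfun.
From mathcomp Require Import ring lra.
Import Order.TTheory GRing.Theory Num.Theory.
Import numFieldNormedType.Exports.
Local Open Scope classical_set_scope.
Local Open Scope ring_scope.

(** * Euclidean norm *)

(** The obstacle: [H^*(t,x,v)] can be [+oo] arbitrarily close to points where it is finite, so the
    cost of a perturbed arc cannot be compared directly. The pair (velocity, cost) is therefore kept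
    in dual form, [<u, p> <= H(t,y,p) + al] for all [p], where a perturbation enters additively as
    [ga (1 + |p|)]: a defect [ga] in the cost and [ga] in the velocity. Correcting the velocity
    moves the arc, and by (HLC) this creates a new defect [K |dy|] of the same shape. Hence an
    iteration, whose weight [exp (\int 2 K)] halves the defect at each round. Velocity [0] is used
    on [E] because (H4) bounds its defect by a multiple of [c], so that the total is proportional to
    [\int_E c], which a term [Q c] in [lam1] can absorb. [Q] depends only on [r], on a Lipschitz
    constant of [g] and on bounds for integrals of [k_r]; it is fixed before [E], so nothing is
    circular. Measurability of the corrected velocities comes from explicit formulas made of
    countable infima. Results on Borel functions reach Lebesgue measurable ones through Borel
    versions equal almost everywhere. *)

Section Euclid.
Context {R : realType} {n : nat}.
Implicit Types (u v w : 'rV[R]_n) (a : R).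

Lemma dotvC u v : dotv u v = dotv v u.
Proof. by apply: eq_bigr => i _; rewrite mulrC. Qed.

Lemma dotvDl u v w : dotv (u + v) w = dotv u w + dotv v w.
Proof. by rewrite -big_split; apply: eq_bigr => i _; rewrite mxE mulrDl. Qed.

Lemma dotvZl a u v : dotv (a *: u) v = a * dotv u v.
Proof. by rewrite mulr_sumr; apply: eq_bigr => i _; rewrite mxE mulrA. Qed.

Lemma dotvNl u v : dotv (- u) v = - dotv u v.
Proof. by rewrite -scaleN1r dotvZl mulN1r. Qed.

Lemma dotvDr u v w : dotv u (v + w) = dotv u v + dotv u w.
Proof. by rewrite dotvC dotvDl !(dotvC u). Qed.

Lemma dotvZr a u v : dotv u (a *: v) = a * dotv u v.
Proof. by rewrite dotvC dotvZl dotvC. Qed.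

Lemma dotvNr u v : dotv u (- v) = - dotv u v.
Proof. by rewrite dotvC dotvNl dotvC. Qed.

Lemma dot0v v : dotv 0 v = 0.
Proof. by rewrite -(scale0r 0) dotvZl mul0r. Qed.

Lemma dotv0 v : dotv v 0 = 0.
Proof. by rewrite dotvC dot0v. Qed.

Lemma dotv_ge0 u : 0 <= dotv u u.
Proof. by apply: sumr_ge0 => i _; rewrite -expr2 sqr_ge0. Qed.

Lemma enorm_ge0 u : 0 <= enorm u.
Proof. exact: sqrtr_ge0. Qed.

Lemma enorm_sqr u : enorm u ^+ 2 = dotv u u.
Proof. by rewrite sqr_sqrtr ?dotv_ge0. Qed.

Lemma enorm0 : enorm (0 : 'rV[R]_n) = 0.
Proof. by rewrite /enorm dot0v sqrtr0. Qed.

Lemma enormZ a u : enorm (a *: u) = `|a| * enorm u.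
Proof.
by rewrite /enorm dotvZl dotvZr mulrA -expr2 sqrtrM ?sqr_ge0// sqrtr_sqr.
Qed.

Lemma enormN u : enorm (- u) = enorm u.
Proof. by rewrite -scaleN1r enormZ normrN1 mul1r. Qed.

Lemma enormB u v : enorm (u - v) = enorm (v - u).
Proof. by rewrite -enormN opprB. Qed.

Lemma enorm_eq0 u : enorm u = 0 -> u = 0.
Proof.
move=> u0; have /eqP := enorm_sqr u; rewrite u0 expr0n/= eq_sym.
rewrite psumr_eq0; last by move=> i _; rewrite -expr2 sqr_ge0.
move=> /allP ui; apply/rowP => i; rewrite mxE.
by have := ui i (mem_index_enum i); rewrite /= mulf_eq0 orbb => /eqP.
Qed.

(** The square of [|v| u - |u| v] equals [2 |u| |v| (|u| |v| - <u, v>)]. *)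
Lemma dotv_le u v : dotv u v <= enorm u * enorm v.
Proof.
have [v0|v0] := eqVneq (enorm v) 0.
  by rewrite (enorm_eq0 _ v0) dotv0 enorm0 mulr0.
have vpos : 0 < enorm v by rewrite lt_neqAle eq_sym v0 enorm_ge0.
have := dotv_ge0 (enorm v *: u - enorm u *: v).
rewrite !(dotvDl, dotvDr, dotvNl, dotvNr, dotvZl, dotvZr) -!enorm_sqr (dotvC v u).
have [u0|u0] := eqVneq (enorm u) 0.
  by move=> _; rewrite (enorm_eq0 _ u0) dot0v enorm0 mul0r.
have upos : 0 < enorm u by rewrite lt_neqAle eq_sym u0 enorm_ge0.
set X := (X in 0 <= X).
have -> : X = 2 * (enorm u * enorm v) * (enorm u * enorm v - dotv u v).
  by rewrite /X; ring.
by rewrite pmulr_rge0 ?subr_ge0// mulr_gt0 ?mulr_gt0.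
Qed.

Lemma enormD u v : enorm (u + v) <= enorm u + enorm v.
Proof.
rewrite -(@ler_pXn2r _ 2)// ?nnegrE ?addr_ge0 ?enorm_ge0// sqrrD.
rewrite !enorm_sqr dotvDl !dotvDr (dotvC v u).
have := dotv_le u v; lra.
Qed.

Lemma enorm_sub_le u v w : enorm (u - w) <= enorm (u - v) + enorm (v - w).
Proof. by rewrite (_ : u - w = (u - v) + (v - w)) ?enormD// addrA subrK. Qed.

Lemma enorm_coord u i : `|u ord0 i| <= enorm u.
Proof.
rewrite -sqrtr_sqr /enorm ler_sqrt ?dotv_ge0// /dotv (bigD1 i)//= expr2.
by rewrite lerDl sumr_ge0// => j _; rewrite -expr2 sqr_ge0.
Qed.

Lemma enorm_le_sum u : enorm u <= \sum_i `|u ord0 i|.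
Proof.
rewrite -(@ler_pXn2r _ 2)// ?nnegrE ?enorm_ge0 ?sumr_ge0//.
rewrite enorm_sqr expr2 mulr_suml; apply: ler_sum => i _.
rewrite (le_trans (ler_norm _))// normrM ler_wpM2l//.
by rewrite (bigD1 i)//= lerDl sumr_ge0.
Qed.

Lemma enorm_le_norm u : enorm u <= n%:R * `|u|.
Proof.
apply: (le_trans (enorm_le_sum u)).
apply: (@le_trans _ _ (\sum_(i < n) `|u|)); last first.
  by rewrite sumr_const card_ord mulr_natl.
apply: ler_sum => i _; rewrite [leRHS]/Num.norm/= mx_normrE.
exact: (le_bigmax _ (fun ij => `|u ij.1 ij.2|) (ord0, i)).
Qed.

(** Turns infima and suprema over vectors into countable ones, as measurability requires. *)
Lemma rat_dense_rV u (e : R) : 0 < e ->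
  exists q : 'rV[rat]_n, enorm (u - map_mx ratr q) < e.
Proof.
move=> e0; pose d := e / n.+1%:R.
have d0 : 0 < d by rewrite divr_gt0.
have /choice[q qP] : forall i, exists q : rat, `|u ord0 i - ratr q| < d.
  move=> i; have [|q] := @rat_in_itvoo _ (u ord0 i - d) (u ord0 i + d).
    by rewrite ltrD2l gtrN.
  rewrite in_itv/= => /andP[q1 q2]; exists q; rewrite ltr_norml; lra.
exists (\row_i q i); apply: (le_lt_trans (enorm_le_sum _)).
apply: (@le_lt_trans _ _ (\sum_(i < n) d)).
  by apply: ler_sum => i _; rewrite !mxE ltW.
rewrite sumr_const card_ord -mulr_natl mulrA mulrC ltr_pdivrMl//.
by rewrite ltr_pM2r// ltr_nat.
Qed.

End Euclid.

(** * Subgradients by iterated directional derivatives *)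

Section Infimum.
Context {R : realType} {I : Type}.
Implicit Types f : I -> R.

Lemma inf_range_le f i (m : R) : (forall j, m <= f j) -> inf (range f) <= f i.
Proof.
by move=> mf; apply: ge_inf; [exists m => _ [j _ <-]|exists i].
Qed.

Lemma le_inf_range f (i0 : I) (m : R) : (forall j, m <= f j) -> m <= inf (range f).
Proof.
move=> mf; apply: lb_le_inf; first by exists (f i0), i0.
by move=> _ [j _ <-].
Qed.

End Infimum.

Section DirectionalDerivative.
Context {R : realType} {n : nat}.
Notation V := 'rV[R]_n.
Implicit Types (F G S : V -> R) (x p q e : V) (L : R).

Definition convex_fun_rV F := forall p q (a : R), 0 <= a -> a <= 1 ->
  F (a *: p + (1 - a) *: q) <= a * F p + (1 - a) * F q.

Definition lip_rV L F := forall p q, F p - F q <= L * enorm (p - q).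

(** For convex [F] the quotient decreases with the step, so the infimum over the steps [1/(m+1)] is
    the one-sided directional derivative at [x]. Countably many steps keep it measurable in a
    parameter. *)
Definition dquot F x p (m : nat) : R :=
  m.+1%:R * (F (x + m.+1%:R^-1 *: p) - F x).

Definition ddir F x p : R := inf (range (dquot F x p)).

Section convex_lipschitz.
Variables (F : V -> R) (L : R).
Hypothesis cF : convex_fun_rV F.
Hypothesis lF : lip_rV L F.

Lemma dquot_ge x p m : - (L * enorm p) <= dquot F x p m.
Proof.
rewrite /dquot [leRHS]mulrC -ler_pdivrMr// mulNr lerNl opprB.
apply: le_trans (lF _ _) _; rewrite opprD addrA subrr add0r enormN enormZ.
by rewrite ger0_norm ?invr_ge0// mulrCA mulrC.
Qed.

(** [x + r p] is the convex combination of [x + s p] and [x] with weight [r / s]. *)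
Lemma quotient_nondecreasing x p (r s : R) : 0 < r -> r <= s ->
  r^-1 * (F (x + r *: p) - F x) <= s^-1 * (F (x + s *: p) - F x).
Proof.
move=> r0 rs; have s0 := lt_le_trans r0 rs.
have := cF (x + s *: p) x (r / s) (ltW (divr_gt0 r0 s0)).
rewrite ler_pdivrMr// mul1r => /(_ rs).
rewrite (_ : _ *: _ + _ = x + r *: p); last first.
  rewrite scalerDr scalerA mulfVK ?gt_eqF// addrAC -scalerDl.
  by rewrite addrC addrCA subrr addr0 scale1r addrC.
move=> h; rewrite ler_pdivrMl// mulrA; lra.
Qed.

Lemma ddir_le x p (s : R) : 0 < s -> ddir F x p <= s^-1 * (F (x + s *: p) - F x).
Proof.
move=> s0; have [m] : exists m : nat, m.+1%:R^-1 <= s.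
  exists (Num.truncn s^-1); rewrite invf_ple ?posrE ?ltr0n//.
  by apply/ltW; exact: truncnS_gt.
move=> ms; apply: le_trans (@inf_range_le _ _ _ m _ (dquot_ge x p)) _.
rewrite /dquot -{1}(invrK m.+1%:R).
by apply: quotient_nondecreasing; rewrite // invr_gt0.
Qed.

Lemma ddir_ge x p (c : R) :
  (forall s, 0 < s -> c <= s^-1 * (F (x + s *: p) - F x)) -> c <= ddir F x p.
Proof.
move=> h; apply: (@le_inf_range _ _ _ 0%N) => m; rewrite /dquot -{1}(invrK m.+1%:R).
by apply: h; rewrite invr_gt0.
Qed.

Lemma ddir_le_lip x p : ddir F x p <= L * enorm p.
Proof.
apply: le_trans (@ddir_le x p 1 ltr01) _; rewrite invr1 mul1r scale1r.
by apply: le_trans (lF _ _) _; rewrite addrC addKr.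
Qed.

Lemma ddir_scale x p (l : R) : 0 < l -> ddir F x (l *: p) <= l * ddir F x p.
Proof.
move=> l0; rewrite mulrC -ler_pdivrMr//; apply: ddir_ge => s s0.
rewrite ler_pdivrMr//; apply: le_trans (@ddir_le _ _ (s / l) _) _.
  by rewrite divr_gt0.
rewrite scalerA mulfVK ?gt_eqF// invf_div.
by rewrite [leLHS]mulrAC -mulrA [leLHS]mulrC [X in X * l]mulrC.
Qed.

(** The midpoint of [x + d p] and [x + d q] is [x + (d/2)(p + q)]. Taking [d] below two arbitrary
    steps, monotonicity of the quotients bounds both of them at once. *)
Lemma ddir_add x p q : ddir F x (p + q) <= ddir F x p + ddir F x q.
Proof.
rewrite -lerBlDr; apply: ddir_ge => s s0.
rewrite lerBlDr -lerBlDl; apply: ddir_ge => r r0; rewrite lerBlDl.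
pose d := Num.min r s.
have d0 : 0 < d by rewrite lt_min r0.
have ds : d <= s by rewrite ge_min lexx orbT.
have dr : d <= r by rewrite ge_min lexx.
apply: le_trans (@ddir_le _ _ (d / 2) _) _; first by rewrite divr_gt0.
apply: le_trans (lerD (quotient_nondecreasing x p d s d0 ds)
                      (quotient_nondecreasing x q d r d0 dr)).
have <- : 2^-1 *: (x + d *: p) + 2^-1 *: (x + d *: q) = x + (d / 2) *: (p + q).
  rewrite -scalerDr addrACA -scalerDr -mulr2n. 
  rewrite [LHS]scalerDr scalerA [2^-1 * d]mulrC.
  by rewrite -[x *+ 2]scaler_nat scalerA mulVf// scale1r.
have := cF (x + d *: p) (x + d *: q) 2^-1.
rewrite invr_ge0 ler0n invf_le1// ler1n => /(_ isT isT).
have -> : 1 - 2^-1 = 2^-1 :> R by lra.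
set A := F (2^-1 *: _ + _); set B := F (x + d *: p); set C := F (x + d *: q).
move=> h; rewrite -mulrDr invf_div [X in _ <= X]mulrC ler_pdivlMr//.
have -> : 2 / d * (A - F x) * d = 2 * (A - F x).
  by rewrite mulrAC mulfVK ?gt_eqF.
lra.
Qed.

End convex_lipschitz.

(** One inequality suffices for homogeneity: using it at [l] and at [1/l] gives equality. *)
Definition sublinear_rV S := (forall p q, S (p + q) <= S p + S q) /\
  (forall (l : R) p, 0 < l -> S (l *: p) <= l * S p).

Lemma sublinear_ddir F L x : convex_fun_rV F -> lip_rV L F ->
  sublinear_rV (ddir F x).
Proof.
by move=> cF lF; split=> *; [exact: (ddir_add _ _ cF lF)|exact: (ddir_scale _ _ cF lF)].
Qed.

Lemma sublinear0 S : sublinear_rV S -> S 0 = 0.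
Proof.
move=> [Sa Sm]; have := Sa 0 0; have := Sm 2^-1 0.
by rewrite addr0 scaler0 invr_gt0 ltr0n => /(_ isT); lra.
Qed.

Lemma sublinear_convex S : sublinear_rV S -> convex_fun_rV S.
Proof.
move=> sS p q a a0 a1; have [Sa Sm] := sS; apply: le_trans (Sa _ _) _.
have Sm0 l r : 0 <= l -> S (l *: r) <= l * S r.
  by rewrite le_eqVlt => /predU1P[<-|/Sm//]; rewrite scale0r mul0r sublinear0.
by rewrite lerD// Sm0// subr_ge0.
Qed.

Lemma sublinear_lip S L : sublinear_rV S -> (forall p, S p <= L * enorm p) ->
  lip_rV L S.
Proof.
move=> [Sa _] SL p q; rewrite lerBlDr -{1}(subrK q p).
by apply: le_trans (Sa _ _) _; rewrite lerD2r.
Qed.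

Notation ev i := (delta_mx (ord0 : 'I_1) i : V).

(** Nesterov's lexicographic derivative of [F] at [0] along the axes listed in [s]. It replaces the
    choice in the Hahn-Banach theorem by a formula. *)
Definition hb_extension F (s : seq 'I_n) : V -> R :=
  foldl (fun G i => ddir G (ev i)) (ddir F 0) s.

(* Each step makes the functional odd along one more axis without destroying
   oddness along the previous ones, so the last one is linear. *)
Lemma hb_extensionP F L s : convex_fun_rV F -> lip_rV L F ->
  [/\ sublinear_rV (hb_extension F s), forall p, hb_extension F s p <= L * enorm p,
      forall p, hb_extension F s p <= ddir F 0 p &
      forall i, i \in s -> hb_extension F s (- ev i) <= - hb_extension F s (ev i)].
Proof.
move=> cF lF; elim/last_ind: s => [|s j [sub GL GF odd]].
  by split=> //; [exact: sublinear_ddir lF|exact: ddir_le_lip].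
rewrite /hb_extension foldl_rcons -/(hb_extension F s).
set G := hb_extension F s in sub GL GF odd *.
have cG := sublinear_convex _ sub; have lG := sublinear_lip _ _ sub GL.
have G'G e p : ddir G e p <= G p.
  apply: le_trans (ddir_le _ _ cG lG e p 1 ltr01) _.
  by rewrite invr1 mul1r scale1r lerBlDl; case: sub.
split=> [|p|p|i].
- exact: sublinear_ddir lG.
- exact: ddir_le_lip.
- exact: le_trans (G'G _ _) (GF _).
- rewrite mem_rcons inE => /predU1P[->|/odd Gi].
    apply: (@le_trans _ _ (- G (ev j))); last by rewrite lerN2.
    (* A step [1/2] leads from [e_j] to [e_j / 2], where homogeneity gives
       [G (e_j / 2) <= G e_j / 2]; the quotient is then at most [- G e_j]. *)
    have := ddir_le _ _ cG lG (ev j) (- ev j) 2^-1.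
    rewrite invr_gt0 ltr0n => /(_ isT) /le_trans; apply.
    rewrite invrK -[X in X + _ *: _]scale1r scalerN -scalerBl.
    have -> : 1 - 2^-1 = 2^-1 :> R by lra.
    have := sub.2 2^-1 (ev j); rewrite invr_gt0 ltr0n => /(_ isT); lra.
  by rewrite (le_trans (G'G _ _))// (le_trans Gi)// lerN2.
Qed.

Definition subgrad F : V := \row_i hb_extension F (enum 'I_n) (ev i).

(** Oddness on the axes gives [G q <= <w, q>] for the iterated derivative [G] and [w = subgrad F].
    At [q = - p], subadditivity turns this into [<w, p> <= G p], and [G] lies below the directional
    derivative of [F] at [0]. *)
Lemma subgradP F L p : convex_fun_rV F -> lip_rV L F ->
  dotv (subgrad F) p <= F p - F 0.
Proof.
move=> cF lF; have [sub GL GF odd] := hb_extensionP _ _ (enum 'I_n) cF lF.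
rewrite /subgrad; set G := hb_extension _ _ in sub GL GF odd *.
have GN q : G q <= dotv (\row_i G (ev i)) q.
  have GS (r : seq 'I_n) : G (\sum_(i <- r) q ord0 i *: ev i) <=
      \sum_(i <- r) G (q ord0 i *: ev i).
    elim: r => [|i r ih]; first by rewrite !big_nil (sublinear0 _ sub).
    by rewrite !big_cons (le_trans (sub.1 _ _))// lerD2l.
  rewrite {1}(row_sum_delta q); apply: le_trans (GS _) _.
  apply: ler_sum => i _; rewrite mxE mulrC.
  have [q0|q0|q0] := ltrgtP (q ord0 i) 0.
  - rewrite -[q ord0 i]opprK scaleNr -scalerN (le_trans (sub.2 _ _ _))//.
      by rewrite oppr_gt0.
    by rewrite opprK mulNr -mulrN (ler_wnM2l (ltW q0))// lerNr odd// mem_enum.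
  - exact: sub.2.
  - by rewrite q0 scale0r mul0r (sublinear0 _ sub).
have := GN (- p); have := sub.1 p (- p); rewrite subrr (sublinear0 _ sub) dotvNr.
have := GF p; have := ddir_le _ _ cF lF 0 p 1 ltr01.
rewrite invr1 mul1r scale1r add0r; lra.
Qed.

End DirectionalDerivative.

(** * Measurable choice of a dominated linear functional near a given one *)

Section Sandwich.
Context {R : realType} {n : nat}.
Notation V := 'rV[R]_n.
Implicit Types (H : V -> R) (v p q : V) (a g : R).

Definition ratv (q : 'rV[rat]_n) : V := map_mx ratr q.

Definition infconv H a v g p : R :=
  inf (range (fun q : 'rV[rat]_n =>
    H (ratv q) + a + dotv v (p - ratv q) + g * enorm (p - ratv q))).

(* A measurable choice of a point [w] with [|w - v| <= g] and [<w, .> <= H + a]: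
   under [<v, .> - g |.| <= H + a], the infimal convolution of [H + a] with
   [<v, .> + g |.|] is nonnegative at [0], and [w] is a subgradient of it there. *)
Definition sandwich H a v g : V := subgrad (infconv H a v g).

Variables (H : V -> R) (L a g : R) (v : V).
Hypothesis cH : convex_fun_rV H.
Hypothesis lH : lip_rV L H.
Hypothesis g0 : 0 <= g.
Hypothesis Ha : forall q, dotv v q - g * enorm q <= H q + a.

(** Bounds the terms of the infimal convolution from below, without which the real infimum is
    meaningless; at [p = 0] the bound is [0]. *)
Lemma infconv_term_ge p q : dotv v p - g * enorm p <=
  H q + a + dotv v (p - q) + g * enorm (p - q).
Proof.
have := Ha q; rewrite dotvDr dotvNr.
have : g * enorm q <= g * enorm p + g * enorm (p - q).
  rewrite -mulrDr ler_wpM2l// -{1}(subrK p q) (le_trans (enormD _ _))//.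
  by rewrite addrC enormB.
lra.
Qed.

Lemma infconv_le p q :
  infconv H a v g p <= H q + a + dotv v (p - q) + g * enorm (p - q).
Proof.
apply/ler_addgt0Pr => e e0.
(* A Lipschitz constant in [q] of the expression under the infimum, plus [1] for positivity: moving
   [q] to a nearby rational point costs at most [e]. *)
pose K := 1 + `|L| + enorm v + g.
have K0 : 0 < K by rewrite !ltr_wpDr// enorm_ge0.
have [r rP] := rat_dense_rV q (e / K) (divr_gt0 e0 K0).
apply: le_trans (@inf_range_le _ _ _ r _ (fun r => infconv_term_ge p (ratv r))) _.
rewrite -[map_mx _ r]/(ratv r) in rP; set z := ratv r in rP *.
have h1 : H z - H q <= `|L| * enorm (q - z).
  by rewrite (le_trans (lH _ _))// enormB ler_wpM2r ?enorm_ge0// ler_norm.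
have h2 : dotv v (p - z) <= dotv v (p - q) + enorm v * enorm (q - z).
  have := dotv_le v (q - z).
  by rewrite !dotvDr !dotvNr; lra.
have h3 : g * enorm (p - z) <= g * enorm (p - q) + g * enorm (q - z).
  by rewrite -mulrDr ler_wpM2l// enorm_sub_le.
have : K * enorm (q - z) <= e by rewrite mulrC -ler_pdivlMr// ltW.
have := enorm_ge0 (q - z).
rewrite /K !mulrDl mul1r; lra.
Qed.

Lemma le_infconv (c : R) p :
  (forall q, c <= H q + a + dotv v (p - q) + g * enorm (p - q)) ->
  c <= infconv H a v g p.
Proof. by move=> h; apply: (@le_inf_range _ _ _ 0) => q; exact: h. Qed.

Lemma infconv_shift p p' : infconv H a v g p <=
  infconv H a v g p' + dotv v (p - p') + g * enorm (p - p').
Proof.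
rewrite -addrA -lerBlDr; apply: le_infconv => q.
have := infconv_le p q; have := enorm_sub_le p p' q.
move=> /(ler_wpM2l g0); rewrite !mulrDr !dotvDr !dotvNr; lra.
Qed.

Lemma lip_infconv : lip_rV (enorm v + g) (infconv H a v g).
Proof.
move=> p q; have := infconv_shift p q; have := dotv_le v (p - q).
rewrite mulrDl; lra.
Qed.

Lemma convex_infconv : convex_fun_rV (infconv H a v g).
Proof.
move=> p q b b0 b1.
have [->|bn0] := eqVneq b 0; first by rewrite !subr0 !scale0r !mul0r !add0r scale1r mul1r.
have [->|bn1] := eqVneq b 1; first by rewrite subrr !scale0r !mul0r !addr0 scale1r mul1r.
have b0' : 0 < b by rewrite lt_neqAle eq_sym bn0.
have b1' : 0 < 1 - b by rewrite subr_gt0 lt_neqAle bn1.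
rewrite -lerBlDr [leRHS]mulrC -ler_pdivrMr//; apply: le_infconv => r.
rewrite ler_pdivrMr// lerBlDl -lerBlDr.
rewrite [leRHS]mulrC -ler_pdivrMr//; apply: le_infconv => s.
rewrite ler_pdivrMr// lerBlDr.
(* The weight [b] is real, so this point need not be rational; [infconv_le] admits every real
   point. *)
apply: le_trans (infconv_le _ (b *: r + (1 - b) *: s)) _.
have e1 : b *: p + (1 - b) *: q - (b *: r + (1 - b) *: s) =
    b *: (p - r) + (1 - b) *: (q - s).
  by rewrite !scalerBr opprD addrACA.
rewrite e1 (dotvDr v (b *: _)) !(dotvZr _ v).
have := cH r s b b0 b1.
have : g * enorm (b *: (p - r) + (1 - b) *: (q - s)) <=
    g * (b * enorm (p - r) + (1 - b) * enorm (q - s)).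
  rewrite ler_wpM2l// (le_trans (enormD _ _))// !enormZ.
  by rewrite !ger0_norm// ltW.
lra.
Qed.

Lemma sandwich_le p : dotv (sandwich H a v g) p <= H p + a.
Proof.
have := subgradP _ _ p convex_infconv lip_infconv.
have : 0 <= infconv H a v g 0.
  by apply: le_infconv => q; have := infconv_term_ge 0 q; rewrite dotv0 enorm0; lra.
by have := infconv_le p p; rewrite subrr dotv0 enorm0 /sandwich; lra.
Qed.

(** Test the subgradient inequality in the direction [w - v]: the convolution grows there by at most
    [<v, w - v> + g |w - v|], whence [|w - v|^2 <= g |w - v|]. *)
Lemma sandwich_dist : enorm (sandwich H a v g - v) <= g.
Proof.
set w := sandwich H a v g; have := subgradP _ _ (w - v) convex_infconv lip_infconv.
have := infconv_shift (w - v) 0; rewrite subr0 -/w => h1 h2.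
have : enorm (w - v) ^+ 2 <= g * enorm (w - v).
  by rewrite enorm_sqr dotvDl dotvNl -/w; rewrite -/w in h2; lra.
have := enorm_ge0 (w - v); rewrite le_eqVlt => /predU1P[<-//|d0].
by rewrite expr2 ler_pM2r.
Qed.

End Sandwich.

(** * Measurability *)

Section MeasurableInfimum.
Context {d} {T : measurableType d} {R : realType} {I : countType}.
Variables (D : set T).

Lemma measurable_fun_inf_countable (f : T -> I -> R) (m : T -> R) (i0 : I) :
  (forall i, measurable_fun D (fun t => f t i)) ->
  (forall t i, D t -> m t <= f t i) ->
  measurable_fun D (fun t => inf (range (f t))).
Proof.
(* Integers that code no index repeat [i0], which leaves the range unchanged. *)
move=> mf mle; pose h k t := f t (odflt i0 (unpickle k)).
apply: (@eq_measurable_fun _ _ _ _ _ (fun t => infs (h ^~ t) 0%N)).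
  move=> t tD; congr inf; apply/seteqP; split=> [_ [k _ <-]|_ [i _ <-]].
    by eexists.
  by exists (pickle i) => //; rewrite /h pickleK.
by apply: measurable_fun_infs => [t Dt|k]; [exists (m t) => _ [k _ <-]; exact: mle|exact: mf].
Qed.

Lemma measurable_fun_ereal_sup_countable (f : T -> I -> \bar R) (i0 : I) :
  (forall i, measurable_fun D (fun t => f t i)) ->
  measurable_fun D (fun t => ereal_sup (range (f t))).
Proof.
move=> mf; pose h k t := f t (odflt i0 (unpickle k)).
apply: (@eq_measurable_fun _ _ _ _ _ (fun t => esups (h ^~ t) 0%N)).
  move=> t tD; congr ereal_sup; apply/seteqP; split=> [_ [k _ <-]|_ [i _ <-]].
    by eexists.
  by exists (pickle i) => //; rewrite /h pickleK.
by apply: measurable_fun_esups => k; exact: mf.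
Qed.

End MeasurableInfimum.

Section MeasurableSandwich.
Context {d} {T : measurableType d} {R : realType} {n : nat}.
Notation V := 'rV[R]_n.
Variables (D : set T).

Definition measurable_vec (u : T -> V) :=
  forall i, measurable_fun D (fun t => u t ord0 i).

Lemma measurable_vec_cst (x : V) : measurable_vec (fun=> x).
Proof. by move=> i; exact: measurable_cst. Qed.

Lemma measurable_vecD u v : measurable_vec u -> measurable_vec v ->
  measurable_vec (fun t => u t + v t).
Proof.
move=> mu mv i; under eq_fun do rewrite mxE; exact: measurable_funD.
Qed.

Lemma measurable_vecB u v : measurable_vec u -> measurable_vec v ->
  measurable_vec (fun t => u t - v t).
Proof.
move=> mu mv i; under eq_fun do rewrite !mxE; exact: measurable_funB.
Qed.

Lemma measurable_dotv u v : measurable_vec u -> measurable_vec v ->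
  measurable_fun D (fun t => dotv (u t) (v t)).
Proof.
by move=> mu mv; apply: measurable_sum => i; exact: measurable_funM.
Qed.

Lemma measurable_enorm u : measurable_vec u ->
  measurable_fun D (fun t => enorm (u t)).
Proof.
move=> mu; apply: measurableT_comp; last exact: measurable_dotv.
by apply: continuous_measurable_fun; exact: sqrt_continuous.
Qed.

Lemma measurable_ddir (F : T -> V -> R) (L : T -> R) x p :
  (forall p, measurable_fun D (F ^~ p)) ->
  (forall t, D t -> convex_fun_rV (F t)) -> (forall t, D t -> lip_rV (L t) (F t)) ->
  measurable_fun D (fun t => ddir (F t) x p).
Proof.
move=> mF cF lF.
apply: (@measurable_fun_inf_countable _ _ _ _ _ (fun t => dquot (F t) x p)
  (fun t => - (L t * enorm p)) 0%N) => [m|t m Dt].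
  by apply: measurable_funM => //; exact: measurable_funB.
by apply: dquot_ge; exact: lF.
Qed.

Lemma measurable_subgrad (F : T -> V -> R) (L : T -> R) :
  (forall p, measurable_fun D (F ^~ p)) ->
  (forall t, D t -> convex_fun_rV (F t)) -> (forall t, D t -> lip_rV (L t) (F t)) ->
  measurable_vec (fun t => subgrad (F t)).
Proof.
move=> mF cF lF i; under eq_fun do rewrite mxE.
move: (enum 'I_n) (delta_mx _ _); elim/last_ind => [|s j ih] p.
  exact: measurable_ddir cF lF.
rewrite /hb_extension; under eq_fun do rewrite foldl_rcons -/(hb_extension _ _).
apply: (@measurable_ddir _ L) => // t Dt;
  have [? ? _ _] := hb_extensionP _ _ s (cF t Dt) (lF t Dt).
  exact: sublinear_convex.
exact: sublinear_lip.
Qed.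

Lemma measurable_sandwich (H : T -> V -> R) (L a g : T -> R) (v : T -> V) :
  (forall p, measurable_fun D (H ^~ p)) -> measurable_fun D a ->
  measurable_fun D g -> measurable_vec v ->
  (forall t, D t -> convex_fun_rV (H t)) -> (forall t, D t -> lip_rV (L t) (H t)) ->
  (forall t, D t -> 0 <= g t) ->
  (forall t, D t -> forall q, dotv (v t) q - g t * enorm q <= H t q + a t) ->
  measurable_vec (fun t => sandwich (H t) (a t) (v t) (g t)).
Proof.
move=> mH ma mg mv cH lH g0 Ha.
apply: (@measurable_subgrad _ (fun t => enorm (v t) + g t)) => [p|t Dt|t Dt].
- apply: (@measurable_fun_inf_countable _ _ _ _ _
    (fun t (q : 'rV[rat]_n) => H t (ratv q) + a t + dotv (v t) (p - ratv q) +
       g t * enorm (p - ratv q)) (fun t => dotv (v t) p - g t * enorm p) 0) => [q|t q Dt].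
    apply: measurable_funD; last by apply: measurable_funM => //; exact: measurable_cst.
    apply: measurable_funD; first exact: measurable_funD.
    by apply: measurable_dotv => //; exact: measurable_vec_cst.
  exact: (infconv_term_ge _ _ _ _ (g0 t Dt) (Ha t Dt)).
- exact: (convex_infconv _ _ _ _ _ (cH t Dt) (lH t Dt) (g0 t Dt) (Ha t Dt)).
- exact: (lip_infconv _ _ _ _ _ (lH t Dt) (g0 t Dt) (Ha t Dt)).
Qed.

End MeasurableSandwich.

Section MeasurableHamiltonian.
Context {d} {T : measurableType d} {R : realType} {n : nat}.
Notation V := 'rV[R]_n.
Variables (D : set T).

(* A function that is Lipschitz in [x] is the infimum over rational [q] of
   [H t q + K t |x - q|], and each of these terms is measurable along [y]. *)
Lemma measurable_fun_lip_comp (H : T -> V -> R) (K : T -> R) (y : T -> V) (r : R) :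
  (forall x, measurable_fun D (H ^~ x)) -> measurable_fun D K ->
  (forall t, D t -> 0 <= K t) ->
  (forall t, D t -> forall x x', enorm x <= r -> enorm x' <= r ->
     `|H t x - H t x'| <= K t * enorm (x - x')) ->
  measurable_vec D y -> (forall t, D t -> enorm (y t) < r) ->
  measurable_fun D (fun t => H t (y t)).
Proof.
move=> mH mK K0 HK my yr mD.
have [[t0 Dt0]|] := pselect (exists t, D t); last first.
  by move=> D0 B mB; rewrite (_ : _ `&` _ = set0)// -subset0 => t [Dt _];
     apply: D0; exists t.
have r0 : 0 <= r by rewrite (le_trans (enorm_ge0 (y t0)))// ltW// yr.
pose I := {q : 'rV[rat]_n | enorm (ratv q : V) <= r}.
have i0 : I.
  by exists 0; rewrite /ratv map_mx0 enorm0.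
move: mD; apply: (@eq_measurable_fun _ _ _ _ _
    (fun t => inf (range (fun q : I => H t (ratv (val q)) +
       K t * enorm (y t - ratv (val q)))))).
  move=> t /set_mem Dt; have lb (q : I) : H t (y t) <=
      H t (ratv (val q)) + K t * enorm (y t - ratv (val q)).
    have := HK t Dt _ _ (ltW (yr t Dt)) (valP q).
    by rewrite ler_norml => /andP[_]; lra.
  apply/eqP; rewrite eq_le (le_inf_range _ i0)// andbT.
  apply/ler_addgt0Pr => e e0.
  (* The first bound keeps [q] in the ball of radius [r]; the second makes [2 K |y - q|], the
     Lipschitz error plus the penalty, at most [e]. *)
  pose del := Num.min (r - enorm (y t)) (e / (1 + 2 * K t)).
  have K1 : 0 < 1 + 2 * K t by rewrite ltr_pwDl// mulr_ge0// K0.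
  have [|q] := @rat_dense_rV _ _ (y t) del.
    by rewrite lt_min subr_gt0 yr// divr_gt0.
  rewrite lt_min -/(ratv q) => /andP[q1 q2].
  have qr : enorm (ratv q : V) <= r.
    have := enormD (ratv q - y t) (y t); rewrite subrK enormB; lra.
  apply: le_trans (@inf_range_le _ _ _ (Sub q qr : I) _ lb) _.
  rewrite SubK; have := HK t Dt _ _ (ltW (yr t Dt)) qr.
  rewrite ltr_pdivlMr// in q2; rewrite ler_norml => /andP[+ _].
  have := enorm_ge0 (y t - ratv q); lra.
apply: (@measurable_fun_inf_countable _ _ _ _ _ _ (fun t => H t (y t)) i0) => [q|t q Dt].
  apply: measurable_funD => //; apply: measurable_funM => //.
  by apply: measurable_enorm; apply: measurable_vecB => //; exact: measurable_vec_cst.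
have := HK t Dt _ _ (ltW (yr t Dt)) (valP q).
by rewrite ler_norml => /andP[_]; lra.
Qed.

End MeasurableHamiltonian.

(** * The conjugate [H^*] and its domain *)

Section Hstar.
Context {R : realType} {n : nat}.
Notation V := 'rV[R]_n.
Variables (H : R -> V -> V -> R).

(** Membership in the epigraph of [H^*] becomes a family of affine inequalities between reals, the
    form in which arcs are repaired below. *)
Lemma HstarP t x v (a : R) :
  (Hstar H t x v <= a%:E)%E <-> forall p, dotv v p <= H t x p + a.
Proof.
split=> [h p|h].
  have : ((dotv v p - H t x p)%:E <= a%:E)%E.
    by apply: le_trans h; apply: ereal_sup_ubound; exists p.
  by rewrite lee_fin; lra.
by apply: ub_ereal_sup => _ [p _ <-]; rewrite lee_fin; have := h p; lra.
Qed.

Lemma Hstar_ge t x v p : ((dotv v p - H t x p)%:E <= Hstar H t x v)%E.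
Proof. by apply: ereal_sup_ubound; exists p. Qed.

Lemma Hstar_gtNy t x v : (-oo < Hstar H t x v)%E.
Proof. by apply: lt_le_trans (Hstar_ge _ _ _ 0); rewrite ltNyr. Qed.

Lemma Hstar_ratE t x v (L : R) : lip_rV L (H t x) ->
  Hstar H t x v =
  ereal_sup (range (fun q : 'rV[rat]_n => (dotv v (ratv q) - H t x (ratv q))%:E)).
Proof.
move=> lH; apply/eqP; rewrite eq_le; apply/andP; split; last first.
  by apply: ub_ereal_sup => _ [q _ <-]; exact: Hstar_ge.
apply: ub_ereal_sup => _ [p _ <-]; apply/lee_addgt0Pr => e e0.
pose K := 1 + `|L| + enorm v.
have K0 : 0 < K by rewrite !ltr_wpDr// enorm_ge0.
have [q qP] := rat_dense_rV p (e / K) (divr_gt0 e0 K0).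
apply: (@le_trans _ _ ((dotv v (ratv q) - H t x (ratv q))%:E + e%:E)%E); last first.
  by rewrite leeD2r//; apply: ereal_sup_ubound; exists q.
rewrite -EFinD lee_fin -/(ratv q) in qP *.
have : K * enorm (p - ratv q) <= e by rewrite mulrC -ler_pdivlMr// ltW.
have := dotv_le v (p - ratv q); rewrite dotvDr dotvNr.
have : H t x (ratv q) - H t x p <= `|L| * enorm (p - ratv q).
  by rewrite (le_trans (lH _ _))// enormB ler_wpM2r ?enorm_ge0// ler_norm.
have := enorm_ge0 (p - ratv q).
rewrite /K !mulrDl mul1r; lra.
Qed.

Lemma Hstar_dom_bound t x v (L : R) : 0 <= L -> lip_rV L (H t x) ->
  (Hstar H t x v < +oo)%E -> enorm v <= L.
Proof.
move=> L0 lH fin; have [a /HstarP va] : exists a : R, (Hstar H t x v <= a%:E)%E.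
  by exists (fine (Hstar H t x v)); rewrite fineK// fin_real// Hstar_gtNy.
rewrite leNgt; apply/negP => Lv.
have v0 : 0 < enorm v by exact: le_lt_trans Lv.
(* If [|v| > L], then [<v, s v> - H(s v)] exceeds [- H(0)] by at least [s |v| (|v| - L)]; this [s]
   makes the excess larger than [H(0) + a]. *)
pose s := (1 + `|H t x 0 + a|) / (enorm v * (enorm v - L)).
have s0 : 0 < s by rewrite divr_gt0 ?mulr_gt0 ?subr_gt0// ltr_wpDr.
have := va (s *: v); have := lH (s *: v) 0.
rewrite dotvZr subr0 enormZ gtr0_norm// -enorm_sqr expr2.
have : s * (enorm v * (enorm v - L)) = 1 + `|H t x 0 + a|.
  by rewrite /s mulfVK// mulf_neq0// gt_eqF// subr_gt0.
have := ler_norm (H t x 0 + a); lra.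
Qed.

End Hstar.

(** * The completed Lebesgue integral *)

Lemma ae_imply2 {d} {T : measurableType d} {R : realType}
    (mu : {measure set T -> \bar R}) (P Q S : T -> Prop) :
  {ae mu, forall t, P t} -> {ae mu, forall t, Q t} ->
  (forall t, P t -> Q t -> S t) -> {ae mu, forall t, S t}.
Proof. by move=> aP aQ PQS; apply: filterS2 aP aQ. Qed.

Section CompleteMeasure.
Context {d} {T : measurableType d} {R : realType} (mu : {measure set T -> \bar R}).
Hypothesis cmu : measure_is_complete mu.
Variables (D : set T) (f g : T -> \bar R).
Hypothesis mD : measurable D.
Hypothesis fg : {ae mu, forall t, D t -> f t = g t}.

Lemma complete_ae_integral : measurable_fun D f ->
  (\int[mu]_(t in D) f t = \int[mu]_(t in D) g t)%E.
Proof.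
by move=> mf; apply: ae_eq_integral => //; exact: ae_measurable_fun cmu _ _ _ fg mf.
Qed.

Lemma complete_ae_integrable : mu.-integrable D f -> mu.-integrable D g.
Proof.
move=> /integrableP[mf foo]; have mg := ae_measurable_fun cmu fg mf.
apply/integrableP; split=> //; apply: le_lt_trans foo.
rewrite le_eqVlt; apply/orP; left; apply/eqP; apply: ae_eq_integral => //.
- exact: measurableT_comp.
- exact: measurableT_comp.
- by apply: filterS fg => t + Dt; rewrite /= => ->.
Qed.

End CompleteMeasure.

Section Completed.
Context {R : realType}.
Implicit Types (f g : R -> R) (D : set R).
Local Notation mu := (@lebesgue_measure R).

Definition leb_measurable_fun D f :=
  measurable_fun (D : set (LebR R)) (f : LebR R -> R).

Definition leb_integrable D f :=
  (leb R).-integrable (D : set (LebR R)) (fun t : LebR R => (f t)%:E).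

Definition leb_int D f : R :=
  \int[leb R]_(t in (D : set (LebR R))) (f t : R).

Lemma borel_leb_measurable (A : set R) : measurable A ->
  measurable (A : set (LebR R)).
Proof. exact: sub_caratheodory. Qed.

Lemma leb_measurable_borel (A : set R) : measurable (A : set (LebR R)) ->
  exists B N : set R, [/\ measurable B, mu.-negligible N & A = B `|` N].
Proof.
move=> mA; have : (completed_algebra_gen mu).-sigma.-measurable A.
  by rewrite completed_caratheodory_measurable.
by rewrite g_sigma_completed_algebra_genE => -[B mB [N nN <-]]; exists B, N.
Qed.

Lemma ae_lebesgue_leb (P : set R) : {ae mu, forall t, P t} ->
  {ae leb R, forall t : LebR R, P t}.
Proof.
by move=> [N [mN N0 PN]]; exists N; split => //; exact: borel_leb_measurable.
Qed.

Lemma borel_leb_measurable_fun D f : measurable D -> measurable_fun D f ->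
  leb_measurable_fun D f.
Proof. by move=> mD mf _ B mB; apply: borel_leb_measurable; exact: mf. Qed.

(** Each sublevel set of [f] at a rational level is Borel up to a null set. Off the union [W] of
    these countably many null sets, Borel sets determine [f], so [f] restricted to [D] minus [W] and
    extended by [0] is Borel. *)
Lemma ex_borel_version D f : measurable D -> leb_measurable_fun D f ->
  exists2 g : R -> R, measurable_fun (setT : set R) g &
    {ae leb R, forall t : LebR R, D t -> f t = g t}.
Proof.
move=> mD mf; pose r k : R := ratr (odflt 0 (unpickle k)).
have rP (x y : R) : x < y -> exists k, x < r k /\ r k < y.
  move=> xy; have [q] := rat_in_itvoo xy; rewrite in_itv/= => /andP[xq qy].
  by exists (pickle q); rewrite /r pickleK.
have /choice[B BP] : forall k, exists B : set R, measurable B /\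
    exists Z : set R, [/\ measurable Z, mu Z = 0%E &
    forall t, ~ Z t -> (B t <-> D t /\ f t < r k)].
  move=> k; have : measurable ((D : set (LebR R)) `&` f @^-1` `]-oo, r k[).
    by apply: mf; [exact: borel_leb_measurable|exact: measurable_itv].
  move=> /leb_measurable_borel[B [N [mB [Z [mZ Z0 NZ]] E]]].
  exists B; split=> //; exists Z; split=> // t Zt.
  have <- : (D `&` f @^-1` `]-oo, r k[) t <-> D t /\ f t < r k.
    by rewrite /= in_itv.
  by rewrite E; split=> [|[//|/NZ//]]; left.
have /choice[Z ZP] := fun k => (BP k).2.
pose W := \bigcup_k Z k.
have mW : measurable W by apply: bigcupT_measurable => k; have [] := ZP k.
have W0 : mu W = 0%E.
  apply: (@measure_negligible _ _ _ mu) => //.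
  apply: negligible_bigcup => k.
  by have [mZ Z0 _] := ZP k; exists (Z k); split => // t.
have mDW : measurable (D `\` W) by exact: measurableD.
exists (f \_ (D `\` W)); last first.
  exists W; split => //; first exact: borel_leb_measurable.
  move=> t /= /not_implyP[Dt ft]; apply: contrapT => Wt; apply: ft.
  by rewrite patchE mem_set.
apply: (iffLR (measurable_restrictT f mDW)).
move=> _; apply: (measurability _ (RGenInftyO.measurableE R)) => // _ [_ [x ->] <-].
rewrite (_ : _ `&` _ = (D `\` W) `&` \bigcup_(k in [set k | r k <= x]) B k).
  apply: measurableI => //; apply: bigcup_measurable => // k _.
  exact: (BP k).1.
apply/seteqP; split=> t [DWt] /=.
  rewrite in_itv/= => ftx; split=> //.
  have [k [k1 k2]] := rP _ _ ftx.
  exists k; rewrite /= ?ltW//; have [_ _ h] := ZP k.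
  by apply/h; [move=> Zt; apply: DWt.2; exists k|split=> //; case: DWt].
move=> [k /= kx Bk]; split=> //; rewrite in_itv/=.
have [_ _ h] := ZP k; apply: lt_le_trans kx.
by case/h : Bk => // Zt; apply: DWt.2; exists k.
Qed.

(** The identity from the completed to the Borel sigma-algebra pushes the completed measure forward
    to Lebesgue measure. *)
Lemma leb_integral_borel D (f : R -> \bar R) : measurable D ->
  measurable_fun (setT : set R) f ->
  (\int[leb R]_(t in (D : set (LebR R))) f t = \int[mu]_(t in D) f t)%E.
Proof.
move=> mD mf; pose phi : LebR R -> measurableTypeR R := id.
have mphi : measurable_fun setT phi.
  by move=> _ B mB; rewrite setTI; exact: borel_leb_measurable.
rewrite integralE [RHS]integralE; congr (_ - _)%E.
- rewrite -[LHS](@ge0_integral_pushforward _ _ _ _ _ phi mphi (leb R) D (f^\+)%E)//.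
  exact/measurable_funepos/measurable_funTS.
- rewrite -[LHS](@ge0_integral_pushforward _ _ _ _ _ phi mphi (leb R) D (f^\-)%E)//.
  exact/measurable_funeneg/measurable_funTS.
Qed.

Lemma ae_leb_int D f g : measurable D -> leb_measurable_fun D f ->
  {ae leb R, forall t : LebR R, D t -> f t = g t} -> leb_int D f = leb_int D g.
Proof.
move=> mD mf fg; rewrite /leb_int /Rintegral; congr fine.
apply: (complete_ae_integral _ completed_lebesgue_measure_is_complete).
- exact: borel_leb_measurable.
- by apply: filterS fg => t + Dt => ->.
- exact/measurable_EFinP.
Qed.

Lemma ae_leb_imply2 (P Q S : R -> Prop) : {ae leb R, forall t : LebR R, P t} ->
  {ae leb R, forall t : LebR R, Q t} -> (forall t, P t -> Q t -> S t) ->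
  {ae leb R, forall t : LebR R, S t}.
Proof. exact: (@ae_imply2 _ (LebR R) R (leb R)). Qed.

Lemma ae_leb_imply (P S : R -> Prop) : {ae leb R, forall t : LebR R, P t} ->
  (forall t, P t -> S t) -> {ae leb R, forall t : LebR R, S t}.
Proof. by move=> aP PS; apply: (ae_leb_imply2 _ _ _ aP aP) => t /PS. Qed.

End Completed.

(** * Lebesgue differentiation for the completed measure *)

Section CompletedFTC.
Context {R : realType}.
Implicit Types (f g : R -> R) (D : set R).
Local Notation mu := (@lebesgue_measure R).

Lemma measurable_leb_itv (i : interval R) : measurable ([set` i] : set (LebR R)).
Proof. by apply: borel_leb_measurable; exact: measurable_itv. Qed.

Lemma ae_leb_integrable D f g : measurable (D : set (LebR R)) -> leb_integrable D f ->
  {ae leb R, forall t : LebR R, D t -> f t = g t} -> leb_integrable D g.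
Proof.
move=> mD fi fg.
apply: (complete_ae_integrable _ completed_lebesgue_measure_is_complete _ _ _ mD _ fi).
by apply: (ae_leb_imply _ _ fg) => t + Dt => ->.
Qed.

Lemma borel_integrable D f : measurable D -> measurable_fun (setT : set R) f ->
  leb_integrable D f -> mu.-integrable D (EFin \o f).
Proof.
move=> mD mf /integrableP[_ foo]; apply/integrableP; split.
  exact/measurable_EFinP/measurable_funTS.
rewrite -leb_integral_borel//; apply: measurableT_comp => //.
exact/measurable_EFinP.
Qed.

Lemma leb_int_borel D f : measurable D -> measurable_fun (setT : set R) f ->
  leb_int D f = \int[mu]_(t in D) f t.
Proof.
move=> mD mf; rewrite /leb_int /Rintegral leb_integral_borel//.
exact/measurable_EFinP.
Qed.

(** Differentiate the integral of a Borel version extended by [0]; for [s] near an interior point it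
    agrees with the integral of [f] over [[a, s]]. *)
Lemma leb_FTC1 (a b : R) f : leb_integrable `[a, b] f ->
  {ae leb R, forall t : LebR R, a < t -> t < b ->
     is_derive (t : R) (1 : R) (fun s : R => leb_int `[a, s] f) (f t)}.
Proof.
move=> fi; have /measurable_EFinP mf := measurable_int _ fi.
have mD : measurable (`[a, b] : set R) := measurable_itv _.
have mD' := measurable_leb_itv `[a, b].
have [g mg fg] := ex_borel_version _ _ mD mf.
pose h := g \_ `[a, b]%classic.
have mh : measurable_fun (setT : set R) h.
  by apply: (iffLR (measurable_restrictT g mD)); exact: measurable_funTS.
have ih : mu.-integrable setT (EFin \o h).
  have : mu.-integrable `[a, b]%classic (EFin \o g).
    by apply: borel_integrable => //; exact: ae_leb_integrable fg.
  by rewrite integrable_mkcond//= restrict_EFin.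
have ihy (y : R) : mu.-integrable [set` Interval (BLeft a) (BRight y)] (EFin \o h).
  by apply: integrableS ih => //; exact: measurable_itv.
have := @FTC1 R h (BLeft a) ihy (open_integrable_locally openT ih).
move=> /ae_lebesgue_leb ftc.
apply: (ae_leb_imply2 _ _ _ ftc fg) => t Ft fgt at0 tb.
have {Ft}[|dF F't] := Ft; first by rewrite lte_fin.
have atb : t \in `[a, b] by rewrite in_itv/= !ltW.
have -> : f t = h t by rewrite /h patchE mem_set// fgt.
rewrite -F't derive1E; apply: (@near_eq_is_derive _ _ _ (fun x => (\int[mu]_(s in `[a, x]) h s)%R)).
  near=> s; have sb : s <= b by near: s; exact: lt_le_nbhsl.
  have sub : `[a, s]%classic `<=` `[a, b]%classic.
    by apply: subset_itvl; rewrite bnd_simp.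
  have mas : measurable (`[a, s] : set R) := measurable_itv _.
  transitivity (leb_int `[a, s] h); first by rewrite leb_int_borel.
  apply: ae_leb_int => //; first exact/borel_leb_measurable_fun/measurable_funTS.
  apply: (ae_leb_imply _ _ fg) => r gr asr.
  by rewrite /h patchE mem_set; [rewrite gr//|]; exact: sub.
exact/derivableP.
Unshelve. all: by end_near.
Qed.

End CompletedFTC.

(** * Absolutely continuous functions are primitives *)

Section AbsolutelyContinuousReal.
Context {R : realType}.
Implicit Types (F G : R -> R) (a b : R).

Definition disjoint_family a b (J : Type) (u v : J -> R) :=
  (forall i, a <= u i /\ u i <= v i /\ v i <= b) /\
  (forall i j, i <> j -> v i <= u j \/ v j <= u i).

(** Families are indexed by arbitrary finite types, so that the pieces of several partitions form
    one family, indexed by a sigma type, without renumbering. *)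
Definition ac_real a b F := forall e : R, 0 < e -> exists2 d : R, 0 < d &
  forall (J : finType) (u v : J -> R), disjoint_family a b J u v ->
    \sum_i (v i - u i) < d -> \sum_i `|F (v i) - F (u i)| < e.

Lemma ac_real_of_ord a b F :
  (forall e : R, 0 < e -> exists2 d : R, 0 < d &
    forall (k : nat) (u v : 'I_k -> R), disjoint_family a b 'I_k u v ->
      \sum_(i < k) (v i - u i) < d -> \sum_(i < k) `|F (v i) - F (u i)| < e) ->
  ac_real a b F.
Proof.
move=> acF e /acF[d d0 dP]; exists d => // J u v [uv djt] lt.
have reidx (f : J -> R) : \sum_i f i = \sum_(i < #|J|) f (enum_val i).
  by rewrite big_enum_val.
rewrite (reidx (fun i => `|F (v i) - F (u i)|)).
rewrite (reidx (fun i => v i - u i)) in lt.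
apply: (dP _ (u \o enum_val) (v \o enum_val)) lt.
split=> [i|i j ij]; first exact: uv.
by apply: djt => /enum_val_inj.
Qed.

Lemma variationE a b F s : variation a b F s =
  \sum_(j < size s) `|F (nth b (a :: s) j.+1) - F (nth b (a :: s) j)|.
Proof. by rewrite /variation big_mkord. Qed.

(** Partition every interval of the family: all pieces together are again disjoint and have the same
    total length, so the [d] of [F] bounds the sum of the variations. Passing to suprema only costs
    the strict inequality. *)
Lemma ac_real_sum_variation a b F (e : R) : ac_real a b F -> 0 < e ->
  exists2 d : R, 0 < d & forall (J : finType) (u v : J -> R),
    disjoint_family a b J u v -> \sum_i (v i - u i) < d ->
    (\sum_i total_variation (u i) (v i) F <= e%:E)%E.
Proof.
move=> acF /acF[d d0 dP]; exists d => // J u v [uv djt] lt.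
have lists (l : J -> seq R) : (forall i, itv_partition (u i) (v i) (l i)) ->
    \sum_i variation (u i) (v i) F (l i) <= e.
  move=> lP; pose x i := nth (v i) (u i :: l i).
  pose K := {i : J & 'I_(size (l i))}.
  have sigE (f : R -> R) : \sum_i variation (u i) (v i) f (l i) =
      \sum_(k : K) `|f (x (tag k) (tagged k).+1) - f (x (tag k) (tagged k))|.
    under eq_bigr do rewrite variationE.
    by rewrite sig_big_dep.
  have xmono i j k : (j <= k)%N -> (k <= size (l i))%N -> x i j <= x i k.
    have [lp _] := lP i; rewrite leq_eqVlt => /predU1P[->//|jk] kl.
    apply/ltW; have := lp; rewrite -[path _ _ _]/(sorted <%O (u i :: l i)).
    move=> /(lt_sorted_ltn_nth (v i)) ->//; rewrite inE/= ltnS//.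
    exact: leq_trans (ltnW jk) kl.
  have x0 i : x i 0%N = u i by [].
  have xN i : x i (size (l i)) = v i.
    by rewrite /x -[X in nth _ _ X]/(size (u i :: l i)).-1 nth_last/=; have [_ /eqP] := lP i.
  rewrite sigE ltW//; apply: (dP K (fun k => x (tag k) (tagged k))
    (fun k => x (tag k) (tagged k).+1)).
    split=> [[i j]|[i j] [i' j'] /= ne].
      have [aui [uvi vib]] := uv i; rewrite /=; split; last split.
      - by rewrite (le_trans aui)// -x0 xmono// ltnW.
      - by rewrite xmono.
      - by rewrite (le_trans _ vib)// -xN xmono.
    have [ii'|/eqP/djt] := eqVneq i i'.
      subst i'; have jj' : j != j' by apply/eqP => jj'; apply: ne; rewrite jj'.
      have [lj|lj|/val_inj jE] := ltngtP j j'; last by rewrite jE eqxx in jj'.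
        by left; rewrite xmono// ltnW.
      by right; rewrite xmono// ltnW.
    have xu q r : (r <= size (l q))%N -> u q <= x q r by move=> rq; rewrite -x0 xmono.
    have xv q r : (r <= size (l q))%N -> x q r <= v q by move=> rq; rewrite -xN xmono.
    case=> vu; [left|right]; rewrite (le_trans (xv _ _ _))// (le_trans vu)// xu// ltnW//.
  apply: le_lt_trans lt; rewrite le_eqVlt; apply/orP; left; apply/eqP.
  transitivity (\sum_i variation (u i) (v i) id (l i)).
    rewrite sigE; apply: eq_bigr => -[i j] _ /=.
    by rewrite ger0_norm// subr_ge0 xmono.
  apply: eq_bigr => i _; rewrite variationE -/(x i).
  rewrite (eq_bigr (fun j : 'I_(size (l i)) => x i j.+1 - x i j)); last first.
    by move=> j _; rewrite ger0_norm// subr_ge0 xmono.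
  by rewrite -(big_mkord predT (fun j => x i j.+1 - x i j)) telescope_sumr// x0 xN.
have ex0 i : exists l, itv_partition (u i) (v i) l.
  have [_ [+ _]] := uv i; rewrite le_eqVlt => /predU1P[->|/itv_partition1]; last by exists [:: v i].
  by exists [::].
have /choice[l0 l0P] := ex0.
have varge0 i l : 0 <= variation (u i) (v i) F l.
  by rewrite variationE sumr_ge0.
have TVe i : (total_variation (u i) (v i) F <= e%:E)%E.
  apply: ub_ereal_sup => _ [_ [l lP <-] <-]; rewrite lee_fin.
  (* Changing one partition at a time bounds each total variation separately, hence shows it finite
     before the suprema are summed. *)
  pose l1 j := if j == i then l else l0 j.
  apply: (@le_trans _ _ (\sum_i variation (u i) (v i) F (l1 i))).
    by rewrite (bigD1 i)//= /l1 eqxx lerDl sumr_ge0.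
  by apply: lists => j; rewrite /l1; case: eqP => [->|].
have TVfin i : total_variation (u i) (v i) F \is a fin_num.
  rewrite ge0_fin_numE; first exact: le_lt_trans (TVe i) (ltry _).
  by apply: total_variation_ge0; have [_ []] := uv i.
rewrite (eq_bigr (fun i => (fine (total_variation (u i) (v i) F))%:E)); last first.
  by move=> i _; rewrite fineK.
rewrite sumEFin lee_fin; apply/ler_addgt0Pr => eta eta0.
pose c := eta / #|J|.+1%:R.
have c0 : 0 < c by rewrite divr_gt0.
have /choice[l lP] i : exists l, itv_partition (u i) (v i) l /\
    fine (total_variation (u i) (v i) F) - c < variation (u i) (v i) F l.
  have : ((fine (total_variation (u i) (v i) F) - c)%:E < total_variation (u i) (v i) F)%E.
    by rewrite -[ltRHS]fineK// lte_fin gtrBl.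
  by move=> /ereal_sup_gt[_ [_ [l lP <-] <-]]; rewrite lte_fin; exists l.
apply: (@le_trans _ _ (\sum_i (variation (u i) (v i) F (l i) + c))).
  by apply: ler_sum => i _; rewrite -lerBlDr ltW//; case: (lP i).
rewrite big_split/= lerD ?lists//; first by move=> i; case: (lP i).
rewrite sumr_const -mulr_natl /c mulrA ler_pdivrMr// mulrC ler_wpM2l ?ltW//.
by rewrite ltr_nat.
Qed.

End AbsolutelyContinuousReal.

(** * Jordan decomposition of absolutely continuous functions *)

Section JordanAC.
Context {R : realType}.
Implicit Types (F G : R -> R) (a b : R).

Lemma ac_real_sub a b c d F : a <= c -> d <= b -> ac_real a b F -> ac_real c d F.
Proof.
move=> ac db acF e /acF[r r0 rP]; exists r => // J u v [uv djt]; apply: rP.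
split=> // i; have [cu [uvi vd]] := uv i.
by rewrite (le_trans ac)// uvi (le_trans vd).
Qed.

Lemma ac_real1 a b F (e : R) : ac_real a b F -> 0 < e ->
  exists2 d : R, 0 < d & forall x y, a <= x -> x <= y -> y <= b -> y - x < d ->
    `|F y - F x| < e.
Proof.
move=> acF /acF[d d0 dP]; exists d => // x y ax xy yb lt.
have := dP unit (fun=> x) (fun=> y); rewrite !big_const !card_unit/= !addr0; apply=> //.
by split=> [//|[] []].
Qed.

Lemma ac_real_total_variation_fin a b F : ac_real a b F -> a <= b ->
  total_variation a b F \is a fin_num.
Proof.
move=> acF ab; have [d d0 dP] := ac_real_sum_variation _ _ _ 1 acF ltr01.
have TV1 x y : a <= x -> x <= y -> y <= b -> y - x < d ->
    (total_variation x y F <= 1)%E.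
  move=> ax xy yb lt; have := dP unit (fun=> x) (fun=> y).
  by rewrite !big_const !card_unit/= addr0 adde0; apply=> //; split=> [//|[] []].
(* Half of [d], so that closed steps of length [h] are strictly shorter than [d] and have variation
   at most [1]. *)
pose h := d / 2; have h0 : 0 < h by rewrite divr_gt0.
have TVm (m : nat) : forall y, a <= y -> y <= b -> y <= a + m%:R * h ->
    (total_variation a y F < +oo)%E.
  elim: m => [|m ih] y ay yb.
    rewrite mul0r addr0 => ya; have -> : y = a by apply/eqP; rewrite eq_le ya.
    by rewrite total_variationxx ltry.
  move=> ym; have [y'|y'] := leP y (a + m%:R * h); first exact: ih.
  have am : a <= a + m%:R * h by rewrite lerDl mulr_ge0// ltW.
  rewrite (total_variationD _ am (ltW y')) lte_add_pinfty//.
    by apply: ih => //; rewrite (le_trans (ltW y')).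
  apply: le_lt_trans (TV1 _ _ am (ltW y') yb _) (ltry _).
  rewrite -natr1 mulrDl mul1r addrA in ym.
  by rewrite ltrBlDl (le_lt_trans ym)// ltrD2l /h ltr_pdivrMr// ltr_pMr// ltr1n.
rewrite ge0_fin_numE ?total_variation_ge0//.
apply: (TVm (Num.bound ((b - a) / h))) => //.
rewrite -lerBlDl -ler_pdivrMr// ltW//.
by rewrite archi_boundP// divr_ge0 ?subr_ge0// ltW.
Qed.

(** [V] is the total variation from [a] and [W = V - F]. Absolute continuity of [V] comes from the
    summed variation bound, applied with [e / 2] because that bound is not strict. *)
Lemma ac_real_decomp a b F : ac_real a b F -> a <= b ->
  exists V W : R -> R, [/\ forall x, a <= x -> x <= b -> F x = V x - W x,
    ac_real a b V, ac_real a b W,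
    (forall x y, a <= x -> x <= y -> y <= b -> V x <= V y) &
    (forall x y, a <= x -> x <= y -> y <= b -> W x <= W y)].
Proof.
move=> acF ab; pose TV x y := fine (total_variation x y F).
have TVfin x y : a <= x -> x <= y -> y <= b -> total_variation x y F \is a fin_num.
  move=> ax xy yb; apply: ac_real_total_variation_fin => //.
  exact: ac_real_sub acF.
have TVD x y : a <= x -> x <= y -> y <= b -> TV a y = TV a x + TV x y.
  move=> ax xy yb; rewrite /TV (total_variationD _ ax xy) fineD ?TVfin//.
  exact: le_trans yb.
have TVge x y : a <= x -> x <= y -> y <= b -> `|F y - F x| <= TV x y.
  move=> ax xy yb; rewrite -lee_fin fineK ?TVfin//; exact: total_variation_ge.
have acV : ac_real a b (TV a).
  move=> e e0; have e2 : 0 < e / 2 by rewrite divr_gt0.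
  have [d d0 dP] := ac_real_sum_variation _ _ _ _ acF e2.
  exists d => // J u v djt lt; have [uv _] := djt.
  have := dP J u v djt lt; under eq_bigr => i _.
    have [au [uvi vb]] := uv i; rewrite -[total_variation _ _ _]fineK ?TVfin//.
    over.
  rewrite sumEFin lee_fin => le2; apply: le_lt_trans (le_trans _ le2) _; last first.
    by rewrite ltr_pdivrMr// ltr_pMr// ltr1n.
  apply: ler_sum => i _; have [au [uvi vb]] := uv i.
  rewrite (TVD (u i))// addrC addKr ger0_norm//.
  by apply: fine_ge0; exact: total_variation_ge0.
exists (TV a), (fun x => TV a x - F x); split=> // [x ax xb||x y ax xy yb|x y ax xy yb].
- by rewrite opprB addrC subrK.
- move=> e e0; have e2 : 0 < e / 2 by rewrite divr_gt0.
  have [d1 d10 dP1] := acV _ e2; have [d2 d20 dP2] := acF _ e2.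
  exists (Num.min d1 d2) => [|J u v djt]; first by rewrite lt_min d10.
  rewrite lt_min => /andP[lt1 lt2]; rewrite (splitr e).
  apply: le_lt_trans (ltrD (dP1 J u v djt lt1) (dP2 J u v djt lt2)).
  rewrite -big_split/=; apply: ler_sum => i _.
  set x := TV a (v i); set y := TV a (u i).
  have -> : x - F (v i) - (y - F (u i)) = (x - y) - (F (v i) - F (u i)) by ring.
  exact: ler_normB.
- rewrite (TVD x y)// lerDl; apply: fine_ge0; exact: total_variation_ge0.
- have := TVge x y ax xy yb; rewrite (TVD x y)// ler_norml => /andP[_]; lra.
Qed.

End JordanAC.

(** * Density of a monotone absolutely continuous function *)

Section MonotoneAC.
Context {R : realType}.
Local Notation mu := (@lebesgue_measure R).

(** A clipped component is caught between []x, y[] and []x, y]]: the inner interval serves for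
    disjointness and Lebesgue length, the outer one for the Stieltjes mass. An empty intersection is
    encoded by [x = y = a]. *)
Lemma open_itv_endpoints (a b : R) (I : set R) : a <= b -> open I -> is_interval I ->
  exists x y, [/\ a <= x /\ x <= y /\ y <= b,
    `]x, y[%classic `<=` I `&` `]a, b]%classic,
    I `&` `]a, b]%classic `<=` `]x, y]%classic & (x = a /\ y = a) \/ x < y].
Proof.
move=> ab oI iI; set J := I `&` _.
have [J0|/set0P[z0 Jz0]] := eqVneq J set0.
  exists a, a; split; [by []| |by rewrite J0; exact: sub0set|by left].
  by move=> x; rewrite /= in_itv/= => /andP[ax xa]; have := lt_trans ax xa; rewrite ltxx.
have Jab z : J z -> a < z /\ z <= b by move=> [_]; rewrite /= in_itv/= => /andP[].
have infJ : has_inf J by split; [exists z0|exists a => z /Jab[/ltW]].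
have supJ : has_sup J by split; [exists z0|exists b => z /Jab[]].
have Jlt z : J z -> inf J < z.
  move=> Jz; have [az zb] := Jab z Jz.
  have /nbhs_ballP[r /= r0 rI] : nbhs z I by apply: open_nbhs_nbhs; split=> //; case: Jz.
  pose z' := Num.max ((a + z) / 2) (z - r / 2).
  have z'z : z' < z by rewrite gt_max; apply/andP; split; lra.
  have az' : a < z' by rewrite lt_max; apply/orP; left; lra.
  have zr : z - r / 2 <= z' by rewrite le_max lexx orbT.
  apply: le_lt_trans (z'z); apply: ge_inf; first exact: infJ.2.
  split; last by rewrite /= in_itv/= az' (le_trans (ltW z'z)).
  by apply: rI; rewrite /ball/= ltr_norml; apply/andP; split; lra.
have Jle z : J z -> z <= sup J by move=> Jz; apply: ub_le_sup => //; exact: supJ.2.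
have xy : inf J < sup J by apply: lt_le_trans (Jlt _ Jz0) (Jle _ Jz0).
exists (inf J), (sup J); split; last by right.
- split; first by apply: lb_le_inf; [exists z0|move=> z /Jab[/ltW]].
  by split; [exact: ltW|apply: ge_sup; [exists z0|move=> z /Jab[]]].
- move=> w; rewrite /= in_itv/= => /andP[xw wy].
  have [p Jp pw] := inf_lt infJ.1 xw; have [q Jq wq] := sup_gt supJ.1 wy.
  split; first by apply: (iI p q) => //; [case: Jp|case: Jq|rewrite !ltW].
  rewrite /= in_itv/= (lt_trans (Jab _ Jp).1 pw)/=.
  exact: le_trans (ltW wq) (Jab _ Jq).2.
- by move=> z Jz; rewrite /= in_itv/= Jlt// Jle.
Qed.

Section stieltjes.
Variables (a b : R) (G : R -> R).
Hypothesis ab : a < b.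
Hypothesis acG : ac_real a b G.
Hypothesis ndG : forall x y, a <= x -> x <= y -> y <= b -> G x <= G y.

(** Clamping to [[a, b]] extends [G] by constants to a nondecreasing right-continuous function on
    the line, which defines a Stieltjes measure. *)
Let cl (x : R) := Num.max a (Num.min x b).

Let clP x : a <= cl x /\ cl x <= b.
Proof. by rewrite /cl le_max lexx/= ge_max ltW//= ge_min lexx orbT. Qed.

Let cl_le x y : x <= y -> cl x <= cl y.
Proof.
move=> xy; rewrite /cl ge_max !le_max lexx/= le_min !ge_min lexx xy orbT/=.
by rewrite orbT.
Qed.

Let cl_lip x y : x <= y -> cl y - cl x <= y - x.
Proof.
move=> xy; rewrite /cl; case: (leP x b); case: (leP y b); case: (leP a b) => *;
 rewrite /Num.max; repeat case: ifPn; rewrite -?leNgt; lra.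
Qed.

Let cl_id x : a <= x -> x <= b -> cl x = x.
Proof. by move=> ax xb; rewrite /cl min_l// max_r. Qed.

Let Gt := G \o cl.

Let ndGt : nondecreasing Gt.
Proof.
move=> x y xy; apply: ndG; [exact: (clP x).1|exact: cl_le|exact: (clP y).2].
Qed.

Let rcGt : right_continuous Gt.
Proof.
move=> x; apply/cvgrPdist_lt => e e0.
have [d d0 dP] := ac_real1 _ _ _ _ acG e0.
near=> y; have xy : x <= y by near: y; exact: nbhs_right_ge.
rewrite distrC; apply: dP; [exact: (clP x).1|exact: cl_le|exact: (clP y).2|].
apply: le_lt_trans (cl_lip _ _ xy) _; rewrite ltrBlDl.
by near: y; apply: nbhs_right_lt; rewrite ltrDl.
Unshelve. all: by end_near. Qed.

Let Gc : cumulative R R := HB.pack Gt (isCumulative.Build R _ R Gt ndGt rcGt).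

Let nu := lebesgue_stieltjes_measure Gc.

Let nu_itv x y : a <= x -> x <= y -> y <= b -> nu `]x, y]%classic = (G y - G x)%:E.
Proof.
move=> ax xy yb; rewrite /nu /lebesgue_stieltjes_measure /measure_extension.
rewrite measurable_mu_extE/=; last exact: is_ocitv.
rewrite wlength_itv_bnd//= /Gt/= !cl_id//; first exact: le_trans yb.
exact: le_trans xy.
Qed.

Let D : set (measurableTypeR R) := `]a, b]%classic.

Let mD : measurable D. Proof. exact: measurable_itv. Qed.

Let nuD : (nu D < +oo)%E.
Proof. by rewrite nu_itv ?lexx ?ltW// ltry. Qed.

Let nu' : {finite_measure set (measurableTypeR R) -> \bar R} := mfrestr mD nuD.

(** Cover the null set by an open set of measure below the [d] of absolute continuity. Finitely many
    of its components, clipped to []a, b]], have total increment below [e], and the bound passes to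
    the countable sum. *)
Let nu_small (e : R) (A : set R) : 0 < e -> measurable A -> A `<=` D -> mu A = 0%E ->
  (nu A <= e%:E)%E.
Proof.
move=> e0 mA AD A0; have [d d0 dP] := acG _ e0.
have [|U [oU AU]] := lebesgue_regularity_outer mA _ d0.
  exact: (eq_ind_r (fun x => (x < +oo)%E) (ltry 0) A0).
move=> UAd; have mU : measurable U by exact: open_measurable.
have Ud : (mu U < d%:E)%E.
  rewrite -(setDUK AU) (le_lt_trans (measureU2 _ _ _))//; first exact: measurableD.
  by rewrite [X in (X + _)%E]A0 add0e.
pose I := open_disjoint_itv oU; pose J i := I i `&` D.
have mJ i : measurable (J i).
  by apply: measurableI => //; apply: open_measurable; exact: open_disjoint_itv_open.
have tJ : trivIset setT J.
  by apply: trivIset_setIr; exact: open_disjoint_itv_trivIset.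
have AJ : A `<=` \bigcup_i J i.
  move=> x Ax; have [i _ Iix] : (\bigcup_i I i) x.
    by rewrite /I -open_disjoint_itv_bigcup; exact: AU.
  by exists i => //; split=> //; exact: AD.
have mUJ : measurable (\bigcup_i J i) by exact: bigcupT_measurable.
have /choice[x /choice[y xyP]] i := open_itv_endpoints _ _ _ (ltW ab)
  (@open_disjoint_itv_open _ _ oU i) (@open_disjoint_itv_is_interval _ _ oU i).
have dj N : disjoint_family a b 'I_N (x \o val) (y \o val).
  split=> [i|i j ij] /=; first by have [] := xyP i.
  have [[axi [xyi yib]] subi _ ci] := xyP i; have [[axj [xyj yjb]] subj _ cj] := xyP j.
  case: ci => [[_ ->]|lti]; first by left.
  case: cj => [[_ ->]|ltj]; first by right.
  apply/orP; rewrite -[_ || _]negbK negb_or -!ltNge; apply/negP => /andP[h1 h2].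
  (* If two intervals overlapped, the midpoint of the overlap would lie in two disjoint
     components. *)
  pose p := Num.max (x i) (x j); pose q := Num.min (y i) (y j).
  have pq : p < q by rewrite /p /q lt_min !gt_max lti h1 h2 ltj.
  have [ip iq] : x i <= p /\ x j <= p by rewrite !le_max !lexx orbT.
  have [jp jq] : q <= y i /\ q <= y j by rewrite !ge_min !lexx orbT.
  have mi : J i ((p + q) / 2) by apply: subi; rewrite /= in_itv/=; apply/andP; split; lra.
  have mj : J j ((p + q) / 2) by apply: subj; rewrite /= in_itv/=; apply/andP; split; lra.
  by apply: ij; apply: val_inj; apply: tJ => //; exists ((p + q) / 2).
have len N : \sum_(i < N) (y i - x i) < d.
  rewrite -lte_fin; apply: le_lt_trans Ud.
  apply: (@le_trans _ _ (mu (\bigcup_i J i))); last first.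
    apply: le_measure; rewrite ?inE//.
    by move=> z [i _ [Iiz _]]; rewrite (open_disjoint_itv_bigcup oU); exists i.
  rewrite measure_semi_bigcup//; apply: le_trans (nneseries_lim_ge N _) => //.
  rewrite big_mkord -sumEFin; apply: lee_sum => i _.
  have [[axi [xyi yib]] subi _ _] := xyP i.
  apply: (@le_trans _ _ (mu `]x i, y i[%classic)); last first.
    apply: le_measure; rewrite ?inE//; exact: mJ.
  by rewrite lebesgue_measure_itv/= lte_fin; case: ltP => // h; rewrite lee_fin subr_le0.
apply: (@le_trans _ _ (nu (\bigcup_i J i))).
  by apply: le_measure; rewrite ?inE.
have -> : nu (\bigcup_i J i) = (\sum_(0 <= i <oo) nu (J i))%E.
  exact: (@measure_semi_bigcup _ _ _ (lebesgue_stieltjes_measure Gc)).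
apply: lime_le; first by apply: is_cvg_nneseries => i _ _; exact: measure_ge0.
apply: nearW => N; rewrite big_mkord.
have := dP _ _ _ (dj N) (len N) => /ltW; rewrite -lee_fin; apply: le_trans.
rewrite -sumEFin; apply: lee_sum => i _ /=.
have [[axi [xyi yib]] _ supi _] := xyP i.
apply: (@le_trans _ _ (nu `]x i, y i]%classic)).
  by apply: le_measure; rewrite ?inE//; exact: mJ.
by rewrite nu_itv// lee_fin ler_norm.
Qed.

Let dom : nu' `<< mu.
Proof.
apply/null_content_dominatesP => A mA A0.
have mAD : measurable (A `&` D) by exact: measurableI.
apply/eqP; rewrite eq_le measure_ge0 andbT; apply/lee_addgt0Pr => e e0.
rewrite add0e; apply: nu_small => //.
apply/eqP; rewrite eq_le measure_ge0 andbT -[leRHS]A0.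
by apply: le_measure; rewrite ?inE.
Qed.

(** The density is the Radon-Nikodym derivative of the Stieltjes measure restricted to []a, b]]. *)
Lemma ac_mono_density : exists g : R -> R, [/\ measurable_fun (setT : set R) g,
  mu.-integrable setT (EFin \o g) &
  forall t, a <= t -> t <= b -> (\int[mu]_(s in `]a, t]) (g s)%:E = (G t - G a)%:E)%E].
Proof.
pose f := Radon_Nikodym_SigmaFinite.f nu' mu.
have fE : EFin \o (fine \o f) = f.
  by apply/funext => x; rewrite /= fineK//; exact: Radon_Nikodym_SigmaFinite.f_fin_num.
have fi := Radon_Nikodym_SigmaFinite.f_integrable dom.
exists (fine \o f); split.
- by apply/measurable_EFinP; rewrite fE; exact: measurable_int fi.
- by rewrite fE.
- move=> t at_ tb; rewrite -[LHS]/(\int[mu]_(s in `]a, t]) ((EFin \o (fine \o f)) s))%E fE.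
  rewrite -(Radon_Nikodym_SigmaFinite.f_integral dom) /=; last exact: measurable_itv.
  rewrite /mfrestr /mrestr/= -nu_itv//; congr (nu _).
  by apply/setIidPl; apply: subset_itvl; rewrite bnd_simp.
Qed.

End stieltjes.
End MonotoneAC.

(** * Primitives, Gronwall, vector integrals *)

Section LebIntTheory.
Context {R : realType}.
Implicit Types (f g : R -> R) (D E : set R) (a b : R).
Local Notation mu := (@lebesgue_measure R).
Local Notation lmeasurable D := (measurable (D : set (LebR R))).

Lemma leb_intD D f g : lmeasurable D -> leb_integrable D f -> leb_integrable D g ->
  leb_int D (fun t => f t + g t) = leb_int D f + leb_int D g.
Proof. exact: RintegralD. Qed.

Lemma leb_intB D f g : lmeasurable D -> leb_integrable D f -> leb_integrable D g ->
  leb_int D (fun t => f t - g t) = leb_int D f - leb_int D g.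
Proof. exact: RintegralB. Qed.

Lemma leb_intZ D f (r : R) : lmeasurable D -> leb_integrable D f ->
  leb_int D (fun t => r * f t) = r * leb_int D f.
Proof. by move=> mD fi; apply: RintegralZl. Qed.

Lemma leb_int_le D f g : lmeasurable D -> leb_integrable D f -> leb_integrable D g ->
  (forall t, D t -> f t <= g t) -> leb_int D f <= leb_int D g.
Proof. exact: le_Rintegral. Qed.

Lemma leb_int_ge0 D f : (forall t, D t -> 0 <= f t) -> 0 <= leb_int D f.
Proof. by move=> f0; rewrite /leb_int; apply: Rintegral_ge0. Qed.

Lemma eq_leb_int D f g : (forall t, D t -> f t = g t) -> leb_int D f = leb_int D g.
Proof. by move=> fg; apply: eq_Rintegral => t /set_mem/fg. Qed.

Lemma leb_integrableD D f g : lmeasurable D -> leb_integrable D f ->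
  leb_integrable D g -> leb_integrable D (fun t => f t + g t).
Proof.
move=> mD fi gi; apply: (eq_integrable _ _ _ _ (integrableD mD fi gi)) => //.
Qed.

Lemma leb_integrableZ D f (r : R) : lmeasurable D -> leb_integrable D f ->
  leb_integrable D (fun t => r * f t).
Proof.
move=> mD fi; apply: (eq_integrable _ _ _ _ (integrableZl mD r fi)) => //.
Qed.

Lemma leb_integrableB D f g : lmeasurable D -> leb_integrable D f ->
  leb_integrable D g -> leb_integrable D (fun t => f t - g t).
Proof.
move=> mD fi gi; apply: (eq_integrable _ _ _ _ (integrableB mD fi gi)) => //.
Qed.

Lemma leb_integrableS D E f : lmeasurable D -> lmeasurable E -> E `<=` D ->
  leb_integrable D f -> leb_integrable E f.
Proof. by move=> mD mE ED; apply: integrableS. Qed.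

Lemma le_leb_integrable D f g : lmeasurable D -> leb_measurable_fun D f ->
  (forall t, D t -> `|f t| <= g t) -> leb_integrable D g -> leb_integrable D f.
Proof.
move=> mD mf fg gi; have mF : measurable_fun (D : set (LebR R)) (EFin \o f).
  exact/measurable_EFinP.
apply: (@le_integrable _ (LebR R) R (leb R) D mD (EFin \o f) (EFin \o g) mF _ gi).
by move=> t Dt; rewrite lee_fin (le_trans (fg t Dt))// ler_norm.
Qed.

Lemma leb_integrable_measurable D f : leb_integrable D f -> leb_measurable_fun D f.
Proof. by move=> fi; apply/measurable_EFinP; exact: measurable_int fi. Qed.

Lemma leb_integrable_borel D f : measurable D -> measurable_fun (setT : set R) f ->
  mu.-integrable D (EFin \o f) -> leb_integrable D f.
Proof.
move=> mD mf /integrableP[_ foo]; apply/integrableP; split.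
  by apply/measurable_EFinP; apply: borel_leb_measurable_fun => //; exact: measurable_funTS.
rewrite leb_integral_borel//; apply: measurableT_comp => //.
exact/measurable_EFinP.
Qed.

Lemma leb_integrable_cst a b (r : R) : leb_integrable `[a, b] (fun=> r).
Proof.
have foo : (mu `[a, b]%classic < +oo)%E.
  by rewrite lebesgue_measure_itv/=; case: ifP; rewrite ?ltry// -EFinB ltry.
apply: leb_integrable_borel; [exact: measurable_itv|exact: measurable_cst|].
apply: measurable_bounded_integrable.
- exact: measurable_itv.
- exact: foo.
- exact: measurable_cst.
- by exists `|r|; split; [exact: num_real|move=> x rx t _ /=; exact: ltW].
Qed.

Lemma leb_int_cst a b (r : R) : a <= b -> leb_int `[a, b] (fun=> r) = r * (b - a).
Proof.
move=> ab; rewrite leb_int_borel//.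
rewrite Rintegral_cst//.
rewrite [X in fine X](lebesgue_measure_itv `[a, b])/= lte_fin; move: ab; rewrite le_eqVlt => /predU1P[->|ab].
  by rewrite ltxx subrr.
by rewrite ab.
Qed.

Lemma leb_int_oc a b s t f : leb_integrable `[a, b] f -> a <= s -> s <= t -> t <= b ->
  leb_int `]s, t] f = leb_int `[a, t] f - leb_int `[a, s] f.
Proof.
move=> fi as_ st tb; rewrite /leb_int.
have -> : `[a, t]%classic = `[a, s]%classic `|` `]s, t]%classic.
  by rewrite -itv_bndbnd_setU// bnd_simp.
pose A : set (LebR R) := `[a, s]%classic; pose B : set (LebR R) := `]s, t]%classic.
have mA : measurable A := measurable_leb_itv _.
have mB : measurable B := measurable_leb_itv _.
have ABE : (A `|` B : set R) = `[a, t]%classic.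
  by rewrite /A /B -itv_bndbnd_setU// bnd_simp.
have fAB : leb_integrable (A `|` B) f.
  rewrite ABE; apply: leb_integrableS fi; [exact: measurable_leb_itv..|].
  by apply: subset_itvl; rewrite bnd_simp.
have djAB : [disjoint A & B].
  apply/disj_setPLR => x; rewrite /A /B /= !in_itv/= => /andP[_ xs] /andP[sx _].
  by have := lt_le_trans sx xs; rewrite ltxx.
have := @Rintegral_setU _ (LebR R) R (leb R) A B f mA mB fAB djAB.
by rewrite -/A -/B => ->; rewrite addrC addKr.
Qed.

Lemma leb_int_aa a f : leb_int `[a, a] f = 0.
Proof.
rewrite (@eq_leb_int _ f (fun=> f a)) ?leb_int_cst ?lexx ?subrr ?mulr0//.
by move=> t; rewrite /= in_itv/= => /andP[ta at_]; congr f; apply/eqP; rewrite eq_le ta at_.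
Qed.

Lemma leb_int_small a b f (e : R) : leb_integrable `[a, b] f -> 0 < e ->
  exists2 d : R, 0 < d & forall E : set R, measurable E -> E `<=` `[a, b]%classic ->
    (mu E < d%:E)%E -> leb_int E (fun t => `|f t|) < e.
Proof.
move=> fi e0; have mab := measurable_leb_itv `[a, b].
have ih : (leb R).-integrable setT (EFin \o (f \_ `[a, b]%classic : LebR R -> R)).
  move: fi; rewrite /leb_integrable integrable_mkcond//.
  by rewrite -restrict_EFin.
have [d [d0 dP]] := integral_normr_continuous ih e0.
exists d => // E mE Eab Ed; have := dP E (borel_leb_measurable _ mE) Ed.
congr (_ < _); apply: eq_Rintegral => t /set_mem Et.
by rewrite patchE mem_set//; exact: Eab.
Qed.

(** The increments over a disjoint family add up to the integral over its union, to which absolute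
    continuity of the integral applies. *)
Lemma leb_int_ac a b f : leb_integrable `[a, b] f -> (forall t, a <= t <= b -> 0 <= f t) ->
  ac_real a b (fun t => leb_int `[a, t] f).
Proof.
move=> fi f0 e e0; have [d d0 dP] := leb_int_small _ _ _ _ fi e0.
exists d => // J u v [uv djt] lt.
have mI i : measurable (`]u i, v i] : set R) by exact: measurable_itv.
pose E : set R := \big[setU/set0]_(i <- index_enum J) `]u i, v i]%classic.
have mE : measurable E by exact: bigsetU_measurable.
have tI : trivIset setT (fun i => `]u i, v i]%classic).
  move=> i j _ _ [t []]; rewrite /= !in_itv/= => /andP[ut tv] /andP[ut' tv'].
  apply: contrapT => /djt[h|h].
    by have := lt_le_trans ut' (le_trans tv h); rewrite ltxx.
  by have := lt_le_trans ut (le_trans tv' h); rewrite ltxx.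
have Eab : E `<=` `[a, b]%classic.
  rewrite /E -bigcup_seq => t [i _]; rewrite /= !in_itv/= => /andP[ut tv].
  by have [au [_ vb]] := uv i; rewrite (le_trans au (ltW ut)) (le_trans tv vb).
have muE : (mu E < d%:E)%E.
  apply: le_lt_trans (_ : (\sum_i (v i - u i))%:E < _)%E; last by rewrite lte_fin.
  rewrite /E; elim: (index_enum J) => [|i s ih]; first by rewrite !big_nil measure0.
  rewrite !big_cons EFinD (le_trans (measureU2 _ _ _))//.
    exact: bigsetU_measurable.
  apply: leeD => //; have [_ [uvi _]] := uv i.
  rewrite [leLHS](lebesgue_measure_itv `]u i, v i])/= lte_fin.
  by case: ltP => // h; rewrite lee_fin subr_ge0.
have := dP E mE Eab muE; apply: le_lt_trans.
rewrite le_eqVlt; apply/orP; left; apply/eqP.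
have mab := measurable_leb_itv `[a, b].
have fiE : leb_integrable E f.
  exact: (leb_integrableS _ _ _ mab (borel_leb_measurable _ mE) Eab fi).
have sub i : `]u i, v i]%classic `<=` `[a, b]%classic.
  have [au [uvi vb]] := uv i; move=> t; rewrite /= !in_itv/= => /andP[ut tv].
  by rewrite (le_trans au (ltW ut)) (le_trans tv vb).
rewrite (@eq_leb_int E _ f); last first.
  by move=> t /Eab; rewrite /= in_itv/= => tab; rewrite ger0_norm// f0.
rewrite /leb_int /Rintegral /E (@integral_bigsetU_EFin _ (LebR R))/=.
- rewrite (eq_bigr (fun i => (leb_int `]u i, v i] f)%:E)); last first.
    move=> i _; rewrite fineK//; apply: integrable_fin_num.
      exact: measurable_leb_itv.
    by apply: leb_integrableS (sub i) fi; exact: measurable_leb_itv.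
  rewrite sumEFin/=; apply: eq_bigr => i _; have [au [uvi vb]] := uv i.
  rewrite (leb_int_oc _ _ _ _ _ fi)// ger0_norm// subr_ge0.
  rewrite -subr_ge0 -(leb_int_oc _ _ _ _ _ fi)// leb_int_ge0// => t /sub.
  by rewrite /= in_itv/=; exact: f0.
- by move=> i; exact: measurable_leb_itv.
- exact: index_enum_uniq.
- exact: sub_trivIset tI.
- exact: measurable_int fiE.
Qed.

End LebIntTheory.

(** * Fundamental theorem of calculus and Gronwall's inequality *)

Section FundamentalTheorem.
Context {R : realType}.
Implicit Types (f g F : R -> R) (a b : R).
Local Notation mu := (@lebesgue_measure R).

Lemma ae_neq a : {ae leb R, forall t : LebR R, (t : R) <> a}.
Proof.
apply: ae_lebesgue_leb; exists [set a]; split=> [||t /= /contrapT//].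
- exact: measurable_set1.
- exact: lebesgue_measure_set1.
Qed.

Lemma ae_itv_oo a b (P : R -> Prop) :
  {ae leb R, forall t : LebR R, a < t -> t < b -> P t} ->
  {ae leb R, forall t : LebR R, a <= t -> t <= b -> P t}.
Proof.
move=> aeP; have aeN := ae_leb_imply2 _ _ _ (ae_neq a) (ae_neq b) (fun t p q => conj p q).
apply: (ae_leb_imply2 _ _ _ aeP aeN) => t Pt [/eqP ta /eqP tb] at_ tb'.
by apply: Pt; rewrite lt_neqAle ?at_ ?tb' ?tb// eq_sym ta.
Qed.

Lemma primitive_is_derive a b F f : leb_integrable `[a, b] f ->
  (forall t, a <= t -> t <= b -> F t = F a + leb_int `[a, t] f) ->
  {ae leb R, forall t : LebR R, a <= t -> t <= b -> is_derive (t : R) (1 : R) F (f t)}.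
Proof.
move=> fi FE; apply: ae_itv_oo; apply: (ae_leb_imply _ _ (leb_FTC1 _ _ _ fi)) => t dt at_ tb.
apply: (@near_eq_is_derive _ _ _ (cst (F a) + (fun s => leb_int `[a, s] f))).
  near=> s; have as_ : a <= s by near: s; exact: lt_le_nbhsr.
  have sb : s <= b by near: s; exact: lt_le_nbhsl.
  by rewrite [F s]FE.
by rewrite -[f t]add0r; have ? := dt at_ tb; exact: is_deriveD.
Unshelve. all: by end_near. Qed.

Lemma ac_real_primitive a b F : a <= b -> ac_real a b F ->
  exists2 f, leb_integrable `[a, b] f &
    forall t, a <= t -> t <= b -> F t = F a + leb_int `[a, t] f.
Proof.
rewrite le_eqVlt => /predU1P[<-|ab] acF.
  exists (fun=> 0); first exact: leb_integrable_cst.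
  move=> t at_ ta; have -> : t = a by apply/eqP; rewrite eq_le ta at_.
  by rewrite leb_int_aa addr0.
have [V [W [FE acV acW ndV ndW]]] := ac_real_decomp _ _ _ acF (ltW ab).
have [v [mv iv vE]] := ac_mono_density _ _ _ ab acV ndV.
have [w [mw iw wE]] := ac_mono_density _ _ _ ab acW ndW.
have mab := measurable_leb_itv `[a, b].
have dens (G g : R -> R) : measurable_fun (setT : set R) g -> mu.-integrable setT (EFin \o g) ->
    (forall t, a <= t -> t <= b -> (\int[mu]_(s in `]a, t]) (g s)%:E = (G t - G a)%:E)%E) ->
    leb_integrable `[a, b] g /\
    forall t, a <= t -> t <= b -> leb_int `[a, t] g = G t - G a.
  move=> mg ig gE; split.
    by apply: leb_integrable_borel => //; apply: integrableS ig.
  move=> t at_ tb; rewrite leb_int_borel// -Rintegral_itv_obnd_cbnd; last first.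
    by apply: integrableS ig.
  by rewrite /Rintegral gE.
have [lv lvE] := dens V v mv iv vE; have [lw lwE] := dens W w mw iw wE.
exists (fun t => v t - w t); first exact: leb_integrableB.
move=> t at_ tb; have at' : leb_integrable `[a, t] v /\ leb_integrable `[a, t] w.
  have sub : `[a, t]%classic `<=` `[a, b]%classic by apply: subset_itvl; rewrite bnd_simp.
  by split; [apply: leb_integrableS sub lv|apply: leb_integrableS sub lw];
    exact: measurable_leb_itv.
rewrite leb_intB; [|exact: measurable_leb_itv|exact: at'.1|exact: at'.2].
by rewrite lvE// lwE// !FE// ?lexx ?(ltW ab)//; ring.
Qed.

Lemma leb_int_nd a b f s t : leb_integrable `[a, b] f ->
  (forall r, a <= r -> r <= b -> 0 <= f r) -> a <= s -> s <= t -> t <= b ->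
  leb_int `[a, s] f <= leb_int `[a, t] f.
Proof.
move=> fi f0 as_ st tb; rewrite -subr_ge0 -(leb_int_oc _ _ _ _ _ fi)//.
apply: leb_int_ge0 => r; rewrite /= in_itv/= => /andP[sr rt].
by apply: f0; [exact: le_trans as_ (ltW sr)|exact: le_trans rt tb].
Qed.

Lemma expR_lip (x y B : R) : x <= B -> y <= B -> `|expR x - expR y| <= expR B * `|x - y|.
Proof.
wlog xy : x y / x <= y => [hw|] xB yB.
  have [xy|yx] := leP x y; first exact: hw.
  by rewrite distrC [`|x - y|]distrC hw// ltW.
rewrite ler0_norm ?subr_le0 ?ler_expR// ler0_norm ?subr_le0// !opprB.
apply: (@le_trans _ _ (expR y * (y - x))); last first.
  by rewrite ler_wpM2r ?subr_ge0// ler_expR.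
have := expR_ge1Dx (x - y); rewrite expRD expRN => h.
have y0 := expR_gt0 y.
rewrite lerBlDr -lerBlDl -[X in X - _]mulr1 -mulrBr.
by rewrite mulrC -ler_pdivlMr//; lra.
Qed.

Section exponential.
Variables (a b : R) (c : R -> R).
Hypothesis ab : a <= b.
Hypothesis ci : leb_integrable `[a, b] c.
Hypothesis c0 : forall t, a <= t -> t <= b -> 0 <= c t.
Let C t := leb_int `[a, t] c.

(** [exp C] is absolutely continuous, as a function Lipschitz on the range of [C] composed with [C];
    it is thus a primitive, and the chain rule identifies its density almost everywhere. *)
Lemma leb_int_expR : leb_integrable `[a, b] (fun t => c t * expR (C t)) /\
  forall t, a <= t -> t <= b ->
    leb_int `[a, t] (fun t => c t * expR (C t)) = expR (C t) - 1.
Proof.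
have Ca : C a = 0 by rewrite /C leb_int_aa.
have Cb t : a <= t -> t <= b -> C t <= C b by move=> at_ tb; apply: leb_int_nd tb (lexx _).
have acE : ac_real a b (expR \o C).
  move=> e e0; have B0 := expR_gt0 (C b).
  have c0' t : a <= t <= b -> 0 <= c t by move=> /andP[]; exact: c0.
  have [d d0 dP] := leb_int_ac _ _ _ ci c0' _ (divr_gt0 e0 B0).
  exists d => // J u v djt lt; have := dP J u v djt lt.
  rewrite ltr_pdivlMr//; apply: le_lt_trans; rewrite mulr_suml; apply: ler_sum => i _.
  have [au [uv vb]] := djt.1 i.
  rewrite mulrC; apply: expR_lip; apply: Cb => //; first exact: le_trans uv.
  exact: le_trans vb.
have [g gi gE] := ac_real_primitive _ _ _ ab acE.
have gc : {ae leb R, forall t : LebR R, (`[a, b]%classic : set R) t ->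
    g t = c t * expR (C t)}.
  have dg := primitive_is_derive _ _ _ _ gi gE.
  have dC : {ae leb R, forall t : LebR R, a <= t -> t <= b ->
      is_derive (t : R) (1 : R) C (c t)}.
    by apply: primitive_is_derive => // t at_ tb; rewrite Ca add0r.
  apply: (ae_leb_imply2 _ _ _ dg dC) => t h1 h2; rewrite /= in_itv/= => /andP[at_ tb].
  have {}h1 := h1 at_ tb; have {}h2 := h2 at_ tb.
  have h3 : is_derive (t : R) (1 : R) (expR \o C) (expR (C t) * c t).
    by apply: is_derive1_comp.
  by rewrite -(@derive_val _ _ _ _ _ _ _ h1) (@derive_val _ _ _ _ _ _ _ h3) mulrC.
have mab := measurable_leb_itv `[a, b].
split=> [|t at_ tb]; first exact: ae_leb_integrable gc.
have := gE t at_ tb; rewrite /= Ca expR0 => ->; rewrite addrC addKr.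
apply/esym/ae_leb_int; first exact: measurable_itv.
  apply: leb_integrable_measurable; apply: leb_integrableS gi => //.
    exact: measurable_leb_itv.
  by apply: subset_itvl; rewrite bnd_simp.
apply: (ae_leb_imply _ _ gc) => s h; rewrite /= in_itv/= => /andP[as_ st]; apply: h.
by rewrite /= in_itv/= as_ (le_trans st).
Qed.

(** Let [S] be the supremum of [phi exp(-C)]. Inserting [phi <= S exp C] under the integral gives
    [phi <= A + S (exp C - 1)]; if [S > A], then [phi exp(-C) <= S - (S - A) exp(- C b)], strictly
    below its own supremum. *)
Lemma gronwall (phi : R -> R) (A N : R) : 0 <= A ->
  (forall t, a <= t -> t <= b -> phi t <= N) ->
  leb_integrable `[a, b] (fun t => c t * phi t) ->
  (forall t, a <= t -> t <= b -> phi t <= A + leb_int `[a, t] (fun s => c s * phi s)) ->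
  forall t, a <= t -> t <= b -> phi t <= A * expR (C t).
Proof.
move=> A0 phiN ci' phile.
pose P := [set phi t * expR (- C t) | t in `[a, b]%classic].
have abP t : a <= t -> t <= b -> P (phi t * expR (- C t)).
  by move=> at_ tb; exists t => //; rewrite /= in_itv/= at_.
have C0 t : a <= t -> t <= b -> 0 <= C t.
  move=> at_ tb; apply: leb_int_ge0 => s; rewrite /= in_itv/= => /andP[as_ st].
  by apply: c0 => //; exact: le_trans tb.
have ubP : has_ubound P.
  exists `|N| => _ [t + <-]; rewrite /= in_itv/= => /andP[at_ tb].
  apply: (@le_trans _ _ (`|N| * expR (- C t))).
    by rewrite ler_wpM2r ?expR_ge0// (le_trans (phiN t _ _))// ler_norm.
  by rewrite -[leRHS]mulr1 ler_wpM2l// -expR0 ler_expR oppr_le0 C0.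
pose S := sup P.
have phiS t : a <= t -> t <= b -> phi t <= S * expR (C t).
  move=> at_ tb; have := ub_le_sup ubP (abP t at_ tb).
  by rewrite expRN ler_pdivrMr ?expR_gt0.
have [ei eE] := leb_int_expR.
have main t : a <= t -> t <= b -> phi t <= A + S * (expR (C t) - 1).
  move=> at_ tb; apply: le_trans (phile t at_ tb) _; rewrite lerD2l -eE//.
  have mat := measurable_leb_itv `[a, t].
  have sub : `[a, t]%classic `<=` `[a, b]%classic by apply: subset_itvl; rewrite bnd_simp.
  have ei' : leb_integrable `[a, t] (fun s => c s * expR (C s)).
    by apply: leb_integrableS sub ei => //; exact: measurable_leb_itv.
  rewrite -leb_intZ//; apply: leb_int_le => //.
  - by apply: leb_integrableS sub ci' => //; exact: measurable_leb_itv.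
  - exact: leb_integrableZ.
  - move=> s; rewrite /= in_itv/= => /andP[as_ st]; have sb := le_trans st tb.
    by rewrite mulrCA ler_wpM2l ?c0// phiS.
suff SA : S <= A.
  by move=> t at_ tb; apply: le_trans (phiS t at_ tb) _; rewrite ler_wpM2r ?expR_ge0.
rewrite leNgt; apply/negP => AS.
have CC t : a <= t -> t <= b -> C t <= C b by move=> at_ tb; apply: leb_int_nd tb (lexx _).
suff : S <= S - (S - A) * expR (- C b).
  by rewrite lerBrDr gerDl leNgt mulr_gt0 ?expR_gt0 ?subr_gt0.
apply: ge_sup; first by exists (phi a * expR (- C a)); exact: abP.
move=> _ [t + <-]; rewrite /= in_itv/= => /andP[at_ tb].
have e0 := expR_gt0 (- C t).
apply: (@le_trans _ _ (S - (S - A) * expR (- C t))); last first.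
  by rewrite lerD2l lerN2 ler_wpM2l ?subr_ge0 ?(ltW AS)// ler_expR lerN2 CC.
apply: le_trans (ler_wpM2r (ltW e0) (main t at_ tb)) _.
have -> : (A + S * (expR (C t) - 1)) * expR (- C t) =
   S * (expR (C t) * expR (- C t)) - (S - A) * expR (- C t) by ring.
by rewrite -expRD subrr expR0 mulr1.
Qed.

End exponential.
End FundamentalTheorem.

(** * Integrals of vector functions *)

Section VectorIntegral.
Context {R : realType} {n : nat}.
Notation V := 'rV[R]_n.
Implicit Types (u v : R -> V) (f phi : R -> R) (D : set R) (a b : R).

Definition leb_measurable_vec D (u : R -> V) :=
  measurable_vec (D : set (LebR R)) (u : LebR R -> V).

Definition vec_integrable D u := forall i, leb_integrable D (fun t => u t ord0 i).

Definition vint D u : V := \row_i leb_int D (fun t => u t ord0 i).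

Lemma vec_integrable_dom D u phi : measurable (D : set (LebR R)) ->
  leb_measurable_vec D u -> leb_integrable D phi ->
  (forall t, D t -> enorm (u t) <= phi t) -> vec_integrable D u.
Proof.
move=> mD mu iphi uphi i; apply: le_leb_integrable iphi => //; first exact: mu.
by move=> t Dt; apply: le_trans (enorm_coord _ _) (uphi t Dt).
Qed.

Lemma vintB D u v : measurable (D : set (LebR R)) -> vec_integrable D u ->
  vec_integrable D v -> vint D (fun t => u t - v t) = vint D u - vint D v.
Proof.
move=> mD iu iv; apply/rowP => i; rewrite !mxE -leb_intB//.
by apply: eq_leb_int => t _; rewrite !mxE.
Qed.

Lemma dotv_vint D u (w : V) : measurable (D : set (LebR R)) -> vec_integrable D u ->
  leb_integrable D (fun t => dotv w (u t)) /\
  dotv w (vint D u) = leb_int D (fun t => dotv w (u t)).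
Proof.
move=> mD iu; rewrite /dotv.
have main (s : seq 'I_n) :
  leb_integrable D (fun t => \sum_(i <- s) w ord0 i * u t ord0 i) /\
  \sum_(i <- s) w ord0 i * vint D u ord0 i =
    leb_int D (fun t => \sum_(i <- s) w ord0 i * u t ord0 i); last exact: main.
elim: s => [|j s [is_ sE]].
  have -> : (fun t : R => \sum_(i <- [::]) w ord0 i * u t ord0 i) = (fun=> 0).
    by apply/funext => t; rewrite big_nil.
  split; first exact: integrable0.
  by rewrite big_nil /leb_int /Rintegral integral0.
have -> : (fun t : R => \sum_(i <- j :: s) w ord0 i * u t ord0 i) =
    (fun t => w ord0 j * u t ord0 j + \sum_(i <- s) w ord0 i * u t ord0 i).
  by apply/funext => t; rewrite big_cons.
have ij := leb_integrableZ _ _ (w ord0 j) mD (iu j).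
split; first exact: leb_integrableD.
by rewrite big_cons leb_intD// leb_intZ// sE mxE.
Qed.

(* Cauchy-Schwarz applied to the pairing of the integral with itself. *)
Lemma enorm_vint_le D u phi : measurable (D : set (LebR R)) -> vec_integrable D u ->
  leb_integrable D phi -> (forall t, D t -> enorm (u t) <= phi t) ->
  enorm (vint D u) <= leb_int D phi.
Proof.
move=> mD iu iphi uphi; set w := vint D u.
have [iw wE] := dotv_vint _ _ w mD iu.
have : enorm w ^+ 2 <= enorm w * leb_int D phi.
  rewrite enorm_sqr wE -leb_intZ//; apply: leb_int_le => //.
    exact: leb_integrableZ.
  move=> t Dt; apply: le_trans (dotv_le _ _) _.
  by rewrite ler_wpM2l ?enorm_ge0// uphi.
have := enorm_ge0 w; rewrite le_eqVlt => /predU1P[<- _|w0].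
  by apply: leb_int_ge0 => t Dt; rewrite (le_trans (enorm_ge0 (u t)))// uphi.
by rewrite expr2 ler_pM2l.
Qed.

Lemma leb_integrable_sub a b s t f : a <= s -> t <= b ->
  leb_integrable `[a, b] f -> leb_integrable `[s, t] f.
Proof.
move=> as_ tb; apply: leb_integrableS; [exact: measurable_leb_itv..|].
by apply: subset_itv; rewrite bnd_simp.
Qed.

Lemma vec_integrable_sub a b s t u : a <= s -> t <= b ->
  vec_integrable `[a, b] u -> vec_integrable `[s, t] u.
Proof. by move=> as_ tb iu i; apply: leb_integrable_sub (iu i). Qed.

Lemma enorm_vint_sub a b s t u phi : vec_integrable `[a, b] u ->
  leb_integrable `[a, b] phi -> (forall r, a <= r -> r <= b -> enorm (u r) <= phi r) ->
  a <= s -> s <= t -> t <= b ->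
  enorm (vint `[a, t] u - vint `[a, s] u) <=
  leb_int `[a, t] phi - leb_int `[a, s] phi.
Proof.
move=> iu ip up as_ st tb.
have -> : vint `[a, t] u - vint `[a, s] u = vint `]s, t] u.
  by apply/rowP => i; rewrite !mxE (leb_int_oc _ _ _ _ _ (iu i)).
have sub : `]s, t]%classic `<=` `[a, b]%classic.
  by move=> r; rewrite /= !in_itv/= => /andP[sr rt];
     rewrite (le_trans as_ (ltW sr)) (le_trans rt tb).
rewrite -(leb_int_oc _ _ _ _ _ ip)//; apply: enorm_vint_le.
- exact: measurable_leb_itv.
- by move=> i; apply: leb_integrableS sub (iu i); exact: measurable_leb_itv.
- by apply: leb_integrableS sub ip; exact: measurable_leb_itv.
- by move=> r /sub; rewrite /= in_itv/= => /andP[]; exact: up.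
Qed.

Lemma leb_int_measurable a b f : leb_integrable `[a, b] f ->
  leb_measurable_fun `[a, b] (fun t => leb_int `[a, t] f).
Proof.
move=> fi; have mab : measurable (`[a, b] : set R) := measurable_itv _.
have [ba|ab] := ltP b a.
  by rewrite set_itv_ge ?bnd_simp -?ltNge//; exact: measurable_fun_set0.
have [g mg fg] := ex_borel_version _ _ mab (leb_integrable_measurable _ _ fi).
have gi := ae_leb_integrable _ _ _ (measurable_leb_itv _) fi fg.
have bgi := borel_integrable _ _ mab mg gi.
have /(subspace_continuous_measurable_fun mab) mF := parameterized_integral_continuous ab bgi.
have := borel_leb_measurable_fun _ _ mab mF; apply: eq_measurable_fun => t.
move=> /set_mem; rewrite /= in_itv/= => /andP[at_ tb].
have mat : measurable (`[a, t] : set R) := measurable_itv _.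
transitivity (leb_int `[a, t] g); first by rewrite leb_int_borel.
apply/esym/ae_leb_int => //.
  by apply: leb_integrable_measurable; exact: leb_integrable_sub fi.
apply: (ae_leb_imply _ _ fg) => s h; rewrite /= in_itv/= => /andP[as_ st]; apply: h.
by rewrite /= in_itv/= as_ (le_trans st).
Qed.

Lemma vint_measurable a b u : vec_integrable `[a, b] u ->
  leb_measurable_vec `[a, b] (fun t => vint `[a, t] u).
Proof.
move=> iu i; have := leb_int_measurable _ _ _ (iu i).
by apply: eq_measurable_fun => t _; rewrite mxE.
Qed.

(** Each coordinate is differentiable off a null set; the induction on the list of coordinates
    unites these finitely many null sets. *)
Lemma vint_derive1 a b u (x0 : V) (y : R -> V) : vec_integrable `[a, b] u ->
  (forall t, a <= t -> t <= b -> y t = x0 + vint `[a, t] u) ->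
  {ae leb R, forall t : LebR R, a <= t -> t <= b -> derive1 y t = u t}.
Proof.
move=> iu yE.
have dy (s : seq 'I_n) : {ae leb R, forall t : LebR R, forall i, i \in s ->
    a <= t -> t <= b -> is_derive (t : R) (1 : R) (fun r : R => y r ord0 i : R) (u t ord0 i)}.
  elim: s => [|i s ih]; first by apply: (ae_leb_imply _ _ (ae_neq 0)) => t _ i; rewrite in_nil.
  have di := primitive_is_derive a b (fun r : R => y r ord0 i : R) _ (iu i).
  have {}di : {ae leb R, forall t : LebR R, a <= t -> t <= b ->
      is_derive (t : R) (1 : R) (fun r : R => y r ord0 i : R) (u t ord0 i)}.
    apply: di => t at_ tb; have ab := le_trans at_ tb.
    by rewrite (yE t)// (yE a)// !mxE leb_int_aa addr0.
  apply: (ae_leb_imply2 _ _ _ ih di) => t h1 h2 j.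
  by rewrite inE => /predU1P[->|/h1].
apply: (ae_leb_imply _ _ (dy (enum 'I_n))) => t h at_ tb.
have {}h i := h i (mem_enum _ i) at_ tb.
rewrite derive1E; apply/rowP => i; rewrite derive_mx; last first.
  by apply/derivable_mxP => j k; rewrite (ord1 j); case: (h k).
by rewrite mxE; apply: derive_val.
Qed.

End VectorIntegral.

(** * Filippov's theorem for the epigraphical inclusion *)

Section GeometricSequences.
Context {R : realType}.

(** With [r j = 2 B / 2^j] the intervals of radius [r j] around [x j] are nested; the limit is the
    infimum of their right ends. *)
Lemma geometric_cvg (x : nat -> R) (B : R) :
  (forall j, `|x j.+1 - x j| <= B * 2^-1 ^+ j) ->
  exists l, forall j, `|l - x j| <= 2 * B * 2^-1 ^+ j.
Proof.
move=> xB; pose r j : R := 2 * B * 2^-1 ^+ j.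
have rS j : r j = r j.+1 + B * 2^-1 ^+ j by rewrite /r exprS; lra.
have step j : x j - r j <= x j.+1 - r j.+1 /\ x j.+1 + r j.+1 <= x j + r j.
  by have := xB j; rewrite ler_norml (rS j) => /andP[]; split; lra.
have B0 : 0 <= B by have := xB 0%N; rewrite expr0 mulr1; apply: le_trans.
have r0 j : 0 <= r j by rewrite !mulr_ge0// exprn_ge0.
have up i k : x i - r i <= x (i + k)%N - r (i + k)%N /\
    x (i + k)%N + r (i + k)%N <= x i + r i.
  elim: k => [|k [ih1 ih2]]; first by rewrite addn0.
  by have [s1 s2] := step (i + k)%N; rewrite addnS; split; lra.
have cross i j : x i - r i <= x j + r j.
  have [ij|/ltnW ji] := leqP i j.
    by have [h _] := up i (j - i)%N; have := r0 j; rewrite subnKC// in h; lra.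
  by have [_ h] := up j (i - j)%N; have := r0 i; rewrite subnKC// in h; lra.
exists (inf (range (fun j => x j + r j))) => j; rewrite -/(r j) ler_norml.
have h1 := @inf_range_le _ _ (fun j => x j + r j) j _ (cross 0%N).
have h2 := @le_inf_range _ _ (fun j => x j + r j) 0%N _ (cross j).
by apply/andP; split; lra.
Qed.

Lemma le_geometric (x y Q : R) : (forall j, x <= y + Q * 2^-1 ^+ j) -> x <= y.
Proof.
move=> h; have [Q0|Q0] := leP Q 0.
  by apply: le_trans (h 0%N) _; rewrite expr0 mulr1 gerDl.
apply/ler_addgt0Pr => e e0.
have : (fun j => (2^-1 : R) ^+ j) @ \oo --> (0 : R).
  by apply: cvg_expr; rewrite ger0_norm// invf_lt1// ltr1n.
move/cvgrPdist_lt => /(_ (e / Q) (divr_gt0 e0 Q0)) [j _ /(_ j (leqnn j))].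
rewrite sub0r normrN ger0_norm ?exprn_ge0// ltr_pdivlMr// => hj.
by apply: le_trans (h j) _; rewrite lerD2l mulrC ltW.
Qed.

Lemma geometric_cvg0 (x : nat -> R) (y B : R) :
  (forall j, `|y - x j| <= B * 2^-1 ^+ j) -> x @ \oo --> y.
Proof.
move=> h; apply/cvgrPdist_le => e e0.
have : (fun j => `|B| * (2^-1 : R) ^+ j) @ \oo --> (`|B| * 0 : R).
  by apply: cvgMr; apply: cvg_expr; rewrite ger0_norm// invf_lt1// ltr1n.
rewrite mulr0 => /cvgrPdist_lt/(_ e e0); apply: filterS => j.
rewrite sub0r normrN ger0_norm ?mulr_ge0 ?exprn_ge0// => hj.
apply: le_trans (h j) (le_trans _ (ltW hj)).
by rewrite ler_wpM2r ?exprn_ge0// ler_norm.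
Qed.

End GeometricSequences.

Definition on_itv {R : realType} (a b : R) (P : R -> Prop) :=
  forall t, (`[a, b]%classic : set R) t -> P t.

(** The standing hypotheses on a subinterval, with (HLC) at the single radius [r] of a ball in which
    the arcs under study stay. *)
Record regular_hamiltonian {R : realType} {n : nat} (a b : R)
    (H : R -> 'rV[R]_n -> 'rV[R]_n -> R) (c K : R -> R) (r : R) : Prop := {
  rh_meas : forall x p, leb_measurable_fun `[a, b] (fun t => H t x p);
  rh_conv : on_itv a b (fun t => forall x, convex_fun_rV (H t x));
  rh_c0 : on_itv a b (fun t => 0 <= c t);
  rh_ci : leb_integrable `[a, b] c;
  rh_lip : on_itv a b (fun t => forall x p q,
    `|H t x p - H t x q| <= c t * (1 + enorm x) * enorm (p - q));
  rh_K0 : on_itv a b (fun t => 0 <= K t);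
  rh_Ki : leb_integrable `[a, b] K;
  rh_Kr : on_itv a b (fun t => forall x y p, enorm x <= r -> enorm y <= r ->
    `|H t x p - H t y p| <= K t * (1 + enorm p) * enorm (x - y)) }.

Section Filippov.
Opaque leb_int leb_integrable.
Context {R : realType} {n : nat}.
Notation V := 'rV[R]_n.
Variables (a b : R) (H : R -> V -> V -> R) (c K : R -> R) (r A : R) (x0 : V).
Notation D := (`[a, b]%classic : set R).

Hypothesis ab : a <= b.
Hypothesis rh : regular_hamiltonian a b H c K r.
Let Hmeas := rh_meas _ _ _ _ _ _ rh.
Let Hconv := rh_conv _ _ _ _ _ _ rh.
Let c0 := rh_c0 _ _ _ _ _ _ rh.
Let ci := rh_ci _ _ _ _ _ _ rh.
Let Hlip := rh_lip _ _ _ _ _ _ rh.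
Let K0 := rh_K0 _ _ _ _ _ _ rh.
Let Ki := rh_Ki _ _ _ _ _ _ rh.
Let Kr := rh_Kr _ _ _ _ _ _ rh.
Hypothesis x0A : 1 + enorm x0 <= A.

Let C t := leb_int `[a, t] c.
Hypothesis rA : A * expR (C b) <= r.

Let bet t := A * (c t * expR (C t)).
Let kap t := leb_int `[a, t] (fun s => 2 * K s).
(** The Bielecki weight: [2 K E] has the primitive [E - 1], so integrating [K] against [E] yields at
    most [E / 2]. *)
Let E t := expR (kap t).

Definition traj (x : V) (u : R -> V) t := x + vint `[a, t] u.

Let mD : measurable (D : set (LebR R)). Proof. exact: measurable_leb_itv. Qed.

Let DP t : a <= t -> t <= b -> D t.
Proof. by move=> at_ tb; rewrite /= in_itv/= at_. Qed.

Let A1 : 1 <= A.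
Proof. by apply: le_trans x0A; rewrite lerDl enorm_ge0. Qed.

Let A0 : 0 <= A. Proof. exact: le_trans A1. Qed.

Let ci_exp : leb_integrable D (fun t => c t * expR (C t)) /\
  forall t, a <= t -> t <= b ->
    leb_int `[a, t] (fun t => c t * expR (C t)) = expR (C t) - 1.
Proof. by apply: leb_int_expR => // t at_ tb; apply: c0; exact: DP. Qed.

Let beti : leb_integrable D bet.
Proof. by apply: leb_integrableZ => //; exact: ci_exp.1. Qed.

(* [bet] is the a priori bound that (H4) and Gronwall impose on any velocity of
   finite cost; it is stable under the iteration below. *)
Definition slow (u : R -> V) := leb_measurable_vec D u /\
  forall t, D t -> enorm (u t) <= bet t.

Lemma slow_integrable u : slow u -> vec_integrable D u.
Proof. by move=> [mu ub]; exact: vec_integrable_dom ub. Qed.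

Let sub_itv t : t <= b -> `[a, t]%classic `<=` D.
Proof. by move=> tb; apply: subset_itvl; rewrite bnd_simp. Qed.

(** The integral of [bet] over [[a, t]] is exactly [A (exp (C t) - 1)]. Consequently
    [c (1 + |y|) <= bet] along slow arcs, which makes slowness self-reproducing. *)
Lemma traj_bound u t : slow u -> a <= t -> t <= b -> 1 + enorm (traj x0 u t) <= A * expR (C t).
Proof.
move=> su at_ tb; have iu := slow_integrable _ su.
have h : enorm (vint `[a, t] u) <= leb_int `[a, t] bet.
  apply: enorm_vint_le.
  - exact: measurable_leb_itv.
  - exact: vec_integrable_sub iu.
  - exact: leb_integrable_sub beti.
  - by move=> s /(sub_itv _ tb); exact: su.2.
have bE : leb_int `[a, t] bet = A * (expR (C t) - 1).
  rewrite -ci_exp.2// leb_intZ//; first exact: measurable_leb_itv.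
  exact: leb_integrable_sub ci_exp.1.
have := enormD x0 (vint `[a, t] u); have := x0A; rewrite /traj bE in h *; lra.
Qed.

Let C_le t : a <= t -> t <= b -> C t <= C b.
Proof.
move=> at_ tb; apply: leb_int_nd tb (lexx _) => // s as_ sb.
by apply: c0; exact: DP.
Qed.

Lemma traj_lt u t : slow u -> D t -> enorm (traj x0 u t) < r.
Proof.
move=> su; rewrite /= in_itv/= => /andP[at_ tb].
have e1 : expR (C t) <= expR (C b) by rewrite ler_expR; exact: C_le.
apply: (lt_le_trans _ (le_trans (ler_wpM2l A0 e1) rA)).
by apply: lt_le_trans (traj_bound _ _ su at_ tb); rewrite ltrDr.
Qed.

Lemma traj_meas u : slow u -> leb_measurable_vec D (traj x0 u).
Proof.
move=> su; apply: measurable_vecD; first exact: measurable_vec_cst.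
exact: vint_measurable (slow_integrable _ su).
Qed.

Lemma H_traj_meas u p : slow u -> leb_measurable_fun D (fun t => H t (traj x0 u t) p).
Proof.
move=> su; apply: (@measurable_fun_lip_comp _ (LebR R) R n D (fun t x => H t x p)
  (fun t => K t * (1 + enorm p)) (traj x0 u) r).
- by move=> x; exact: Hmeas.
- apply: measurable_funM; last exact: measurable_cst.
  exact: leb_integrable_measurable.
- by move=> t Dt; rewrite mulr_ge0 ?K0// addr_ge0// enorm_ge0.
- by move=> t Dt x x' xr x'r; exact: Kr.
- exact: traj_meas.
- by move=> t; exact: traj_lt.
Qed.

Let H_lip_rV t x : D t -> lip_rV (c t * (1 + enorm x)) (H t x).
Proof. by move=> Dt p q; apply: le_trans (ler_norm _) (Hlip _ Dt _ _ _). Qed.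

(* [u] satisfies the inclusion [(u, al) \in epi H^*(t, y, .)] along its own
   trajectory up to the error [ga (1 + |p|)]. *)
Definition almost_solution (u : R -> V) (al ga : R -> R) :=
  [/\ slow u, leb_measurable_fun D al, leb_measurable_fun D ga,
    forall t, D t -> 0 <= ga t &
    forall t, D t -> forall p,
      dotv (u t) p <= H t (traj x0 u t) p + al t + ga t * (1 + enorm p)].

Let next_u u (al ga : R -> R) t : V :=
  sandwich (H t (traj x0 u t)) (al t + ga t) (u t) (ga t).

Let next_ga u u' t : R := K t * enorm (traj x0 u' t - traj x0 u t).

(** The part [ga] of the defect is paid for in the cost; the part [ga |p|] is removed by moving the
    velocity by at most [ga]. The new pair is exact along the old trajectory, hence by (HLC) has the
    defect [K |y' - y| (1 + |p|)] along its own. *)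
Lemma almost_solution_next u al ga : almost_solution u al ga ->
  almost_solution (next_u u al ga) (fun t => al t + ga t) (next_ga u (next_u u al ga)) /\
  forall t, D t -> enorm (next_u u al ga t - u t) <= ga t.
Proof.
move=> [su mal mga ga0 uH]; set u' := next_u u al ga.
have uH' t : D t -> forall q, dotv (u t) q - ga t * enorm q <=
    H t (traj x0 u t) q + (al t + ga t).
  by move=> Dt q; have := uH t Dt q; lra.
have u'u t : D t -> enorm (u' t - u t) <= ga t.
  move=> Dt; apply: (sandwich_dist _ _ _ _ _ _ (H_lip_rV _ _ Dt)) => //.
  - exact: Hconv.
  - exact: ga0.
  - exact: uH'.
have u'H t : D t -> forall p, dotv (u' t) p <= H t (traj x0 u t) p + (al t + ga t).
  move=> Dt p; apply: (sandwich_le _ _ _ _ _ _ (H_lip_rV _ _ Dt)) => //.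
  - exact: Hconv.
  - exact: ga0.
  - exact: uH'.
have su' : slow u'.
  split.
    apply: (@measurable_sandwich _ (LebR R) R n D (fun t p => H t (traj x0 u t) p)
      (fun t => c t * (1 + enorm (traj x0 u t))) (fun t => al t + ga t) ga u).
    - by move=> p; exact: H_traj_meas.
    - exact: measurable_funD.
    - exact: mga.
    - exact: su.1.
    - by move=> t Dt; exact: Hconv.
    - by move=> t Dt; exact: H_lip_rV.
    - exact: ga0.
    - exact: uH'.
  (* Exactness along the old trajectory puts the new velocity in the domain of [H^*] there, so (H4)
     bounds it. *)
  move=> t Dt; apply: (@le_trans _ _ (c t * (1 + enorm (traj x0 u t)))).
    apply: (@Hstar_dom_bound _ _ H t (traj x0 u t)).
    - by rewrite mulr_ge0 ?c0// addr_ge0// enorm_ge0.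
    - exact: H_lip_rV.
    - apply: (@le_lt_trans _ _ (al t + ga t)%:E); last exact: ltry.
      by apply/HstarP; exact: u'H.
  rewrite /bet mulrCA ler_wpM2l ?c0//.
  by move: Dt; rewrite /= in_itv/= => /andP[at_ tb]; exact: traj_bound.
split=> //; split=> //.
- exact: measurable_funD.
- apply: measurable_funM; first exact: leb_integrable_measurable.
  apply: measurable_enorm; apply: measurable_vecB; exact: traj_meas.
- by move=> t Dt; rewrite mulr_ge0 ?K0// enorm_ge0.
- move=> t Dt p; have := u'H t Dt p.
  have := Kr t Dt (traj x0 u' t) (traj x0 u t) p (ltW (traj_lt _ _ su' Dt)) (ltW (traj_lt _ _ su Dt)).
  by rewrite ler_norml /next_ga => /andP[+ _]; lra.
Qed.

Section iteration.
Variables (us : nat -> R -> V) (als gas : nat -> R -> R).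
Hypothesis start : almost_solution (us 0%N) (als 0%N) (gas 0%N).
Hypothesis ga0i : leb_integrable D (gas 0%N).
Hypothesis usS : forall j, us j.+1 = next_u (us j) (als j) (gas j).
Hypothesis alsS : forall j t, als j.+1 t = als j t + gas j t.
Hypothesis gasS : forall j, gas j.+1 = next_ga (us j) (us j.+1).

Let Gam := leb_int D (gas 0%N).
(** [B / 2^j] bounds the [j]-th defect, so the defects sum to at most [2 B]. *)
Let B t := gas 0%N t + Gam * (2 * K t * E t).

Let usP j : almost_solution (us j) (als j) (gas j).
Proof.
elim: j => [|j /almost_solution_next[h _]]; first exact: start.
rewrite gasS usS (_ : als j.+1 = fun t => als j t + gas j t)//.
by apply/funext => t; rewrite alsS.
Qed.

Let us_step j t : D t -> enorm (us j.+1 t - us j t) <= gas j t.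
Proof.
by have [_ h] := almost_solution_next _ _ _ (usP j); rewrite usS; exact: h.
Qed.

Let Gam0 : 0 <= Gam.
Proof. by apply: leb_int_ge0; have [_ _ _ h _] := start. Qed.

Let K2 t : D t -> 0 <= 2 * K t. Proof. by move=> Dt; rewrite mulr_ge0// K0. Qed.

Let kapE : leb_integrable D (fun t => 2 * K t * E t) /\
  forall t, a <= t -> t <= b -> leb_int `[a, t] (fun t => 2 * K t * E t) = E t - 1.
Proof.
apply: leb_int_expR => //; first exact: leb_integrableZ.
by move=> t at_ tb; apply: K2; exact: DP.
Qed.

Let E1 t : D t -> 1 <= E t.
Proof.
rewrite /= in_itv/= => /andP[at_ tb]; rewrite -[leLHS]expR0 ler_expR.
by apply: leb_int_ge0 => s /(sub_itv _ tb); exact: K2.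
Qed.

Let Bi : leb_integrable D B.
Proof. exact: leb_integrableD mD ga0i (leb_integrableZ _ _ Gam mD kapE.1). Qed.

Let pow (j : nat) : R := 2^-1 ^+ j.

Let pow0 j : 0 <= pow j. Proof. by rewrite exprn_ge0. Qed.

Let powS j : pow j = 2 * pow j.+1.
Proof. by rewrite /pow exprS mulrA mulfV// mul1r. Qed.

Lemma traj_sub u v t : slow u -> slow v -> a <= t -> t <= b ->
  traj x0 u t - traj x0 v t = vint `[a, t] (fun s => u s - v s).
Proof.
move=> su sv at_ tb; rewrite vintB /traj.
- by rewrite opprD addrACA subrr add0r.
- exact: measurable_leb_itv.
- exact: vec_integrable_sub (slow_integrable _ su).
- exact: vec_integrable_sub (slow_integrable _ sv).
Qed.

Lemma traj_sub_le u v phi t : slow u -> slow v -> leb_integrable D phi ->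
  (forall s, D s -> enorm (u s - v s) <= phi s) -> a <= t -> t <= b ->
  enorm (traj x0 u t - traj x0 v t) <= leb_int `[a, t] phi.
Proof.
move=> su sv ip uv at_ tb; rewrite traj_sub//; apply: enorm_vint_le.
- exact: measurable_leb_itv.
- move=> i; have h := leb_integrableB _ _ _ (measurable_leb_itv _)
    (vec_integrable_sub a b a t _ (lexx _) tb (slow_integrable _ su) i)
    (vec_integrable_sub a b a t _ (lexx _) tb (slow_integrable _ sv) i).
  by rewrite (_ : (fun s => (u s - v s) ord0 i) = (fun s => u s ord0 i - v s ord0 i))//;
    apply/funext => s; rewrite !mxE.
- exact: leb_integrable_sub ip.
- by move=> s /(sub_itv _ tb); exact: uv.
Qed.

Let slow_us j : slow (us j). Proof. by have [] := usP j. Qed.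

(** By induction the next velocity change is at most [K Gam E / 2^j = (Gam / 2^(j+1)) (2 K E)],
    whose integral is at most [Gam E / 2^(j+1)]. *)
Let traj_step j t : D t ->
  enorm (traj x0 (us j.+1) t - traj x0 (us j) t) <= Gam * pow j * E t.
Proof.
elim: j t => [|j ih] t Dt; move: (Dt); rewrite /= in_itv/= => /andP[at_ tb].
  apply: (@le_trans _ _ (leb_int `[a, t] (gas 0%N))).
    by apply: traj_sub_le => //; exact: us_step.
  rewrite /pow expr0 mulr1; apply: (@le_trans _ _ Gam).
    apply: (leb_int_nd _ _ _ _ _ ga0i) => // s as_ sb.
    by have [_ _ _ h _] := start; apply: h; exact: DP.
  by rewrite ler_peMr// E1.
have phii : leb_integrable D (fun s => Gam * pow j.+1 * (2 * K s * E s)).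
  exact: leb_integrableZ mD kapE.1.
apply: (@le_trans _ _ (leb_int `[a, t] (fun s => Gam * pow j.+1 * (2 * K s * E s)))).
  apply: traj_sub_le => // s Ds; apply: le_trans (us_step _ _ Ds) _.
  rewrite gasS /next_ga.
  apply: le_trans (ler_wpM2l (K0 _ Ds) (ih s Ds)) _; rewrite powS.
  by rewrite le_eqVlt; apply/orP; left; apply/eqP; ring.
rewrite leb_intZ ?kapE.2//; last 2 first.
- exact: measurable_leb_itv.
- exact: leb_integrable_sub kapE.1.
by rewrite ler_wpM2l ?mulr_ge0// gerBl.
Qed.

Let B0 t : D t -> 0 <= B t.
Proof.
move=> Dt; rewrite addr_ge0 ?mulr_ge0 ?K0//; first by have [_ _ _ h _] := start; exact: h.
exact: expR_ge0.
Qed.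

Let gas_le j t : D t -> gas j t <= B t * pow j.
Proof.
move=> Dt; case: j => [|j].
  rewrite /pow expr0 mulr1 /B lerDl !mulr_ge0// ?K0//; exact: expR_ge0.
rewrite gasS /next_ga.
apply: le_trans (ler_wpM2l (K0 _ Dt) (traj_step j t Dt)) _.
rewrite (powS j) /B.
have g0 : 0 <= gas 0%N t by have [_ _ _ h _] := start; exact: h.
by have := mulr_ge0 g0 (pow0 j.+1); lra.
Qed.

Let als_le j t : D t -> als j t <= als 0%N t + B t * (2 - 2 * pow j).
Proof.
move=> Dt; elim: j => [|j ih].
  by rewrite /pow expr0 mulr1 subrr mulr0 addr0.
rewrite alsS -powS; have := gas_le j t Dt; lra.
Qed.

Let traj_us0 j t : D t ->
  enorm (traj x0 (us j) t - traj x0 (us 0%N) t) <= Gam * E t * (2 - 2 * pow j).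
Proof.
move=> Dt; elim: j => [|j ih].
  by rewrite subrr enorm0 /pow expr0 mulr1 subrr mulr0.
apply: le_trans (enorm_sub_le _ (traj x0 (us j) t) _) _.
apply: le_trans (lerD (traj_step j t Dt) ih) _; rewrite -powS.
move: (E t) (pow j) => e p.
by rewrite le_eqVlt; apply/orP; left; apply/eqP; ring.
Qed.

(** The velocities converge pointwise at a geometric rate, and integration transfers the rate to the
    arcs. Every inequality holds at stage [j] up to [O(2^-j)] for fixed [t] and [p], so it survives
    in the limit. *)
Lemma filippov_limit : exists u : R -> V, [/\ slow u,
  forall t, D t -> forall p, dotv (u t) p <=
    H t (traj x0 u t) p + (als 0%N t + 2 * (gas 0%N t + Gam * (2 * K t * E t))) &
  forall t, D t -> enorm (traj x0 u t - traj x0 (us 0%N) t) <= 2 * Gam * E t].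
Proof.
have /choice[l lP] : forall t, exists l : V, forall i, D t ->
    forall j, `|l ord0 i - us j t ord0 i| <= 2 * B t * pow j.
  move=> t; have [Dt|nDt] := pselect (D t); last by exists 0.
  have /choice[l lP] : forall i, exists l : R,
      forall j, `|l - us j t ord0 i| <= 2 * B t * pow j.
    move=> i; apply: geometric_cvg => j.
    apply: le_trans (gas_le j t Dt); apply: le_trans (us_step j t Dt).
    by have := enorm_coord (us j.+1 t - us j t) i; rewrite !mxE.
  by exists (\row_i l i) => i _ j; rewrite mxE.
have lus t j : D t -> enorm (l t - us j t) <= n%:R * (2 * B t) * pow j.
  move=> Dt; apply: le_trans (enorm_le_sum _) _.
  apply: (@le_trans _ _ (\sum_(i < n) 2 * B t * pow j)).
    by apply: ler_sum => i _; rewrite !mxE; exact: lP.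
  by rewrite sumr_const card_ord -[leLHS]mulr_natl mulrA.
have sl : slow l.
  split=> [i|t Dt].
    apply: (@measurable_fun_cvg _ (LebR R) R D (fun j t => us j t ord0 i)).
      by move=> j; exact: (slow_us j).1.
    by move=> t Dt; apply: geometric_cvg0 (fun j => lP t i Dt j).
  apply: (@le_geometric _ _ _ (n%:R * (2 * B t))) => j.
  have := enormD (l t - us j t) (us j t); rewrite subrK.
  by have := lus t j Dt; have := (slow_us j).2 t Dt; rewrite -/(pow j); lra.
pose Q t := leb_int `[a, t] (fun s => n%:R * (2 * B s)).
have n2Bi : leb_integrable D (fun s => n%:R * (2 * B s)).
  by do 2 apply: leb_integrableZ => //.
have trl t j : D t -> enorm (traj x0 l t - traj x0 (us j) t) <= Q t * pow j.
  move=> Dt; move: (Dt); rewrite /= in_itv/= => /andP[at_ tb].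
  rewrite mulrC -leb_intZ//; last 2 first.
  - exact: measurable_leb_itv.
  - exact: leb_integrable_sub n2Bi.
  apply: traj_sub_le => //; first exact: leb_integrableZ.
  by move=> s Ds; rewrite mulrC; exact: lus.
exists l; split=> // [t Dt p|t Dt].
- rewrite -/(B t); apply: (@le_geometric _ _ _ (enorm p * (n%:R * (2 * B t)) +
    B t * (1 + enorm p) + K t * (1 + enorm p) * Q t)) => j; rewrite -/(pow j).
  have [_ _ _ _ h] := usP j; have {}h := h t Dt p.
  have h1 : dotv (l t) p <= dotv (us j t) p + enorm p * (n%:R * (2 * B t) * pow j).
    have := dotv_le (l t - us j t) p; rewrite dotvDl dotvNl.
    have := ler_wpM2l (enorm_ge0 p) (lus t j Dt); lra.
  have h2 : gas j t * (1 + enorm p) <= B t * pow j * (1 + enorm p).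
    by rewrite ler_wpM2r ?gas_le// addr_ge0// enorm_ge0.
  have h3 := als_le j t Dt.
  have h4 : B t * (2 - 2 * pow j) <= 2 * B t.
    by have := mulr_ge0 (B0 t Dt) (pow0 j); lra.
  have h5 : H t (traj x0 (us j) t) p <= H t (traj x0 l t) p +
      K t * (1 + enorm p) * (Q t * pow j).
    have := Kr t Dt (traj x0 (us j) t) (traj x0 l t) p
      (ltW (traj_lt _ _ (slow_us j) Dt)) (ltW (traj_lt _ _ sl Dt)).
    rewrite ler_norml => /andP[_].
    have Kp : 0 <= K t * (1 + enorm p) by rewrite mulr_ge0 ?K0// addr_ge0// enorm_ge0.
    by have := ler_wpM2l Kp (trl t j Dt); rewrite (enormB (traj x0 (us j) t)); lra.
  lra.
- apply: (@le_geometric _ _ _ (Q t)) => j; rewrite -/(pow j).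
  apply: le_trans (enorm_sub_le _ (traj x0 (us j) t) _) _.
  apply: le_trans (lerD (trl t j Dt) (traj_us0 j t Dt)) _.
  have GE : 0 <= Gam * E t by rewrite mulr_ge0// expR_ge0.
  by rewrite addrC lerD2r -[leRHS]mulrA [leRHS]mulrC ler_wpM2l// gerBl mulr_ge0.
Qed.

End iteration.

Theorem filippov (u0 : R -> V) (al0 ga0 : R -> R) (Gam := leb_int D ga0) :
  almost_solution u0 al0 ga0 -> leb_integrable D ga0 ->
  exists u : R -> V, [/\ slow u,
    forall t, D t -> forall p, dotv (u t) p <=
      H t (traj x0 u t) p + (al0 t + 2 * (ga0 t + Gam * (2 * K t * E t))) &
    forall t, D t -> enorm (traj x0 u t - traj x0 u0 t) <= 2 * Gam * E t].
Proof.
move=> start gai.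
pose step (s : (R -> V) * (R -> R) * (R -> R)) :=
  (next_u s.1.1 s.1.2 s.2, fun t => s.1.2 t + s.2 t,
   next_ga s.1.1 (next_u s.1.1 s.1.2 s.2)).
pose st j := iter j step (u0, al0, ga0).
exact: (filippov_limit (fun j => (st j).1.1) (fun j => (st j).1.2) (fun j => (st j).2)).
Qed.

End Filippov.

(** * Competitors of a minimizer *)

Section LipschitzOnBalls.
Context {R : realType} {n : nat}.
Notation V := 'rV[R]_n.

Lemma near_enorm (x : V) (e : R) : 0 < e -> \forall y \near x, enorm (y - x) <= e.
Proof.
move=> e0; have d0 : 0 < e / n.+1%:R by rewrite divr_gt0.
apply: filterS (nbhsx_ballx x _ d0) => y; rewrite mx_norm_ball /ball_/= distrC => yx.
apply: le_trans (enorm_le_norm _) _.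
apply: (@le_trans _ _ (n.+1%:R * `|y - x|)); first by rewrite ler_wpM2r// ler_nat.
by rewrite mulrC -ler_pdivlMr// ltW.
Qed.

(** Compactness of a cube containing the ball is used twice: to bound [g], then to find one
    constant. Close points share a local Lipschitz estimate; for distant points the bound on [g] is
    divided by their distance. *)
Lemma locally_lipschitz_ball (g : V -> R) (r : R) : locally_lipschitz g ->
  exists2 L : R, 0 <= L & forall y z, enorm y <= r -> enorm z <= r ->
    `|g y - g z| <= L * enorm (y - z).
Proof.
move=> gl; pose A : set V := [set v | forall i, v ord0 i \in `[- r, r]].
have cA : compact A.
  by apply: (@rV_compact R n (fun=> `[- r, r]%classic)) => i; exact: segment_compact.
have AP y : enorm y <= r -> A y.
  by move=> yr i; rewrite in_itv/= -ler_norml; exact: le_trans (enorm_coord _ _) yr.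
have /compact_near_coveringP cov := cA.
have [B [_ gB]] : \forall B \near +oo_R, A `<=` (fun x => `|g x| <= B).
  apply: cov => x Ax; have [s s0 [L gL]] := gl x.
  exists ([set y | enorm (y - x) <= s], [set B | `|g x| + `|L| * s <= B]).
    by split; [exact: near_enorm|apply: nbhs_pinfty_ge; exact: num_real].
  move=> [y B] /= [yx LB]; apply: le_trans LB.
  rewrite -{1}(subrK (g x) (g y)) (le_trans (ler_normD _ _))// addrC lerD2l.
  have xx : enorm (x - x) <= s by rewrite subrr enorm0 ltW.
  apply: le_trans (gL y x yx xx) _; apply: (@le_trans _ _ (`|L| * enorm (y - x))).
    by rewrite ler_wpM2r ?enorm_ge0// ler_norm.
  by rewrite ler_wpM2l.
have [B0 gB0] : exists B : R, forall x, A x -> `|g x| <= B.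
  by exists (B + 1) => x; apply: gB; rewrite ltrDl.
have [L [_ gL]] : \forall L \near +oo_R, A `<=`
    (fun x => A x -> forall y, A y -> `|g y - g x| <= L * enorm (y - x)).
  apply: cov => x Ax; have [s s0 [L gL]] := gl x.
  have s2 : 0 < s / 2 by rewrite divr_gt0.
  (* The second entry serves pairs at distance at least [s / 2], on which [g] varies by at most
     [2 B0]. *)
  pose L' := Num.max `|L| (2 * B0 / (s / 2)).
  exists ([set y | enorm (y - x) <= s / 2], [set M | L' <= M]).
    by split; [exact: near_enorm|apply: nbhs_pinfty_ge; exact: num_real].
  move=> [x' M] /= [x'x]; rewrite /L' ge_max => /andP[LM BM] Ax' y Ay.
  have [yx|yx] := leP (enorm (y - x)) s.
    have x's : enorm (x' - x) <= s by lra.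
    apply: le_trans (gL y x' yx x's) _; rewrite ler_wpM2r ?enorm_ge0//.
    exact: le_trans (ler_norm _) LM.
  have far : s / 2 <= enorm (y - x').
    by have := enorm_sub_le y x' x; lra.
  apply: le_trans (ler_normB _ _) _.
  apply: (@le_trans _ _ (2 * B0)); first by have := gB0 y Ay; have := gB0 x' Ax'; lra.
  have M0 : 0 <= M by apply: le_trans LM.
  by move: BM; rewrite ler_pdivrMr// => /le_trans; apply; rewrite ler_wpM2l.
exists (`|L| + 1) => [|y z yr zr]; first by rewrite addr_ge0.
apply: gL; [|exact: AP..].
by rewrite (le_lt_trans (ler_norm L))// ltrDl.
Qed.

End LipschitzOnBalls.

Lemma ge0_Rintegral_subset {d} {T : measurableType d} {R : realType}
    (mu : {measure set T -> \bar R}) (D E : set T) (f : T -> R) :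
  measurable D -> measurable E -> D `<=` E -> mu.-integrable E (EFin \o f) ->
  (forall t, E t -> 0 <= f t) -> \int[mu]_(t in D) f t <= \int[mu]_(t in E) f t.
Proof.
move=> mD mE DE fE f0; have fD := integrableS mE mD DE fE.
rewrite /Rintegral; apply: fine_le.
- exact: integrable_fin_num fD.
- exact: integrable_fin_num fE.
apply: ge0_subset_integral => //; exact: measurable_int fE.
Qed.

Lemma integrable_between {d} {T : measurableType d} {R : realType}
    (mu : {measure set T -> \bar R}) (D : set T) (f : T -> \bar R) (l h : T -> R) :
  measurable D -> measurable_fun D f ->
  mu.-integrable D (EFin \o l) -> mu.-integrable D (EFin \o h) ->
  (forall t, D t -> ((- l t)%:E <= f t)%E) -> (forall t, D t -> (f t <= (h t)%:E)%E) ->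
  mu.-integrable D f.
Proof.
move=> mD mf il ih lf fh.
have il' := integrable_abse il; have ih' := integrable_abse ih.
apply: (@le_integrable _ T R mu D mD f _ mf _ (integrableD mD il' ih')) => t Dt.
have := lf t Dt; have := fh t Dt; case: (f t) => [x||]; rewrite ?leeNy_eq ?leye_eq//.
rewrite /= !lee_fin => xh lx; rewrite [leRHS]ger0_norm; last exact: addr_ge0.
rewrite ler_norml; have := ler_norm (l t); have := ler_norm (h t).
by have := normr_ge0 (l t); have := normr_ge0 (h t); move=> *; apply/andP; split; lra.
Qed.

Lemma integral_le_Rint {d} {T : measurableType d} {R : realType}
    (mu : {measure set T -> \bar R}) (D : set T) (f : T -> \bar R) (h : T -> R) :
  measurable D -> mu.-integrable D f -> mu.-integrable D (EFin \o h) ->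
  (forall t, D t -> (f t <= (h t)%:E)%E) ->
  (\int[mu]_(t in D) f t <= (\int[mu]_(t in D) h t)%R%:E)%E.
Proof.
move=> mD fi hi fh; rewrite /Rintegral fineK; last exact: integrable_fin_num hi.
by apply: (le_integral mD fi hi) => t /set_mem; exact: fh.
Qed.

Section Trajectories.
Context {R : realType} {n : nat}.
Notation V := 'rV[R]_n.
Implicit Types (a b : R) (f : R -> R) (u : R -> V).

Lemma leb_int_subset_le (D E : set R) f : measurable (D : set (LebR R)) ->
  measurable (E : set (LebR R)) -> D `<=` E -> leb_integrable E f ->
  (forall t, E t -> 0 <= f t) -> leb_int D f <= leb_int E f.
Proof.
exact: (@ge0_Rintegral_subset _ (LebR R) R (leb R)).
Qed.

Lemma enorm_integrable (D : set R) u : measurable (D : set (LebR R)) ->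
  vec_integrable D u -> leb_integrable D (fun t => enorm (u t)).
Proof.
move=> mD iu; have sumi (s : seq 'I_n) : leb_integrable D (fun t => \sum_(i <- s) `|u t ord0 i|).
  elim: s => [|i s ih].
    rewrite (_ : (fun _ => _) = fun=> 0); first exact: integrable0.
    by apply/funext => t; rewrite big_nil.
  rewrite (_ : (fun t => _) = fun t => `|u t ord0 i| + \sum_(j <- s) `|u t ord0 j|); last first.
    by apply/funext => t; rewrite big_cons.
  apply: leb_integrableD ih => //; exact: (integrable_abse (iu i)).
apply: le_leb_integrable (sumi (index_enum 'I_n)) => //.
  by apply: measurable_enorm => i; exact: leb_integrable_measurable (iu i).
by move=> t _; rewrite ger0_norm ?enorm_ge0//; exact: enorm_le_sum.
Qed.

Lemma abs_cont_traj a b x0 u : vec_integrable `[a, b] u -> abs_cont a b (traj a x0 u).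
Proof.
move=> iu e e0; have mab := measurable_leb_itv `[a, b].
have iphi := enorm_integrable _ _ mab iu.
have [d d0 dP] := leb_int_ac _ _ _ iphi (fun t _ => enorm_ge0 (u t)) _ e0.
exists d => // k v w vw djt lt.
apply: le_lt_trans (dP 'I_k v w _ lt); last first.
  by split=> [//|i j /eqP ij]; exact: djt.
apply: ler_sum => i _; have [av [vwi wb]] := vw i.
rewrite /traj opprD addrACA subrr add0r.
by apply: le_trans (enorm_vint_sub _ _ _ _ _ _ iu iphi _ av vwi wb) (ler_norm _).
Qed.

Lemma abs_cont_coord a b (x : R -> V) i : abs_cont a b x ->
  ac_real a b (fun t => x t ord0 i).
Proof.
move=> acx; apply: ac_real_of_ord => e /acx[d d0 dP]; exists d => // k u v [uv djt] lt.
apply: le_lt_trans (dP k u v uv _ lt); last by move=> p q /eqP; exact: djt.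
apply: ler_sum => j _; have := enorm_coord (x (v j) - x (u j)) i.
by rewrite !mxE.
Qed.

Lemma abs_cont_primitive a b (x : R -> V) : a <= b -> abs_cont a b x ->
  exists2 f, vec_integrable `[a, b] f &
    forall t, a <= t -> t <= b -> x t = traj a (x a) f t.
Proof.
move=> ab acx; have /choice[f fP] : forall i : 'I_n, exists f : R -> R,
    leb_integrable `[a, b] f /\
    forall t, a <= t -> t <= b -> x t ord0 i = x a ord0 i + leb_int `[a, t] f.
  by move=> i; have [f fi fE] := ac_real_primitive _ _ _ ab (abs_cont_coord a b x i acx); exists f.
exists (fun t => \row_i f i t) => [i|t at_ tb].
  rewrite (_ : (fun t => (\row_i f i t) ord0 i) = f i); first exact: (fP i).1.
  by apply/funext => t; rewrite mxE.
apply/rowP => i; rewrite !mxE (fP i).2//; congr (_ + _).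
by apply: eq_leb_int => s _; rewrite mxE.
Qed.

Lemma Hstar_measurable (D : set R) (H : R -> V -> V -> R) (y v : R -> V) (L : R -> R) :
  (forall p, leb_measurable_fun D (fun t => H t (y t) p)) ->
  (forall t, D t -> lip_rV (L t) (H t (y t))) -> leb_measurable_vec D v ->
  measurable_fun (D : set (LebR R)) (fun t => Hstar H t (y t) (v t)).
Proof.
move=> mH lH mv.
apply: (@eq_measurable_fun _ _ _ _ _ (fun t : LebR R =>
  ereal_sup (range (fun q : 'rV[rat]_n => (dotv (v t) (ratv q) - H t (y t) (ratv q))%:E)))).
  by move=> t /set_mem Dt; rewrite (Hstar_ratE _ _ _ _ _ (lH t Dt)).
apply: (@measurable_fun_ereal_sup_countable _ (LebR R) R _ D _ 0) => q.
apply/measurable_EFinP; apply: measurable_funB; last exact: mH.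
by apply: measurable_dotv => //; exact: measurable_vec_cst.
Qed.

End Trajectories.

(** * Cost of the arc obtained from Filippov's theorem *)

Section Competitor.
Context {R : realType} {n : nat}.
Notation V := 'rV[R]_n.
Variables (a b : R) (H : R -> V -> V -> R) (c K : R -> R) (r A : R) (x0 : V).
Notation D := (`[a, b]%classic : set R).
Hypothesis ab : a <= b.
Hypothesis rh : regular_hamiltonian a b H c K r.
Hypothesis x0A : 1 + enorm x0 <= A.
Hypothesis rA : A * expR (leb_int `[a, b] c) <= r.
Hypothesis H00i : leb_integrable D (fun t => H t 0 0).

Lemma Hstar_lower_bound (t : R) x v (rho k : R) : 0 <= k -> enorm x <= rho ->
  (forall x y p, enorm x <= rho -> enorm y <= rho ->
     `|H t x p - H t y p| <= k * (1 + enorm p) * enorm (x - y)) ->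
  ((- (`|H t 0 0| + k * rho))%:E <= Hstar H t x v)%E.
Proof.
move=> k0 xr Hk; apply: le_trans (Hstar_ge H t x v 0); rewrite lee_fin dotv0 add0r lerN2.
have r0 : 0 <= rho by apply: le_trans xr; exact: enorm_ge0.
have z0 : enorm (0 : V) <= rho by rewrite enorm0.
have := Hk x 0 0 xr z0; rewrite enorm0 addr0 mulr1 subr0 => h.
have := ler_wpM2l k0 xr; have := ler_norm (H t 0 0); have := ler_norm (H t x 0 - H t 0 0); lra.
Qed.

(** Pointwise [H^*] lies below [psi] along the repaired arc, and above an integrable function by
    testing [p = 0]. It is therefore integrable there and the bound can be integrated. *)
Theorem competitor (g : V -> R) (u0 : R -> V) (al0 ga0 : R -> R) (Gam := leb_int D ga0)
    (E := fun t => expR (leb_int `[a, t] (fun s => 2 * K s))) :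
  almost_solution a b H c A x0 u0 al0 ga0 -> leb_integrable D ga0 -> leb_integrable D al0 ->
  exists y : R -> V, [/\ admissible b a x0 y,
    (Theta H g b a y <=
      (g (y b) + leb_int D (fun t => al0 t + 2 * (ga0 t + Gam * (2 * K t * E t))))%:E)%E,
    enorm (y b) <= r &
    enorm (y b - traj a x0 u0 b) <= 2 * Gam * E b].
Proof.
move=> start gai ali; have mD : measurable (D : set (LebR R)) := measurable_leb_itv _.
have [u [su uH udist]] := filippov _ _ _ _ _ _ _ _ ab rh x0A rA _ _ _ start gai.
set psi := fun t => al0 t + 2 * (ga0 t + Gam * (2 * K t * E t)).
have iu := slow_integrable _ _ _ _ _ _ _ ab rh _ su.
pose y := traj a x0 u.
have Db : D b by rewrite /= in_itv/= ab lexx.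
exists y; split.
- by split; [exact: abs_cont_traj|
    rewrite /y /traj (_ : vint _ _ = 0) ?addr0//; apply/rowP => i; rewrite !mxE leb_int_aa].
- have K20 t : a <= t -> t <= b -> 0 <= 2 * K t.
    by move=> at_ tb; rewrite mulr_ge0// (rh_K0 _ _ _ _ _ _ rh)//= in_itv/= at_.
  have Ki := rh_Ki _ _ _ _ _ _ rh.
  have [Ei _] := leb_int_expR a b _ ab (leb_integrableZ _ _ 2 mD Ki) K20.
  have psii : leb_integrable D psi.
    exact: (leb_integrableD _ _ _ mD ali (leb_integrableZ _ _ 2 mD
      (leb_integrableD _ _ _ mD gai (leb_integrableZ _ _ Gam mD Ei)))).
  pose phi (t : LebR R) : \bar R := Hstar H t (y t) (u t).
  have ylip t : D t -> lip_rV (c t * (1 + enorm (y t))) (H t (y t)).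
    by move=> Dt p q; apply: le_trans (ler_norm _) (rh_lip _ _ _ _ _ _ rh t Dt _ _ _).
  have mphi : measurable_fun (D : set (LebR R)) phi.
    apply: (Hstar_measurable _ _ _ _ _ _ ylip su.1) => p.
    exact: (H_traj_meas _ _ _ _ _ _ _ _ ab rh x0A rA).
  have phi_le t : D t -> (phi t <= (psi t)%:E)%E.
    by move=> Dt; apply/HstarP; exact: uH.
  pose low t := `|H t 0 0| + K t * r.
  have lowi : leb_integrable D low.
    apply: (leb_integrableD _ _ _ mD (integrable_abse H00i)).
    by rewrite (_ : (fun t => K t * r) = fun t => r * K t);
      [exact: leb_integrableZ mD Ki|apply/funext => t; rewrite mulrC].
  have phi_ge t : D t -> ((- low t)%:E <= phi t)%E.
    move=> Dt; apply: Hstar_lower_bound; first exact: (rh_K0 _ _ _ _ _ _ rh).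
      exact: ltW (traj_lt _ _ _ _ _ _ _ _ ab rh x0A rA _ _ su Dt).
    exact: (rh_Kr _ _ _ _ _ _ rh).
  have phii : (leb R).-integrable (D : set (LebR R)) phi.
    exact: (@integrable_between _ (LebR R) R (leb R) D phi low psi mD mphi lowi psii phi_ge phi_le).
  rewrite /Theta EFinD leeD2l//.
  have -> : (\int[leb R]_(t in (D : set (LebR R))) Hstar H t (y t) (derive1 y t) =
      \int[leb R]_(t in (D : set (LebR R))) phi t)%E.
    apply/esym/(complete_ae_integral _ completed_lebesgue_measure_is_complete) => //.
    have yE t : a <= t -> t <= b -> y t = x0 + vint `[a, t] u by [].
    apply: (ae_leb_imply _ _ (vint_derive1 _ _ _ _ _ iu yE)) => t h.
    by rewrite /= in_itv/= => /andP[at_ tb]; rewrite /phi h.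
  exact: (@integral_le_Rint _ (LebR R) R (leb R) D phi psi mD phii psii phi_le).
- exact: ltW (traj_lt _ _ _ _ _ _ _ _ ab rh x0A rA _ _ su Db).
- exact: udist.
Qed.

End Competitor.

(** Here [i1], [i2], [i3] stand for [\int_E low], [\int h], [\int_E h], while [q] is the budget
    [Q \int_E c]. The repair costs [2 G E] in the integral and [L (2 G E + eps)] in the end cost. *)
Lemma competitor_cost_arith {R : realType} (gy gx L G E i1 i2 i3 q : R) (eps : R) :
  gy <= gx + L * (2 * G * E + eps) ->
  (2 + 2 * L) * (G * E) + L * eps <= q ->
  gy + (i1 + (i2 - i3) + 2 * (G + G * (E - 1))) <= gx + i2 - (i3 - (i1 + q)).
Proof. by move=> h1 h2; lra. Qed.

(** * Stopping an arc on a set of times *)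

Section Exchange.
Opaque leb_int leb_integrable.
Context {R : realType} {n : nat}.
Notation V := 'rV[R]_n.
Variables (a b : R) (H : R -> V -> V -> R) (c K : R -> R) (r A : R) (x0 : V).
Notation D := (`[a, b]%classic : set R).
Hypothesis ab : a <= b.
Hypothesis rh : regular_hamiltonian a b H c K r.
Hypothesis x0A : 1 + enorm x0 <= A.
Hypothesis rA : A * expR (leb_int `[a, b] c) <= r.
Hypothesis H00i : leb_integrable D (fun t => H t 0 0).

Let mD : measurable (D : set (LebR R)). Proof. exact: measurable_leb_itv. Qed.
Let c0 := rh_c0 _ _ _ _ _ _ rh.
Let ci := rh_ci _ _ _ _ _ _ rh.
Let K0 := rh_K0 _ _ _ _ _ _ rh.
Let Ki := rh_Ki _ _ _ _ _ _ rh.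

Let A0 : 0 <= A.
Proof. by apply: le_trans x0A; rewrite addr_ge0// enorm_ge0. Qed.

Let r0 : 0 <= r. Proof. by apply: le_trans rA; rewrite mulr_ge0// expR_ge0. Qed.

Lemma slow_le (u : R -> V) t : slow a b c A u -> D t -> enorm (u t) <= r * c t.
Proof.
move=> [_ ub] Dt; apply: le_trans (ub t Dt) _.
rewrite mulrCA [leRHS]mulrC; apply: (ler_wpM2l (c0 _ Dt)).
apply: le_trans rA; apply: (ler_wpM2l A0); rewrite ler_expR.
move: Dt; rewrite /= in_itv/= => /andP[at_ tb].
apply: (leb_int_nd _ _ _ _ _ ci _ at_ tb (lexx b)).
by move=> s as_ sb; apply: c0; rewrite /= in_itv/= as_.
Qed.

Variables (E : set R) (f : R -> V) (h : R -> R).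
Hypothesis mE : measurable (E : set (LebR R)).
Hypothesis sf : slow a b c A f.
Hypothesis hi : leb_integrable D h.
Hypothesis fh : forall t, D t -> ~ E t -> forall p,
  dotv (f t) p <= H t (traj a x0 f t) p + h t.

Let e (t : R) : R := \1_E t.

Let eT t : E t -> e t = 1. Proof. by move=> Et; rewrite /e indicE mem_set. Qed.
Let eF t : ~ E t -> e t = 0. Proof. by move=> Et; rewrite /e indicE memNset. Qed.
Let e01 t : 0 <= e t /\ e t <= 1.
Proof. by have [/eT->|/eF->] := pselect (E t); rewrite ler01 lexx. Qed.

Let me : leb_measurable_fun D e.
Proof. exact: (@measurable_indic _ (LebR R) R D E mE). Qed.

Let indici q : leb_integrable D q -> leb_integrable D (fun t => e t * q t).
Proof.
move=> qi; have mq := leb_integrable_measurable _ _ qi.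
apply: (le_leb_integrable _ _ (fun t => `|q t|) mD).
- exact: measurable_funM me mq.
- move=> t _; rewrite normrM ger0_norm ?(e01 t).1// ler_piMl ?normr_ge0//.
  exact: (e01 t).2.
- exact: (integrable_abse qi).
Qed.

Let low t : R := `|H t 0 0| + r * K t.

Let lowi : leb_integrable D low.
Proof. exact: (leb_integrableD _ _ _ mD (integrable_abse H00i) (leb_integrableZ _ _ r mD Ki)). Qed.

(* The arc is stopped on [E]. There [(0, low)] lies in the epigraph of
   [H^*(t, y, .)] up to [(1 + r) c (1 + |p|)] by (H4); off [E] the old pair does up
   to [eps K (1 + |p|)] by (HLC), the trajectories being [eps]-close. *)
Let eps := leb_int D (fun t => e t * (r * c t)).
Let u0 t : V := (1 - e t) *: f t.
Let al0 t : R := e t * low t + (h t - e t * h t).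
Let ga0 t : R := e t * ((1 + r) * c t) + (eps * K t - e t * (eps * K t)).

Let rci : leb_integrable D (fun t => r * c t).
Proof. exact: leb_integrableZ mD ci. Qed.

Let eps0 : 0 <= eps.
Proof.
apply: leb_int_ge0 => t Dt; rewrite mulr_ge0 ?mulr_ge0 ?c0//; exact: (e01 t).1.
Qed.

Let al0i : leb_integrable D al0.
Proof. exact: (leb_integrableD _ _ _ mD (indici _ lowi) (leb_integrableB _ _ _ mD hi (indici _ hi))). Qed.

Let Kei : leb_integrable D (fun t => eps * K t).
Proof. exact: leb_integrableZ mD Ki. Qed.

Let rc1i : leb_integrable D (fun t => (1 + r) * c t).
Proof. exact: leb_integrableZ mD ci. Qed.

Let ga0i : leb_integrable D ga0.
Proof.
exact: (leb_integrableD _ _ _ mD (indici _ rc1i) (leb_integrableB _ _ _ mD Kei (indici _ Kei))).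
Qed.

Let slow_u0 : slow a b c A u0.
Proof.
split=> [i|t Dt].
  have mf := sf.1 i; have := measurable_funM (measurable_funB (measurable_cst (1:R)) me) mf.
  by apply: eq_measurable_fun => t _; rewrite /= mxE.
rewrite enormZ ger0_norm; last by rewrite subr_ge0 (e01 t).2.
apply: le_trans (sf.2 t Dt); rewrite ler_piMl ?enorm_ge0// gerBl; exact: (e01 t).1.
Qed.

Let traj_u0 t : D t -> enorm (traj a x0 u0 t - traj a x0 f t) <= eps.
Proof.
move=> Dt; move: (Dt); rewrite /= in_itv/= => /andP[at_ tb].
apply: (@le_trans _ _ (leb_int `[a, t] (fun t => e t * (r * c t)))).
  apply: (traj_sub_le _ _ _ _ _ _ _ x0 ab rh _ _ _ _ slow_u0 sf (indici _ rci)) => // s Ds.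
  have [Es|nEs] := pselect (E s).
    by rewrite /u0 eT// subrr scale0r sub0r enormN mul1r; exact: slow_le sf Ds.
  by rewrite /u0 eF// subr0 scale1r subrr enorm0 mul0r.
apply: (leb_int_nd _ _ _ _ _ (indici _ rci)) => // s as_ sb.
apply: mulr_ge0; first exact: (e01 s).1.
by apply: mulr_ge0 => //; apply: c0; rewrite /= in_itv/= as_.
Qed.

Let start : almost_solution a b H c A x0 u0 al0 ga0.
Proof.
split.
- exact: slow_u0.
- exact: leb_integrable_measurable al0i.
- exact: leb_integrable_measurable ga0i.
- move=> t Dt; rewrite /ga0 addr_ge0//.
    by rewrite mulr_ge0 ?mulr_ge0 ?addr_ge0 ?c0//; exact: (e01 t).1.
  rewrite -{1}[eps * K t]mul1r -mulrBl mulr_ge0 ?mulr_ge0 ?K0// subr_ge0.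
  exact: (e01 t).2.
- move=> t Dt p; have yr := traj_lt _ _ _ _ _ _ _ _ ab rh x0A rA _ _ slow_u0 Dt.
  have fr := traj_lt _ _ _ _ _ _ _ _ ab rh x0A rA _ _ sf Dt.
  have [Et|nEt] := pselect (E t); rewrite /u0 /al0 /ga0.
    rewrite eT// subrr scale0r dot0v !mul1r !subrr !addr0.
    set y := traj a x0 _ t in yr *.
    have z0 : enorm (0 : V) <= r by rewrite enorm0.
    have := rh_Kr _ _ _ _ _ _ rh t Dt y 0 0 (ltW yr) z0.
    rewrite enorm0 addr0 mulr1 subr0 ler_norml => /andP[h1 _].
    have := rh_lip _ _ _ _ _ _ rh t Dt y p 0.
    rewrite subr0 ler_norml => /andP[h2 _].
    have h3 : K t * enorm y <= r * K t.
      by rewrite mulrC; apply: (ler_wpM2r (K0 _ Dt)); exact: ltW.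
    have h4 : c t * (1 + enorm y) * enorm p <= (1 + r) * c t * (1 + enorm p).
      rewrite [(1 + r) * _]mulrC ler_pM ?mulr_ge0 ?addr_ge0 ?c0 ?enorm_ge0//.
        by rewrite ler_wpM2l ?c0// lerD2l ltW.
      by rewrite lerDr.
    have := ler_norm (- H t 0 0); rewrite normrN.
    move: h1 h2 h3 h4; rewrite /low.
    move: (H t y p) (H t y 0) (H t 0 0) (K t * enorm y) (r * K t) => A1 A2 A3 A4 A5.
    move: (c t * (1 + enorm y) * enorm p) ((1 + r) * c t * (1 + enorm p)) => A6 A7.
    lra.
  rewrite eF// subr0 scale1r !mul0r !add0r !subr0.
  apply: le_trans (fh t Dt nEt p) _.
  have := rh_Kr _ _ _ _ _ _ rh t Dt (traj a x0 f t) (traj a x0 u0 t) p (ltW fr) (ltW yr).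
  rewrite ler_norml => /andP[_].
  have Kp : 0 <= K t * (1 + enorm p) by rewrite mulr_ge0 ?K0// addr_ge0// enorm_ge0.
  have := ler_wpM2l Kp (traj_u0 t Dt); rewrite enormB.
  rewrite -/u0 (_ : eps * K t * (1 + enorm p) = K t * (1 + enorm p) * eps); last by ring.
  move: (H t _ p) (H t _ p) => A1 A2; move: (_ * eps) (_ * enorm _) => A3 A4.
  lra.
Qed.

Variables (g : V -> R) (L k0 e1 : R).
Hypothesis L0 : 0 <= L.
Hypothesis gL : forall y z, enorm y <= r -> enorm z <= r ->
  `|g y - g z| <= L * enorm (y - z).
Hypothesis k0P : leb_int D K <= k0.
Hypothesis e1P : expR (leb_int D (fun s => 2 * K s)) <= e1.

(** The factor [2 + 2 L] collects the repair's running cost [2 Gam Eb] and its effect [2 L Gam Eb]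
    on [g], with [Gam <= (1 + r)(1 + k0) \int_E c] and [Eb <= e1]. The term [L r] pays for the
    displacement [eps = r \int_E c] due to stopping. *)
Let Q : R := (2 + 2 * L) * ((1 + r) * (1 + k0) * e1) + L * r.
Let I := leb_int D (fun t => e t * c t).
Let Gam := leb_int D ga0.

Let eiP q (s : R) : leb_integrable D q ->
  leb_int D (fun t => e t * (s * q t)) = s * leb_int D (fun t => e t * q t).
Proof.
move=> qi; rewrite -(leb_intZ _ _ s mD (indici _ qi)); apply: eq_leb_int => t _.
exact: mulrCA.
Qed.

Let I0 : 0 <= I.
Proof. by apply: leb_int_ge0 => t Dt; apply: mulr_ge0 (e01 t).1 (c0 _ Dt). Qed.

Let k00 : 0 <= k0.
Proof. by apply: le_trans k0P; apply: leb_int_ge0; exact: K0. Qed.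

Let epsE : eps = r * I. Proof. exact: eiP ci. Qed.

Let Gam_le : Gam <= (1 + r) * (1 + k0) * I.
Proof.
have eKi : leb_integrable D (fun t => e t * (eps * K t)) := indici _ Kei.
rewrite /Gam /ga0 (leb_intD _ _ _ mD (indici _ rc1i) (leb_integrableB _ _ _ mD Kei eKi)).
rewrite (leb_intB _ _ _ mD Kei eKi) (eiP _ _ ci) -/I (leb_intZ _ _ _ mD Ki).
have h1 : 0 <= leb_int D (fun t => e t * (eps * K t)).
  by apply: leb_int_ge0 => t Dt; apply: mulr_ge0 (e01 t).1 (mulr_ge0 eps0 (K0 _ Dt)).
have h2 : eps * leb_int D K <= r * I * k0 by rewrite -epsE; apply: (ler_wpM2l eps0).
have h3 : 0 <= I * k0 by exact: mulr_ge0.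
move: h1 h2 h3; move: (leb_int D _) (leb_int D _) => x y h1 h2 h3.
apply: (@le_trans _ _ ((1 + r) * I + r * I * k0)); first lra.
rewrite [leRHS](_ : _ = (1 + r) * I + r * I * k0 + I * k0); last by ring.
by rewrite lerDl.
Qed.

Let Gam0 : 0 <= Gam.
Proof. by apply: leb_int_ge0 => t Dt; have [_ _ _ ga_ge0 _] := start; exact: ga_ge0. Qed.

(** Off [E] the stopped arc pays [h], on [E] only [low]; repairing it and the shift of its endpoint
    add at most [Q \int_E c]. *)
Theorem stopped_competitor : exists y : R -> V, admissible b a x0 y /\
  (Theta H g b a y <= (g (traj a x0 f b) + leb_int D h -
     leb_int D (fun t => e t * (h t - (low t + Q * c t))))%:E)%E.
Proof.
have [y [yadm yTh yr yd]] :=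
  competitor _ _ _ _ _ _ _ _ ab rh x0A rA H00i g _ _ _ start ga0i al0i.
exists y; split=> //; apply: le_trans yTh _; rewrite lee_fin.
have K20 t : a <= t -> t <= b -> 0 <= 2 * K t.
  by move=> at_ tb; rewrite mulr_ge0// K0//= in_itv/= at_.
have [Ei EE] := leb_int_expR a b _ ab (leb_integrableZ _ _ 2 mD Ki) K20.
set Eb := expR (leb_int `[a, b] _) in yd EE.
have GEi := leb_integrableZ _ _ Gam mD Ei.
rewrite -/Gam (leb_intD _ _ _ mD al0i (leb_integrableZ _ _ 2 mD (leb_integrableD _ _ _ mD ga0i GEi))).
rewrite (leb_intZ _ _ 2 mD (leb_integrableD _ _ _ mD ga0i GEi)).
rewrite (leb_intD _ _ _ mD ga0i GEi) (leb_intZ _ _ Gam mD Ei) EE ?lexx// -/Gam.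
rewrite {1}/al0 (leb_intD _ _ _ mD (indici _ lowi) (leb_integrableB _ _ _ mD hi (indici _ hi))).
rewrite (leb_intB _ _ _ mD hi (indici _ hi)).
have -> : leb_int D (fun t => e t * (h t - (low t + Q * c t))) =
    leb_int D (fun t => e t * h t) - (leb_int D (fun t => e t * low t) + Q * I).
  have Qci := leb_integrableZ _ _ Q mD ci.
  rewrite -(eiP _ Q ci) -(leb_intD _ _ _ mD (indici _ lowi) (indici _ Qci)).
  rewrite -(leb_intB _ _ _ mD (indici _ hi) (leb_integrableD _ _ _ mD (indici _ lowi) (indici _ Qci))).
  by apply: eq_leb_int => t _; ring.
have Db : D b by rewrite /= in_itv/= ab lexx.
have fr := traj_lt _ _ _ _ _ _ _ _ ab rh x0A rA _ _ sf Db.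
have gy : g (y b) <= g (traj a x0 f b) + L * (2 * Gam * Eb + eps).
  have := gL _ _ yr (ltW fr); rewrite ler_norml => /andP[_].
  rewrite lerBlDr addrC => /le_trans; apply; rewrite lerD2l; apply: (ler_wpM2l L0).
  apply: le_trans (enorm_sub_le _ (traj a x0 u0 b) _) _.
  exact: lerD yd (traj_u0 b Db).
have Eb0 : 0 <= Eb by exact: expR_ge0.
have GE : Gam * Eb <= (1 + r) * (1 + k0) * I * e1.
  exact: ler_pM Gam0 Eb0 Gam_le e1P.
have h1 : (2 + 2 * L) * (Gam * Eb) <= (2 + 2 * L) * ((1 + r) * (1 + k0) * I * e1).
  by apply: (ler_wpM2l _ GE); rewrite addr_ge0// mulr_ge0.
apply: (competitor_cost_arith _ _ _ _ _ _ _ _ _ _ gy); rewrite epsE.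
rewrite [leRHS](_ : _ = (2 + 2 * L) * ((1 + r) * (1 + k0) * I * e1) + L * (r * I)).
  by rewrite lerD2r.
by rewrite /Q; ring.
Qed.

End Exchange.

(** The lower bound makes the negative part integrable, so a value below [+oo] of the integral
    forces the positive part to be integrable as well. This is how a finite optimal value gives a
    finite cost almost everywhere. *)
Lemma integrable_lower_bounded {d} {T : measurableType d} {R : realType}
    (mu : {measure set T -> \bar R}) (D : set T) (f : T -> \bar R) (l : T -> R) :
  measurable D -> measurable_fun D f -> mu.-integrable D (EFin \o l) ->
  (forall t, D t -> ((- l t)%:E <= f t)%E) -> (\int[mu]_(t in D) f t < +oo)%E ->
  mu.-integrable D f.
Proof.
move=> mD mf il lf foo; have mp := measurable_funepos mf; have mn := measurable_funeneg mf.
have il' := integrable_abse il.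
have noo : (\int[mu]_(t in D) f^\- t < +oo)%E.
  have /integrableP[_ loo] := il; apply: le_lt_trans loo.
  apply: ge0_le_integral => //.
    by apply: measurableT_comp => //; exact: measurable_int il.
  move=> t Dt; rewrite funenegE ge_max abse_ge0 andbT.
  have := lf t Dt; case: (f t) => [x||] //=; rewrite ?leNye// !lee_fin => lx.
  by apply: le_trans (ler_norm _); rewrite lerNl.
have poo : (\int[mu]_(t in D) f^\+ t < +oo)%E.
  move: foo; rewrite integralE.
  have nfin : (\int[mu]_(t in D) f^\- t)%E \is a fin_num.
    by rewrite ge0_fin_numE//; apply: integral_ge0.
  by move: nfin; case: (\int[mu]_(t in D) f^\- t)%E => [z||] // _;
    case: (\int[mu]_(t in D) f^\+ t)%E => [x||] //; rewrite ?ltry.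
apply/integrableP; split=> //; rewrite -/(abse \o f) fune_abse ge0_integralD//.
exact: lte_add_pinfty.
Qed.

Lemma ge0_Rintegral_le0_ae {d} {T : measurableType d} {R : realType}
    (mu : {measure set T -> \bar R}) (D : set T) (f : T -> R) :
  measurable D -> mu.-integrable D (EFin \o f) -> (forall t, D t -> 0 <= f t) ->
  \int[mu]_(t in D) f t <= 0 -> {ae mu, forall t, D t -> f t = 0}.
Proof.
move=> mD fi f0 fle; have mf := measurable_int _ fi.
have h0 : (\int[mu]_(t in D) `|(EFin \o f) t| = 0)%E.
  rewrite (eq_integral (EFin \o f)); last first.
    by move=> t /set_mem Dt; rewrite /= ger0_norm ?f0.
  rewrite -[LHS]fineK; last exact: integrable_fin_num fi.
  congr EFin; apply/eqP; rewrite eq_le fle/=.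
  by apply: fine_ge0; apply: integral_ge0 => t Dt; rewrite lee_fin f0.
by apply: filterS (iffLR (ae_eq_integral_abs mu mD mf) h0) => t + Dt => /(_ Dt) [].
Qed.

Lemma EFin_leb_int {R : realType} (D : set R) (h : R -> R) :
  measurable (D : set (LebR R)) -> leb_integrable D h ->
  (\int[leb R]_(t in (D : set (LebR R))) (h t)%:E)%E = (leb_int D h)%:E.
Proof.
by move=> mD hi; rewrite /leb_int /Rintegral fineK//; exact: (integrable_fin_num mD hi).
Qed.

Lemma leb_int_le0_ae {R : realType} (D : set R) (f : R -> R) :
  measurable (D : set (LebR R)) -> leb_integrable D f -> (forall t, D t -> 0 <= f t) ->
  leb_int D f <= 0 -> {ae leb R, forall t : LebR R, D t -> f t = 0}.
Proof. exact: (@ge0_Rintegral_le0_ae _ (LebR R) R (leb R)). Qed.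

Lemma enorm_pair_le {R : realType} {n : nat} (v : 'rV[R]_n) (h : R) :
  enorm_pair v h <= enorm v + `|h|.
Proof.
rewrite /enorm_pair -[leRHS]ger0_norm; last by rewrite addr_ge0// enorm_ge0.
rewrite -sqrtr_sqr ler_wsqrtr// sqrrD (real_normK (num_real h)) enorm_sqr.
by rewrite lerD2r lerDl mulrn_wge0// mulr_ge0// enorm_ge0.
Qed.

(** * A priori bounds along a minimizer *)

Section Minimizer.
Opaque leb_int leb_integrable.
Context {R : realType} {n : nat}.
Notation V := 'rV[R]_n.
Variables (a b : R) (H : R -> V -> V -> R) (c : R -> R) (k : R -> R -> R).
Variables (r A : R) (x0 : V).
Notation D := (`[a, b]%classic : set R).
Hypothesis ab : a <= b.
Hypothesis rhk : forall rho, 0 < rho -> regular_hamiltonian a b H c (k rho) rho.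
Hypothesis x0A : 1 + enorm x0 <= A.
Hypothesis rA : A * expR (leb_int `[a, b] c) <= r.
Hypothesis H00i : leb_integrable D (fun t => H t 0 0).
Variables (g : V -> R) (L k0 e1 : R).
Hypothesis L0 : 0 <= L.
Hypothesis gL : forall y z, enorm y <= r -> enorm z <= r ->
  `|g y - g z| <= L * enorm (y - z).
Hypothesis k0P : leb_int D (k r) <= k0.
Hypothesis e1P : expR (leb_int D (fun s => 2 * k r s)) <= e1.

Let mD : measurable (D : set (LebR R)). Proof. exact: measurable_leb_itv. Qed.

Let A1 : 1 <= A.
Proof. by apply: le_trans x0A; rewrite lerDl enorm_ge0. Qed.

Let r0 : 0 < r.
Proof. by apply: lt_le_trans rA; rewrite mulr_gt0 ?expR_gt0// (lt_le_trans ltr01). Qed.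

Let rh := rhk _ r0.
Let c0 := rh_c0 _ _ _ _ _ _ rh.
Let ci := rh_ci _ _ _ _ _ _ rh.

(* [Q * \int_E c] bounds what the repair of the stopped arc adds to the cost. *)
Let Q : R := (2 + 2 * L) * ((1 + r) * (1 + k0) * e1) + L * r.
Let Q0 : 0 <= Q.
Proof.
have k00 : 0 <= k0 by apply: le_trans k0P; apply: leb_int_ge0; exact: (rh_K0 _ _ _ _ _ _ rh).
have e10 : 0 <= e1 := le_trans (expR_ge0 _) e1P.
by rewrite addr_ge0 ?(mulr_ge0 L0 (ltW r0))// !mulr_ge0 ?addr_ge0 ?(ltW r0)// mulr_ge0.
Qed.

Let low t : R := `|H t 0 0| + r * k r t.
Let lam1 t : R := low t + Q * c t.

Let lam1i : leb_integrable D lam1.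
Proof.
have Ki := rh_Ki _ _ _ _ _ _ rh.
exact: (leb_integrableD _ _ _ mD (leb_integrableD _ _ _ mD (integrable_abse H00i)
  (leb_integrableZ _ _ r mD Ki)) (leb_integrableZ _ _ Q mD ci)).
Qed.

(** Stop the constant arc at all times: with [E] the whole line, the epigraph condition off [E] is
    void. *)
Lemma finite_cost : exists y : R -> V, admissible b a x0 y /\
  (Theta H g b a y < +oo)%E.
Proof.
have s0 : slow a b c A (fun=> 0 : V).
  split=> [i|t Dt]; first exact: measurable_vec_cst.
  rewrite enorm0; apply: mulr_ge0; first exact: le_trans A1.
  by apply: mulr_ge0 (c0 _ Dt) (expR_ge0 _).
have [y [yadm yTh]] := stopped_competitor _ _ _ _ _ _ _ _ ab rh x0A rA H00i setT (fun=> 0 : V) (fun=> 0)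
  measurableT s0 (leb_integrable_cst a b 0) (fun _ _ nT => False_ind _ (nT I)) g L k0 e1 L0 gL k0P e1P.
by exists y; split=> //; apply: le_lt_trans yTh (ltry _).
Qed.

Variable xb : R -> V.
Hypothesis xbmin : minimizer H g b a x0 xb.

Lemma minimizer_cost_fin : (Theta H g b a xb < +oo)%E.
Proof. by have [y [/xbmin.2 le ylt]] := finite_cost; apply: le_lt_trans ylt. Qed.

Lemma minimizer_velocity : exists f0 : R -> V, [/\ vec_integrable D f0,
  forall t, a <= t -> t <= b -> xb t = traj a x0 f0 t &
  {ae leb R, forall t : LebR R, a <= t -> t <= b -> derive1 xb t = f0 t}].
Proof.
have [[acxb xba] _] := xbmin; have [f0 if0] := abs_cont_primitive _ _ _ ab acxb.
rewrite xba => xbE; exists f0; split=> //.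
by apply: (vint_derive1 _ _ _ x0) => // t at_ tb; rewrite xbE.
Qed.

(** Finiteness of the optimal cost makes [H^*] finite almost everywhere along the minimizer.
    Changing velocity and cost on a null set gives real functions on all of [D], to which stopping
    applies. *)
Lemma minimizer_epigraph : exists f h, [/\ slow a b c A f /\ leb_integrable D h,
  forall t, a <= t -> t <= b -> xb t = traj a x0 f t,
  forall t, D t -> h t <= lam1 t -> forall p, dotv (f t) p <= H t (xb t) p + h t,
  {ae leb R, forall t : LebR R, D t -> derive1 xb t = f t /\
     Hstar H t (xb t) (derive1 xb t) = (h t)%:E} &
  Theta H g b a xb = (g (xb b) + leb_int D h)%:E].
Proof.
have [f0 [if0 xbE df0]] := minimizer_velocity.
have DP t : D t -> a <= t /\ t <= b by rewrite /= in_itv/= => /andP[].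
have DI t : a <= t -> t <= b -> D t by move=> at_ tb; rewrite /= in_itv/= at_.
have if0n := enorm_integrable _ _ mD if0.
(* A crude bound on the arc, needed to have a Lipschitz constant of [H] at hand. *)
pose N := enorm x0 + leb_int D (fun t => enorm (f0 t)).
have xbN t : D t -> enorm (xb t) <= N.
  move=> /DP[at_ tb]; rewrite xbE//; apply: le_trans (enormD _ _) _; rewrite lerD2l.
  apply: (@le_trans _ _ (leb_int `[a, t] (fun t => enorm (f0 t)))).
    apply: enorm_vint_le => //; first exact: measurable_leb_itv.
      exact: vec_integrable_sub (lexx a) tb if0.
    exact: leb_integrable_sub (lexx a) tb if0n.
  by apply: (leb_int_nd _ _ _ _ _ if0n) => // s _ _; exact: enorm_ge0.
have N0 : 0 <= N by rewrite addr_ge0 ?enorm_ge0// leb_int_ge0// => t _; exact: enorm_ge0.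
have rho0 : 0 < N + 1 by rewrite ltr_wpDl.
have rhN := rhk _ rho0.
have xbN1 t : D t -> enorm (xb t) < N + 1 by move=> /xbN xN; rewrite (le_lt_trans xN)// ltrDl.
have KN0 := rh_K0 _ _ _ _ _ _ rhN; have KNi := rh_Ki _ _ _ _ _ _ rhN.
have mxb : leb_measurable_vec D xb.
  have := measurable_vecD _ _ _ (measurable_vec_cst _ x0) (vint_measurable _ _ _ if0).
  move=> mx i; apply: eq_measurable_fun (mx i) => t /set_mem/DP[at_ tb].
  by rewrite xbE.
have mHxb p : leb_measurable_fun D (fun t => H t (xb t) p).
  apply: (@measurable_fun_lip_comp _ (LebR R) R n D (fun t x => H t x p)
    (fun t => k (N + 1) t * (1 + enorm p)) xb (N + 1)).
  - by move=> x; exact: (rh_meas _ _ _ _ _ _ rh).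
  - exact: measurable_funM (leb_integrable_measurable _ _ KNi) (measurable_cst _).
  - by move=> t Dt; apply: mulr_ge0 (KN0 _ Dt) _; rewrite addr_ge0// enorm_ge0.
  - by move=> t Dt x x' xr x'r; exact: (rh_Kr _ _ _ _ _ _ rhN).
  - exact: mxb.
  - exact: xbN1.
have lxb t : D t -> lip_rV (c t * (1 + enorm (xb t))) (H t (xb t)).
  by move=> Dt p q; apply: le_trans (ler_norm _) (rh_lip _ _ _ _ _ _ rh t Dt _ _ _).
pose psi (t : LebR R) : \bar R := Hstar H t (xb t) (f0 t).
have mf0 : leb_measurable_vec D f0 by move=> i; exact: leb_integrable_measurable (if0 i).
have mpsi : measurable_fun (D : set (LebR R)) psi by exact: Hstar_measurable lxb mf0.
have psiTheta : (Theta H g b a xb = (g (xb b))%:E +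
    \int[leb R]_(t in (D : set (LebR R))) psi t)%E.
  rewrite /Theta; congr (_ + _)%E.
  apply/esym/(complete_ae_integral _ completed_lebesgue_measure_is_complete) => //.
  by apply: (ae_leb_imply _ _ df0) => t h /DP[at_ tb]; rewrite /psi h.
have psii : (leb R).-integrable (D : set (LebR R)) psi.
  apply: (@integrable_lower_bounded _ (LebR R) R (leb R) D psi
    (fun t => `|H t 0 0| + (N + 1) * k (N + 1) t)) => //.
  - exact: (leb_integrableD _ _ _ mD (integrable_abse H00i) (leb_integrableZ _ _ (N + 1) mD KNi)).
  - move=> t Dt; rewrite [_ * k _ _]mulrC; apply: Hstar_lower_bound.
    + exact: KN0.
    + exact: ltW (xbN1 t Dt).
    + exact: (rh_Kr _ _ _ _ _ _ rhN).
  - have := minimizer_cost_fin; rewrite psiTheta.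
    by case: (\int[leb R]_(t in (D : set (LebR R))) psi t)%E => [z||] //; rewrite ?ltry.
pose G t := psi t \is a fin_num.
have aeG : {ae leb R, forall t : LebR R, D t -> G t} := integrable_ae mD psii.
pose f t := if G t then f0 t else 0.
(* The value [lam1 + 1] places the times of non-finite cost in the set [h > lam1], where no epigraph
   inequality is claimed. *)
pose h t := if G t then fine (psi t) else lam1 t + 1.
have aef : {ae leb R, forall t : LebR R, D t -> f0 t = f t}.
  by apply: (ae_leb_imply _ _ aeG) => t h1 Dt; rewrite /f h1.
have aeh : {ae leb R, forall t : LebR R, D t -> psi t = (h t)%:E}.
  by apply: (ae_leb_imply _ _ aeG) => t h1 Dt; rewrite /h h1// fineK//; exact: h1.
have hi : leb_integrable D h.
  exact: (@complete_ae_integrable _ (LebR R) R (leb R)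
    completed_lebesgue_measure_is_complete D psi (EFin \o h) mD aeh psii).
have if_ : vec_integrable D f.
  move=> i; apply: (ae_leb_integrable _ _ _ mD (if0 i)).
  by apply: (ae_leb_imply _ _ aef) => t h1 Dt; rewrite h1.
have xbf t : a <= t -> t <= b -> xb t = traj a x0 f t.
  move=> at_ tb; rewrite xbE// /traj; congr (_ + _); apply/rowP => i; rewrite !mxE.
  apply: ae_leb_int.
  - exact: measurable_itv.
  - exact: leb_integrable_measurable (vec_integrable_sub _ _ _ _ _ (lexx a) tb if0 i).
  - apply: (ae_leb_imply _ _ aef) => s h1; rewrite /= in_itv/= => /andP[as_ st].
    by rewrite h1//; apply: DI => //; exact: le_trans st tb.
have fb t : D t -> enorm (f t) <= c t * (1 + enorm (xb t)).
  move=> Dt; have cx : 0 <= c t * (1 + enorm (xb t)).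
    by apply: mulr_ge0 (c0 _ Dt) _; rewrite addr_ge0// enorm_ge0.
  rewrite /f; case: ifPn => [Gt|_]; last by rewrite enorm0.
  apply: (Hstar_dom_bound _ _ _ _ _ cx (lxb t Dt)).
  by move: Gt; rewrite /G /psi fin_numE => /andP[_]; rewrite ltey.
have icx : leb_integrable D (fun t => c t * (1 + enorm (xb t))).
  have icN : leb_integrable D (fun t => (1 + N) * c t) := leb_integrableZ _ _ _ mD ci.
  apply: (le_leb_integrable _ _ _ mD _ _ icN).
    apply: measurable_funM (leb_integrable_measurable _ _ ci) _.
    exact: measurable_funD (measurable_cst _) (measurable_enorm _ _ mxb).
  move=> t Dt; rewrite [(1 + N) * _]mulrC normrM (ger0_norm (c0 _ Dt)).
  rewrite ger0_norm; last by rewrite addr_ge0// enorm_ge0.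
  by apply: (ler_wpM2l (c0 _ Dt)); rewrite lerD2l; exact: xbN.
(* Gronwall replaces [N], which depends on the arc, by a bound in terms of [A] and [c] alone. *)
have xbC t : a <= t -> t <= b -> 1 + enorm (xb t) <= A * expR (leb_int `[a, t] c).
  have c0' s : a <= s -> s <= b -> 0 <= c s by move=> as_ sb; apply: c0; exact: DI.
  apply: (gronwall _ _ _ ab ci c0' (fun t => 1 + enorm (xb t)) A (1 + N) (le_trans ler01 A1)
    _ icx).
    by move=> s as_ sb; rewrite lerD2l; apply: xbN; exact: DI.
  move=> s as_ sb; rewrite xbf//.
  have iv : enorm (vint `[a, s] f) <=
      leb_int `[a, s] (fun t => c t * (1 + enorm (xb t))).
    apply: enorm_vint_le.
    - exact: measurable_leb_itv.
    - exact: vec_integrable_sub (lexx a) sb if_.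
    - exact: leb_integrable_sub (lexx a) sb icx.
    - move=> q; rewrite /= in_itv/= => /andP[aq qs]; apply: fb; apply: DI => //.
      exact: le_trans qs sb.
  apply: le_trans (lerD x0A iv); rewrite -addrA lerD2l; exact: enormD.
have sf : slow a b c A f.
  split=> [i|t Dt]; first exact: leb_integrable_measurable (if_ i).
  apply: le_trans (fb t Dt) _; rewrite [leRHS]mulrCA; apply: (ler_wpM2l (c0 _ Dt)).
  by have [at_ tb] := DP t Dt; exact: xbC.
exists f, h; split=> //.
- move=> t Dt; rewrite /h /f; case: ifPn => [Gt _|_]; last by rewrite gerDl ler10.
  by apply/HstarP; rewrite fineK.
- apply: (@ae_imply2 _ (LebR R) R (leb R) _ _ _ df0 (ae_leb_imply2 _ _ _ aef aeh (fun t h1 h2 Dt =>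
    conj (h1 Dt) (h2 Dt)))) => t h1 h2 Dt.
  have [at_ tb] := DP t Dt; have [ff hh] := h2 Dt.
  by rewrite h1//; split=> //.
- rewrite psiTheta EFinD -(EFin_leb_int _ _ mD hi); congr (_ + _)%E.
  exact: (@complete_ae_integral _ (LebR R) R (leb R)
    completed_lebesgue_measure_is_complete D psi (EFin \o h) mD aeh mpsi).
Qed.

Theorem minimizer_bound : {ae leb R, forall t : LebR R, t \in `[a, b] ->
  bounded_by H xb (fun t => lam1 t + r * c t) t}.
Proof.
have [f [h [[sf hi] xbf fh aefh ThE]]] := minimizer_epigraph.
have DP t : D t -> a <= t /\ t <= b by rewrite /= in_itv/= => /andP[].
pose B t := lam1 t < h t.
pose E : set R := D `&` [set t | B t].
have mlam := leb_integrable_measurable _ _ lam1i; have mh := leb_integrable_measurable _ _ hi.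
have mE : measurable (E : set (LebR R)).
  have := @measurable_fun_ltr _ (LebR R) R D lam1 h mlam mh mD [set true] I.
  by congr measurable; apply/seteqP; split=> t [].
have fh' t : D t -> ~ E t -> forall p, dotv (f t) p <= H t (traj a x0 f t) p + h t.
  move=> Dt nEt p; have [at_ tb] := DP t Dt; rewrite -xbf//; apply: fh => //.
  by rewrite leNgt; apply/negP => Bt; exact: nEt.
have [y [yadm]] := stopped_competitor _ _ _ _ _ _ _ _ ab rh x0A rA H00i E f h mE sf hi fh' g L k0 e1
  L0 gL k0P e1P.
move=> /(le_trans (xbmin.2 _ yadm)); rewrite ThE lee_fin -xbf// -[leLHS]addr0 lerD2l.
rewrite oppr_ge0 -[leb_int D (fun _ => _)]/(leb_int D (fun t => \1_E t * (h t - lam1 t))) => gle.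
have E01 t : 0 <= (\1_E t : R) <= 1 by rewrite indicE; case: (_ \in _); rewrite ?lexx ler01.
have gap0 t : D t -> 0 <= \1_E t * (h t - lam1 t).
  move=> Dt; rewrite indicE; case: (boolP (t \in E)) => [|_]; last by rewrite mul0r.
  by rewrite inE => -[_ /ltW Bt]; rewrite mul1r subr_ge0.
have gapi : leb_integrable D (fun t => \1_E t * (h t - lam1 t)).
  have hl := leb_integrableB _ _ _ mD hi lam1i.
  apply: (le_leb_integrable _ _ _ mD _ _ (integrable_abse hl)).
    apply: measurable_funM (@measurable_indic _ (LebR R) R D E mE) _.
    exact: leb_integrable_measurable hl.
  move=> t _; rewrite normrM ler_piMl//.
  by have /andP[h1 h2] := E01 t; rewrite ger0_norm.
apply: (@ae_imply2 _ (LebR R) R (leb R) _ _ _ aefh (leb_int_le0_ae _ _ mD gapi gap0 gle)).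
move=> t h1 h2 Dt; have [dxb hE] := h1 Dt.
have hlam : h t <= lam1 t.
  rewrite leNgt; apply/negP => Bt; have := h2 Dt; rewrite indicE mem_set// mul1r.
  by apply/eqP; rewrite gt_eqF// subr_gt0.
have [at_ tb] := DP t Dt.
(* Testing [p = 0] bounds the cost from below, so that the estimate by [lam1] becomes one of
   [|h|]. *)
have hlow : - low t <= h t.
  rewrite -lee_fin -hE /low [r * _]mulrC; apply: Hstar_lower_bound.
  - exact: (rh_K0 _ _ _ _ _ _ rh).
  - rewrite xbf//; exact: ltW (traj_lt _ _ _ _ _ _ _ _ ab rh x0A rA _ _ sf Dt).
  - exact: (rh_Kr _ _ _ _ _ _ rh).
have lowlam : low t <= lam1 t by rewrite /lam1 lerDl; exact: mulr_ge0 Q0 (c0 _ Dt).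
rewrite /bounded_by hE dxb; split=> //=.
apply: le_trans (enorm_pair_le _ _) _; rewrite addrC; apply: lerD.
  by rewrite ler_norml hlam andbT; apply: le_trans hlow; rewrite lerN2.
exact: (slow_le _ _ _ _ _ _ _ _ rh x0A rA _ _ sf Dt).
Qed.

End Minimizer.

(** * Uniformity in the initial time and point, and conclusion *)

Lemma regular_hamiltonian_sub {R : realType} {n : nat} (a b s t : R)
    (H : R -> 'rV[R]_n -> 'rV[R]_n -> R) (c K : R -> R) (r : R) :
  a <= s -> t <= b -> regular_hamiltonian a b H c K r -> regular_hamiltonian s t H c K r.
Proof.
move=> as_ tb rh.
have sub : `[s, t]%classic `<=` (`[a, b]%classic : set R).
  by apply: subset_itv; rewrite bnd_simp.
split.
- move=> x p; apply: (@measurable_funS _ _ (LebR R) R `[a, b] `[s, t] _ _ sub).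
    exact: measurable_leb_itv.
  exact: rh_meas rh x p.
- by move=> q /sub; exact: (rh_conv _ _ _ _ _ _ rh).
- by move=> q /sub; exact: (rh_c0 _ _ _ _ _ _ rh).
- exact: leb_integrable_sub as_ tb (rh_ci _ _ _ _ _ _ rh).
- by move=> q /sub; exact: (rh_lip _ _ _ _ _ _ rh).
- by move=> q /sub; exact: (rh_K0 _ _ _ _ _ _ rh).
- exact: leb_integrable_sub as_ tb (rh_Ki _ _ _ _ _ _ rh).
- by move=> q /sub; exact: (rh_Kr _ _ _ _ _ _ rh).
Qed.

(** All constants are computed on [[a, b]]. The integrands are nonnegative, so their integrals over
    [[s, b]] are no larger, and one pair [r], [Q] serves every initial time [s] and every initial
    point of norm at most [M]. *)
Lemma minimizer_bound_uniform {R : realType} {n : nat} (a b : R)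
    (H : R -> 'rV[R]_n -> 'rV[R]_n -> R) (c : R -> R) (k : R -> R -> R)
    (g : 'rV[R]_n -> R) (M : R) :
  (forall rho, 0 < rho -> regular_hamiltonian a b H c (k rho) rho) ->
  leb_integrable `[a, b] (fun t => H t 0 0) -> locally_lipschitz g -> 0 <= M ->
  exists r Q : R, 0 < r /\ forall (s : R) (x0 : 'rV[R]_n), a <= s -> s <= b ->
    enorm x0 <= M -> forall xb, minimizer H g b s x0 xb ->
    {ae leb R, forall t : LebR R, t \in `[s, b] ->
      bounded_by H xb (fun t => `|H t 0 0| + r * k r t + Q * c t + r * c t) t}.
Proof.
move=> rhk H00i gl M0; pose r := (1 + M) * expR (leb_int `[a, b] c).
have M1 : 0 < 1 + M by rewrite ltr_pwDl.
have r0 : 0 < r by rewrite mulr_gt0// expR_gt0.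
have rh := rhk r r0; have [L L0 gL] := locally_lipschitz_ball g r gl.
pose k0 := leb_int `[a, b] (k r); pose e1 := expR (leb_int `[a, b] (fun s => 2 * k r s)).
exists r, ((2 + 2 * L) * ((1 + r) * (1 + k0) * e1) + L * r); split=> // s x0 as_ sb x0M xb xbmin.
have mD : measurable (`[a, b]%classic : set (LebR R)) by exact: measurable_leb_itv.
have mS : measurable (`[s, b]%classic : set (LebR R)) by exact: measurable_leb_itv.
have sub : `[s, b]%classic `<=` (`[a, b]%classic : set R).
  by apply: subset_itv; rewrite bnd_simp.
have Ki := rh_Ki _ _ _ _ _ _ rh; have K0 := rh_K0 _ _ _ _ _ _ rh.
have ci := rh_ci _ _ _ _ _ _ rh; have c0 := rh_c0 _ _ _ _ _ _ rh.
have rhs rho : 0 < rho -> regular_hamiltonian s b H c (k rho) rho.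
  by move=> rho0; exact: regular_hamiltonian_sub as_ (lexx b) (rhk rho rho0).
have x0A : 1 + enorm x0 <= 1 + M by rewrite lerD2l.
have rA : (1 + M) * expR (leb_int `[s, b] c) <= r.
  apply: (ler_wpM2l (ltW M1)); rewrite ler_expR.
  exact: leb_int_subset_le mS mD sub ci c0.
have k0P : leb_int `[s, b] (k r) <= k0 by exact: leb_int_subset_le mS mD sub Ki K0.
have K20 t : (`[a, b]%classic : set R) t -> 0 <= 2 * k r t.
  by move=> Dt; exact: mulr_ge0 (ler0n _ 2) (K0 _ Dt).
have e1P : expR (leb_int `[s, b] (fun s => 2 * k r s)) <= e1.
  by rewrite ler_expR; exact: leb_int_subset_le mS mD sub (leb_integrableZ _ _ 2 mD Ki) K20.
have H00s := leb_integrable_sub _ _ _ _ _ as_ (lexx b) H00i.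
exact: (minimizer_bound _ _ _ _ _ _ _ _ sb rhs x0A rA H00s g L k0 e1 L0 gL k0P e1P xb xbmin).
Qed.

Lemma within_continuous_comp {S U W : topologicalType} (A : set S) (B : set U)
    (phi : S -> U) (f : U -> W) :
  continuous phi -> (forall t, A t -> B (phi t)) ->
  {within B, continuous f} -> {within A, continuous (f \o phi)}.
Proof.
move=> cphi AB cf; apply/subspace_continuousP => t At P /= fP.
have h := iffLR (subspace_continuousP _ _) cf (phi t) (AB _ At) P fP.
have {}h : \forall s \near t, B (phi s) -> P (f (phi s)) := cphi t _ h.
by apply: (@filterS _ (nbhs t) _ _ _ _ h) => s + As => /(_ (AB _ As)).
Qed.

Theorem theorem7p4 (R : realType) (n : nat) (T : R)
  (H : R -> 'rV[R]_n -> 'rV[R]_n -> R) (c : R -> R) (k : R -> R -> R)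
  (g : 'rV[R]_n -> R) :
  0 < T ->
  (* (H1) H(., x, p) Lebesgue measurable on [0,T] *)
  (forall x p : 'rV[R]_n,
     measurable_fun (`[0, T] : set (LebR R)) (fun t : LebR R => H t x p)) ->
  (* (H2) H(t, ., .) continuous *)
  (forall t, t \in `[0, T] ->
     continuous (fun z : 'rV[R]_n * 'rV[R]_n => H t z.1 z.2)) ->
  (* (H3) H(t, x, .) convex *)
  (forall t, t \in `[0, T] -> forall x p q : 'rV[R]_n, forall a : R,
     0 <= a -> a <= 1 ->
     H t x (a *: p + (1 - a) *: q) <= a * H t x p + (1 - a) * H t x q) ->
  (* (H4) with c >= 0 integrable (hence measurable) on [0,T] *)
  (forall t, t \in `[0, T] -> 0 <= c t) ->
  (leb R).-integrable (`[0, T] : set (LebR R)) (fun t : LebR R => (c t)%:E) ->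
  (forall t, t \in `[0, T] -> forall x p q : 'rV[R]_n,
     `|H t x p - H t x q| <= c t * (1 + enorm x) * enorm (p - q)) ->
  (* (HLC) with k_R >= 0 integrable (hence measurable) on [0,T] *)
  (forall r : R, 0 < r -> forall t, t \in `[0, T] -> 0 <= k r t) ->
  (forall r : R, 0 < r ->
     (leb R).-integrable (`[0, T] : set (LebR R)) (fun t : LebR R => (k r t)%:E)) ->
  (forall r : R, 0 < r -> forall t, t \in `[0, T] -> forall x y p : 'rV[R]_n,
     enorm x <= r -> enorm y <= r ->
     `|H t x p - H t y p| <= k r t * (1 + enorm p) * enorm (x - y)) ->
  (* t |-> H(t, 0, 0) integrable on [0,T] *)
  (leb R).-integrable (`[0, T] : set (LebR R)) (fun t : LebR R => (H t 0 0)%:E) ->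
  (* g locally Lipschitz *)
  locally_lipschitz g ->
  forall M : R, 0 < M ->
    (exists lam : R -> R,
       (leb R).-integrable (`[0, T] : set (LebR R)) (fun t : LebR R => (lam t)%:E) /\
       forall (t0 : R) (x0 : 'rV[R]_n), t0 \in `[0, T] -> enorm x0 <= M ->
       forall xb : R -> 'rV[R]_n, minimizer H g T t0 x0 xb ->
         {ae leb R, forall t : LebR R, t \in `[t0, T] -> bounded_by H xb lam t})
    /\
    ({within [set z : R * ('rV[R]_n * 'rV[R]_n) | z.1 \in `[0, T]],
        continuous (fun z => H z.1 z.2.1 z.2.2)} ->
     {within `[0, T], continuous c} ->
     (forall r : R, 0 < r -> {within `[0, T], continuous (k r)}) ->
     exists lam : R -> R,
       {within `[0, T], continuous lam} /\
       forall (t0 : R) (x0 : 'rV[R]_n), t0 \in `[0, T] -> enorm x0 <= M ->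
       forall xb : R -> 'rV[R]_n, minimizer H g T t0 x0 xb ->
         {ae leb R, forall t : LebR R, t \in `[t0, T] -> bounded_by H xb lam t}).
Proof.
move=> _ mH _ cvxH c0 ci lipH k0 ki kH H00i gl M M0.
have rhk rho : 0 < rho -> regular_hamiltonian 0 T H c (k rho) rho.
  move=> rho0; split.
  - exact: mH.
  - by move=> t tT x p q s s0 s1; exact: cvxH.
  - exact: c0.
  - exact: ci.
  - exact: lipH.
  - exact: k0.
  - exact: ki.
  - exact: kH.
have [r [Q [r0 bound]]] := minimizer_bound_uniform _ _ _ _ _ _ _ rhk H00i gl (ltW M0).
pose lam t := `|H t 0 0| + r * k r t + Q * c t + r * c t.
have lamP (t0 : R) (x0 : 'rV[R]_n) : t0 \in `[0, T] -> enorm x0 <= M ->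
    forall xb : R -> 'rV[R]_n, minimizer H g T t0 x0 xb ->
    {ae leb R, forall t : LebR R, t \in `[t0, T] -> bounded_by H xb lam t}.
  by rewrite in_itv/= => /andP[t00 t0T] x0M xb; exact: bound.
split=> [|cH cc ck]; exists lam; split=> //.
- have mD : measurable (`[0, T]%classic : set (LebR R)) by exact: measurable_leb_itv.
  exact: (leb_integrableD _ _ _ mD (leb_integrableD _ _ _ mD
    (leb_integrableD _ _ _ mD (integrable_abse H00i) (leb_integrableZ _ _ r mD (ki r r0)))
    (leb_integrableZ _ _ Q mD ci)) (leb_integrableZ _ _ r mD ci)).
- have cH0 : {within `[0, T], continuous (fun t => H t 0 0)}.
    have cphi : continuous (fun t : R => (t, (0, 0)) : R * ('rV[R]_n * 'rV[R]_n)).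
      by move=> t; exact: cvg_pair cvg_id (cvg_cst _).
    exact: (@within_continuous_comp R _ R `[0, T] [set z | z.1 \in `[0, T]] _
      (fun z : R * ('rV[R]_n * 'rV[R]_n) => H z.1 z.2.1 z.2.2) cphi (fun _ => id) cH).
  move=> t; apply: cvgD; first apply: cvgD; first apply: cvgD.
  + by apply: cvg_norm; exact: cH0.
  + exact: cvgM (cvg_cst _) (ck r r0 t).
  + exact: cvgM (cvg_cst _) (cc t).
  + exact: cvgM (cvg_cst _) (cc t).
Qed.
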